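(* Let $M$ be a compact Riemannian manifold and $k\in\mathbb{N}$. An openly $1/k$ geodesic in $M$ is uniquely determined by any collection of $k$ evenly spaced points on it, up to reparametrization by an isometry of $S^1$. That is, if $\gamma,\sigma:S^1\to M$ are openly $1/k$ geodesics and there are $s_0,t_0\in S^1$ such that $$\sigma(s_0+2\pi j/k)=\gamma(t_0+2\pi j/k)\qquad\text{for } j=0,1,\dots,k-1,$$ then there is an isometry $\varphi$ of $S^1$ with $\sigma=\gamma\circ\varphi$.
   Context: Manifolds are connected and without boundary. $S^1=\mathbb{R}/2\pi\mathbb{Z}$. A closed geodesic in $M$ is a nonconstant map $\gamma:S^1\to M$ that is locally length minimizing around every point of $S^1$, parametrized proportionally to arclength with speed $L(\gamma)/(2\pi)$, where $L(\gamma)$ is its length. A $1/k$ geodesic is a closed geodesic $\gamma$ with $d(\gamma(t),\gamma(t+2\pi/k))=L(\gamma)/k$ for all $t\in S^1$. The injectivity radius of a closed geodesic $\gamma$ is $\mathrm{injrad}(\gamma)=\inf_{t\in S^1}h_t$, where $h_t$ is the supremum of all $h$ such that the arc of $\gamma$ of length $h$ starting at $\gamma(t)$ (in the positive direction) is length minimizing between its endpoints. An openly $1/k$ geodesic is a $1/k$ geodesic $\gamma$ with $\mathrm{injrad}(\gamma)>L(\gamma)/k$. *)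

(* Defs.v *)
From HB Require Import structures.
From mathcomp Require Import all_boot all_order all_algebra generic_quotient.
From mathcomp Require Import all_classical all_reals all_analysis.

Set Implicit Arguments.
Unset Strict Implicit.
Unset Printing Implicit Defensive.

Import Order.TTheory GRing.Theory Num.Theory.
Import numFieldNormedType.Exports.

Local Open Scope classical_set_scope.
Local Open Scope ring_scope.
Local Open Scope quotient_scope.

Section SmoothMaps.
Context {R : realType} {V W : normedModType R}.

(* Only meaningful for U open. On R^n, being C^k in this sense (all iterated
   directional derivatives up to order k exist and are continuous on U) is the
   usual C^k condition on partial derivatives. *)
Fixpoint Ck_on (k : nat) (U : set V) (f : V -> W) : Prop :=
  (forall x, U x -> {for x, continuous f}) /\
  if k is k'.+1 then
    forall v, (forall x, U x -> derivable f x v) /\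
              Ck_on k' U (fun x => 'D_v f x)
  else True.

Definition smooth_on (U : set V) (f : V -> W) : Prop :=
  forall k, Ck_on k U f.

End SmoothMaps.

Record chart (R : realType) (n : nat) (M : topologicalType) := Chart {
  cdom : set M;
  cmap : M -> 'rV[R]_n;
  cinv : 'rV[R]_n -> M;
  cdom_open : open cdom;
  cimg_open : open (cmap @` cdom);
  cmapK : forall p, cdom p -> cinv (cmap p) = p;
  cmap_continuous : forall p, cdom p -> {for p, continuous cmap};
  cinv_continuous : forall x, (cmap @` cdom) x -> {for x, continuous cinv}
}.

Record smooth_manifold (R : realType) (n : nat) := SmoothManifold {
  carrier :> topologicalType;
  atlas_index : Type;
  atlas : atlas_index -> chart R n carrier;
  manifold_hausdorff : hausdorff_space carrier;
  manifold_second_countable : @second_countable carrier;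
  manifold_connected : connected [set: carrier];
  atlas_cover : forall p : carrier, exists i, cdom (atlas i) p;
  atlas_smooth : forall i j,
    smooth_on (cmap (atlas i) @` (cdom (atlas i) `&` cdom (atlas j)))
              (cmap (atlas j) \o cinv (atlas i))
}.

Definition bilin (R : realType) (n : nat) (A : 'M[R]_n) (v w : 'rV[R]_n) : R :=
  (v *m A *m w^T) 0 0.

(* [metric i x] is the Gram matrix, at the point of coordinates x, of the
   coordinate vector fields of the i-th chart. *)
Record riemannian_manifold (R : realType) (n : nat) := RiemannianManifold {
  manifold :> smooth_manifold R n;
  metric : atlas_index manifold -> 'rV[R]_n -> 'M[R]_n;
  metric_smooth : forall i,
    smooth_on (cmap (atlas i) @` cdom (atlas i)) (metric i);
  metric_symmetric : forall i (p : manifold), cdom (atlas i) p ->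
    (metric i (cmap (atlas i) p))^T = metric i (cmap (atlas i) p);
  metric_pos : forall i (p : manifold), cdom (atlas i) p ->
    forall v, v != 0 -> 0 < bilin (metric i (cmap (atlas i) p)) v v;
  metric_compat : forall i j (p : manifold),
    cdom (atlas i) p -> cdom (atlas j) p ->
    let x := cmap (atlas i) p in
    let tau := cmap (atlas j) \o cinv (atlas i) in
    forall v w, bilin (metric i x) v w =
                bilin (metric j (cmap (atlas j) p)) ('D_v tau x) ('D_w tau x)
}.

Section RiemannianDistance.
Context {R : realType} {n : nat} (M : riemannian_manifold R n).
Implicit Types (c : R -> M) (p q : M).

Definition chart_at p : atlas_index M := sval (cid (atlas_cover p)).

Definition speed c (t : R) : R :=
  let i := chart_at (c t) in
  let v := derive1 (cmap (atlas i) \o c) t in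
  Num.sqrt (bilin (metric i (cmap (atlas i) (c t))) v v).

Definition C1_curve_on (J : set R) c : Prop :=
  forall t, J t -> {for t, continuous c} /\
    forall i, cdom (atlas i) (c t) ->
      derivable (cmap (atlas i) \o c) t 1 /\
      {for t, continuous (derive1 (cmap (atlas i) \o c))}.

(* C^1 up to the end points, i.e. extendable to a C^1 curve on an open
   interval containing [a, b]. *)
Definition C1_curve_on_segment (a b : R) c : Prop :=
  exists2 c' : R -> M,
    exists2 e : R, 0 < e & C1_curve_on `]a - e, b + e[ c' &
    {in `[a, b], c =1 c'}.

Definition piecewise_C1 (a b : R) c : Prop :=
  exists2 s : seq R, itv_partition a b s &
    forall i, (i < size s)%N ->
      C1_curve_on_segment (nth b (a :: s) i) (nth b (a :: s) i.+1) c.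

(* At the finitely many break points of a piecewise C^1 curve the value of
   [speed] is irrelevant. *)
Definition dist p q : R :=
  inf [set l | exists c, [/\ piecewise_C1 0 1 c, c 0 = p, c 1 = q &
                 l = \int[lebesgue_measure]_(t in `[0, 1]) speed c t]].

Definition curve_length c (a b : R) : \bar R :=
  ereal_sup [set (\sum_(0 <= i < size s)
                    dist (c (nth b (a :: s) i)) (c (nth b (a :: s) i.+1)))%:E
            | s in itv_partition a b].

Definition length_minimizing c (a b : R) : Prop :=
  curve_length c a b = (dist (c a) (c b))%:E.

End RiemannianDistance.

Section Circle.
Context (R : realType).

Definition circle_rel : rel R :=
  fun s t => `[< exists m : int, s - t = 2 * pi * m%:~R >].

Lemma circle_rel_equiv : equiv_class_of circle_rel.
Proof.
split=> [x|x y|y x z].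
- by apply/asboolP; exists 0; rewrite subrr mulr0.
- apply/asboolP/asboolP => -[m h]; exists (- m);
  by rewrite mulrNz mulrN -h opprB.
- move=> /asboolP[m h] /asboolP[m' h']; apply/asboolP; exists (m + m').
  by rewrite mulrzDr mulrDr -h -h' addrA subrK.
Qed.

Canonical circle_equiv := EquivRelPack circle_rel_equiv.

(* R / 2 pi Z *)
Definition circle := {eq_quot circle_rel}.

Definition circle_pt (t : R) : circle := \pi_{eq_quot circle_rel} t.

(* The point x + s of the circle. *)
Definition circle_shift (x : circle) (s : R) : circle :=
  circle_pt (repr (x : {eq_quot circle_rel}) + s).

Definition circle_dist (x y : circle) : R :=
  inf [set d | exists s t : R,
         [/\ circle_pt s = x, circle_pt t = y & d = `|s - t|]].

Definition circle_isometry (phi : circle -> circle) : Prop :=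
  bijective phi /\
  forall x y, circle_dist (phi x) (phi y) = circle_dist x y.

End Circle.

Section ClosedGeodesics.
Context {R : realType} {n : nat} {M : riemannian_manifold R n}.
Implicit Types (gamma : circle R -> M).

Definition loop_length gamma : R :=
  fine (curve_length (gamma \o @circle_pt R) 0 (2 * pi)).

(* Taking a = 0 and b = 2 pi in the second clause shows that the length is
   finite. *)
Definition closed_geodesic gamma : Prop :=
  [/\ exists x y, gamma x <> gamma y,
      forall a b : R, a <= b ->
        curve_length (gamma \o @circle_pt R) a b =
        (loop_length gamma / (2 * pi) * (b - a))%:E &
      forall t : R, exists2 e : R, 0 < e &
        forall a b : R, t - e < a -> a <= b -> b < t + e ->
          length_minimizing (gamma \o @circle_pt R) a b].

Definition one_over_geodesic (k : nat) gamma : Prop :=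
  closed_geodesic gamma /\
  forall t : circle R,
    dist (gamma t) (gamma (circle_shift t (2 * pi / k%:R))) =
    loop_length gamma / k%:R.

Definition arc_minimizing gamma (t : circle R) (h : R) : Prop :=
  length_minimizing (gamma \o circle_shift t)
    0 (2 * pi * h / loop_length gamma).

Definition injrad_at gamma (t : circle R) : \bar R :=
  ereal_sup [set h%:E | h in [set h | 0 <= h /\ arc_minimizing gamma t h]].

Definition injrad gamma : \bar R :=
  ereal_inf [set injrad_at gamma t | t in [set: circle R]].

Definition openly_one_over_geodesic (k : nat) gamma : Prop :=
  one_over_geodesic k gamma /\
  ((loop_length gamma / k%:R)%:E < injrad gamma)%E.

End ClosedGeodesics.

(* Main.v *)
Require Import Defs.
From mathcomp Require Import all_boot all_order all_algebra generic_quotient.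
From mathcomp Require Import all_classical all_reals all_analysis.
From mathcomp Require Import measurable_realfun.
From mathcomp Require Import ring lra.

Set Implicit Arguments.
Unset Strict Implicit.
Unset Printing Implicit Defensive.

Import Order.TTheory GRing.Theory Num.Theory.
Import numFieldNormedType.Exports.

Local Open Scope classical_set_scope.
Local Open Scope ring_scope.

(** Write [c] and [d] for the lifts of [gamma] and [sigma] to the line, issued
    from the points [t0] and [s0], and [T] for [2 pi / k].  Both curves run from
    the common point [c 0] to the common point [c T] and both realize the
    distance of these two points, so they have the same speed [v].  Since the
    injectivity radii exceed the length of the arcs over [[0, T]], the arc of [c]
    is still minimizing on a slightly longer interval [[0, T']].  By the triangle
    inequality the curve [u] that follows [d] up to [T] and [c] afterwards is
    minimizing on [[0, T']] as well.  Now [u] and [d] coincide before [T], and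
    minimizing geodesics do not branch: [d = u = c] shortly after [T].  Any arc
    of either curve over an interval of length [T] is minimizing, and by
    compactness the scale at which branching is excluded
    ([uniform_nonbranching]) is the same at all points of [M], so the agreement
    propagates by steps of a fixed length to the whole circle.  Hence
    [sigma] is [gamma] composed with a rotation.

    The geodesics are only known as curves that realize distances, so
    non-branching ([local_nonbranching]) is proved without a differential
    equation, by a quantitative discrete argument in a chart.  It rests on a
    third order comparison of the Riemannian distance with the metric [g] in
    coordinates ([midpoint_distance]): with [m] the midpoint of [x] and [y] and
    [e = y - x], the square of the distance of [x] and [y] is
    [g_m(e, e) + O(|e| ^ 4)].  The upper bound ([dist_chart_upper]) is the length
    of the coordinate segment.  The lower bound ([dist_chart_lower]) is a
    calibration: an explicit quadratic polynomial increases by [g_m(e, e)] from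
    [x] to [y], while its differential has norm at most
    [sqrt (g_m(e, e)) * (1 + O(|e| ^ 2))] near [m].

    Cut two minimizing geodesics which coincide at first into [N] pieces of
    length [h].  Moving the vertices [1], ..., [k] of such a chain by [a] in a
    coordinate direction cannot decrease the sum of the distances; expanding
    this sum gives a discrete Euler-Lagrange equation for the chain
    ([discrete_euler_lagrange]), and choosing [a = h * t] makes its error
    [h * O(t + h / t)].  The discrete Gronwall inequality bounds the distance of
    the end points of the two chains by [O(t + h / t)]
    ([minimizing_chains_close]).  Letting first [h] and then [t] tend to zero,
    the end points coincide. *)

(** * Bilinear forms and the sup norm of row vectors *)

Section RowVectors.
Context {R : realType} {n : nat}.
Implicit Types (A B : 'M[R]_n) (u v w x y : 'rV[R]_n).

Lemma bilinE A v w :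
  bilin A v w = \sum_i \sum_j A i j * (v 0 i * w 0 j).
Proof.
rewrite /bilin !mxE exchange_big /=; apply: eq_bigr => j _.
rewrite !mxE mulr_suml; apply: eq_bigr => i _; rewrite mulrA; congr (_ * _).
by rewrite mulrC.
Qed.

Lemma bilinDl A u v w : bilin A (u + v) w = bilin A u w + bilin A v w.
Proof. by rewrite /bilin !mulmxDl mxE. Qed.

Lemma bilinZl A a v w : bilin A (a *: v) w = a * bilin A v w.
Proof. by rewrite /bilin -!scalemxAl mxE. Qed.

Lemma bilinDr A u v w : bilin A w (u + v) = bilin A w u + bilin A w v.
Proof. by rewrite /bilin linearD /= mulmxDr mxE. Qed.

Lemma bilinZr A a v w : bilin A w (a *: v) = a * bilin A w v.
Proof. by rewrite /bilin linearZ /= -scalemxAr mxE. Qed.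

Lemma bilinNl A v w : bilin A (- v) w = - bilin A v w.
Proof. by rewrite -scaleN1r bilinZl mulN1r. Qed.

Lemma bilinNr A v w : bilin A w (- v) = - bilin A w v.
Proof. by rewrite -scaleN1r bilinZr mulN1r. Qed.

Lemma bilinBl A u v w : bilin A (u - v) w = bilin A u w - bilin A v w.
Proof. by rewrite bilinDl bilinNl. Qed.

Lemma bilinBr A u v w : bilin A w (u - v) = bilin A w u - bilin A w v.
Proof. by rewrite bilinDr bilinNr. Qed.

Lemma bilin0l A w : bilin A 0 w = 0.
Proof. by rewrite -(scale0r 0) bilinZl mul0r. Qed.

Lemma bilin_mxB A B v w : bilin (A - B) v w = bilin A v w - bilin B v w.
Proof. by rewrite /bilin mulmxBr mulmxBl !mxE. Qed.

Lemma bilin_mxZ a A v w : bilin (a *: A) v w = a * bilin A v w.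
Proof. by rewrite /bilin -scalemxAr -scalemxAl mxE. Qed.

Lemma bilin_mx_sum (I : finType) (A : I -> 'M[R]_n) v w :
  bilin (\sum_i A i) v w = \sum_i bilin (A i) v w.
Proof. by rewrite /bilin mulmx_sumr mulmx_suml summxE. Qed.

Lemma bilin_sym A v w : A^T = A -> bilin A v w = bilin A w v.
Proof.
move=> sA; rewrite !bilinE exchange_big /=; apply: eq_bigr => i _.
by apply: eq_bigr => j _; rewrite -{1}sA mxE [v 0 j * _]mulrC.
Qed.

Lemma bilin_row A v w : bilin A v w = \sum_j w 0 j * bilin A v (delta_mx 0 j).
Proof.
rewrite {1}(row_sum_delta w) /bilin linear_sum mulmx_sumr summxE.
by apply: eq_bigr => j _; rewrite linearZ -scalemxAr mxE.
Qed.

Lemma le_coord_norm v j : `|v 0 j| <= `|v|.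
Proof.
rewrite [leRHS]/Num.Def.normr/= mx_normrE.
exact: (le_bigmax _ (fun ij => `|v ij.1 ij.2|) (0, j)).
Qed.

Lemma row_norm_le v (e : R) : 0 <= e -> (forall j, `|v 0 j| <= e) -> `|v| <= e.
Proof.
move=> e0 ve; rewrite [leLHS]/Num.Def.normr/= mx_normrE.
by rewrite (bigmax_le _ e0)// => -[i j] _ /=; rewrite (ord1 i).
Qed.

Lemma norm_delta_le1 (j : 'I_n) : `|delta_mx 0 j : 'rV[R]_n| <= 1.
Proof.
apply: row_norm_le => // i; rewrite mxE; case: eqP => // _; case: eqP => _;
by rewrite ?normr1 ?normr0.
Qed.

Lemma bilin_norm_le A (e : R) v w :
  (forall i j, `|A i j| <= e) -> `|bilin A v w| <= n%:R ^+ 2 * e * `|v| * `|w|.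
Proof.
move=> Ae; rewrite bilinE.
have -> : n%:R ^+ 2 * e * `|v| * `|w| =
    \sum_(i < n) \sum_(j < n) e * (`|v| * `|w|).
  by rewrite !sumr_const !card_ord -[RHS]mulr_natl -[X in _ = _ * X]mulr_natl; ring.
apply: le_trans (ler_norm_sum _ _ _) _; apply: ler_sum => i _.
apply: le_trans (ler_norm_sum _ _ _) _; apply: ler_sum => j _.
rewrite !normrM; apply: ler_pM => //.
by apply: ler_pM => //; exact: le_coord_norm.
Qed.

End RowVectors.

(** * A mean value inequality along coordinate directions *)

Section MeanValue.
Context {R : realType} {n : nat}.
Implicit Types (x y z : 'rV[R]_n) (F : 'rV[R]_n -> R).

Lemma is_derive_line {W : normedModType R} (F : 'rV[R]_n -> W) z v (t : R) d :
  is_derive (z + t *: v) v F d -> is_derive t 1 (fun s => F (z + s *: v)) d.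
Proof.
move=> [dF <-].
have E : (fun h : R => h^-1 *: (((fun s => F (z + s *: v)) \o shift t) (h *: 1)
             - F (z + t *: v))) =
         (fun h => h^-1 *: ((F \o shift (z + t *: v)) (h *: v) - F (z + t *: v))).
  apply/funext => h /=; congr (_ *: (F _ - _)).
  by rewrite [h *: 1]mulr1 scalerDl addrCA.
by split; rewrite /derivable /derive /= E.
Qed.

Lemma mean_value_line (f df : R -> R) (a e s : R) :
  (forall t : R, `|t| <= `|s| -> is_derive t 1 f (df t) /\ `|df t - a| <= e) ->
  `|f s - f 0 - a * s| <= e * `|s|.
Proof.
move=> H.
have main p q : p <= q -> `|p| <= `|s| -> `|q| <= `|s| ->
    `|f q - f p - a * (q - p)| <= e * (q - p).
  move=> pq ps qs.
  have I t : t \in `[p, q]%R -> `|t| <= `|s|.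
    rewrite in_itv /= => /andP[pt tq]; move: ps qs; rewrite !ler_norml.
    by move=> /andP[p1 p2] /andP[q1 q2]; apply/andP; split; lra.
  have D t : t \in `[p, q]%R -> is_derive t 1 f (df t) by move=> /I /H[].
  have C : {within `[p, q], continuous f}.
    by apply: derivable_within_continuous => t /D[].
  have D' t : t \in `]p, q[%R -> is_derive t 1 f (df t).
    by move=> /subset_itv_oo_cc; exact: D.
  have [c cpq ->] := MVT_segment pq D' C.
  rewrite -mulrBl normrM (ger0_norm (_ : 0 <= q - p)) ?subr_ge0//.
  by apply: ler_wpM2r; [rewrite subr_ge0|exact: (H _ (I _ cpq)).2].
have [s0|s0] := leP 0 s.
  by have := main 0 s s0; rewrite !subr0 normr0 normr_ge0 lexx (ger0_norm s0); exact.
have := main s 0 (ltW s0); rewrite normr0 normr_ge0 lexx (ltr0_norm s0) sub0r.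
move=> /(_ isT isT); congr (_ <= _); rewrite -normrN; congr `|_|; ring.
Qed.

(** Moving from [x] to [y] one coordinate at a time stays inside the sup-norm
    ball of radius [`|y - x|], so partial derivatives alone control the
    increment.  With [a = 0] this is a Lipschitz bound; with [a] the gradient
    at [x] it is a first order Taylor estimate. *)
Lemma mean_value_coord F (DF : 'I_n -> 'rV[R]_n -> R) (a : 'I_n -> R) (e : R) x y :
  (forall z, `|z - x| <= `|y - x| -> forall j,
     is_derive z (delta_mx 0 j) F (DF j z) /\ `|DF j z - a j| <= e) ->
  `|F y - F x - \sum_j (y - x) 0 j * a j| <= n%:R * e * `|y - x|.
Proof.
move=> H.
have [n0|/eqP n0] := eqVneq n 0.
  have -> : y = x by apply/rowP => -[i i_n]; exfalso; rewrite n0 in i_n.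
  rewrite !subrr normr0 mulr0 big1 ?subrr ?normr0// => j _.
  by rewrite !mxE mul0r.
have e0 : 0 <= e.
  have j0 : 'I_n by case: (n) n0 => // m _; exact: ord0.
  by have /(_ _ j0)[] := H x; rewrite ?subrr ?normr0// => _; exact: le_trans.
pose z k : 'rV[R]_n := \row_j (if (j < k)%N then y 0 j else x 0 j).
have z0 : z 0%N = x by apply/rowP => j; rewrite mxE.
have zn : z n = y by apply/rowP => j; rewrite mxE ltn_ord.
rewrite -{1}z0 -{1}zn -(telescope_sumr (fun k => F (z k)) (leq0n n)) big_mkord.
rewrite -sumrB; apply: le_trans (ler_norm_sum _ _ _) _.
have -> : n%:R * e * `|y - x| = \sum_(i < n) e * `|y - x|.
  by rewrite sumr_const card_ord -[RHS]mulr_natl mulrA.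
apply: ler_sum => k _.
pose s := (y - x) 0 k; pose f t := F (z k + t *: delta_mx 0 k).
have sxy : `|s| <= `|y - x| by exact: le_coord_norm.
have -> : z k.+1 = z k + s *: delta_mx 0 k.
  apply/rowP => j; rewrite !mxE eqxx /=; have [->|jk] := eqVneq j k.
    by rewrite ltnSn ltnn mulr1 /s !mxE addrC subrK.
  by rewrite ltnS leq_eqVlt (negPf (jk : (val j != val k))) mulr0 addr0.
have := @mean_value_line f (fun t => DF k (z k + t *: delta_mx 0 k)) (a k) e s.
rewrite {2 3}/f scale0r addr0 [a k * s]mulrC => M.
apply: (le_trans (M _)); last exact: ler_wpM2l.
move=> t ts; have [|D1 D2] := H (z k + t *: delta_mx 0 k) _ k.
  apply: row_norm_le => // j; rewrite !mxE eqxx /=.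
  have [->|jk] := eqVneq j k.
    by rewrite ltnn mulr1 addrAC subrr add0r; exact: le_trans ts sxy.
  rewrite mulr0 addr0; case: ifP => _; last by rewrite subrr normr0.
  by have := le_coord_norm (y - x) j; rewrite !mxE.
by split => //; exact: is_derive_line.
Qed.

End MeanValue.

(** * A discrete Euler-Lagrange equation *)

Section DiscreteGeodesics.
Context {R : realType} {n : nat}.
Implicit Types (x y z u w m : 'rV[R]_n).

Definition midpoint x y : 'rV[R]_n := 2^-1 *: (x + y).

(** All the estimates on a smooth metric and its partial derivatives on a
    coordinate ball that are used below, with one constant. *)
Record regular_metric (x0 : 'rV[R]_n) (r K : R)
    (G : 'rV[R]_n -> 'M[R]_n) (DG : 'I_n -> 'rV[R]_n -> 'M[R]_n) : Prop :=
  RegularMetric {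
  rm_K1 : 1 <= K;
  rm_sym : forall z, `|z - x0| <= r -> (G z)^T = G z;
  rm_bound : forall z u w, `|z - x0| <= r ->
    `|bilin (G z) u w| <= K * `|u| * `|w|;
  rm_elliptic : forall z u, `|z - x0| <= r -> `|u| ^+ 2 <= K * bilin (G z) u u;
  rm_lipschitz : forall z y u w, `|z - x0| <= r -> `|y - x0| <= r ->
    `|bilin (G y) u w - bilin (G z) u w| <= K * `|y - z| * `|u| * `|w|;
  rm_dbound : forall j z u w, `|z - x0| <= r ->
    `|bilin (DG j z) u w| <= K * `|u| * `|w|;
  rm_dlipschitz : forall j z y u w, `|z - x0| <= r -> `|y - x0| <= r ->
    `|bilin (DG j y) u w - bilin (DG j z) u w| <= K * `|y - z| * `|u| * `|w|;
  rm_taylor : forall z y u w, `|z - x0| <= r -> `|y - x0| <= r ->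
    `|bilin (G y) u w - bilin (G z) u w
       - \sum_j (y - z) 0 j * bilin (DG j z) u w|
    <= K * `|y - z| ^+ 2 * `|u| * `|w|
}.

(** Evaluating the metric at the midpoint removes the first order term of its
    expansion.  The errors in the squared distances are therefore of fourth
    order, and over the [1 / h] steps of a subdivision of mesh [h] they add up
    to [O(h ^ 3)] only. *)
Record midpoint_distance (x0 : 'rV[R]_n) (r K rho : R)
    (G : 'rV[R]_n -> 'M[R]_n) (D : 'rV[R]_n -> 'rV[R]_n -> R) : Prop :=
  MidpointDistance {
  md_ge0 : forall x y, 0 <= D x y;
  md_upper : forall x y, `|x - x0| <= r -> `|y - x0| <= r ->
    D x y ^+ 2 <= bilin (G (midpoint x y)) (y - x) (y - x) + K * `|y - x| ^+ 4;
  md_lower : forall x y, `|x - x0| <= r -> `|y - x0| <= r -> D x y <= rho ->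
    bilin (G (midpoint x y)) (y - x) (y - x) <= D x y ^+ 2 + K * D x y ^+ 4;
  md_lipschitz : forall x y, `|x - x0| <= r -> `|y - x0| <= r -> D x y <= rho ->
    `|y - x| <= K * D x y
}.

Context (x0 : 'rV[R]_n) (r K rho : R).
Context (G : 'rV[R]_n -> 'M[R]_n) (DG : 'I_n -> 'rV[R]_n -> 'M[R]_n).
Context (D : 'rV[R]_n -> 'rV[R]_n -> R).
Hypothesis GP : regular_metric x0 r K G DG.
Hypothesis DP : midpoint_distance x0 r K rho G D.

Let K1 : 1 <= K := rm_K1 GP.
Let K0 : 0 <= K. Proof. exact: le_trans K1. Qed.

Lemma midpoint_ball x y (e : R) :
  `|x - x0| <= e -> `|y - x0| <= e -> `|midpoint x y - x0| <= e.
Proof.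
move=> xe ye; have -> : midpoint x y - x0 = 2^-1 *: ((x - x0) + (y - x0)).
  by apply/rowP => i; rewrite !mxE; field.
rewrite normrZ ger0_norm//; have := ler_normD (x - x0) (y - x0); lra.
Qed.

Let e_ (j : 'I_n) : 'rV[R]_n := delta_mx 0 j.

(** The effect of the variation on the two steps at which it starts and stops:
    the step changes by [b *: e_ j], with [b = a] or [b = - a], and its midpoint
    moves half as far. *)
Lemma energy_ramp m j u (a b h : R) :
  `|m - x0| <= r -> `|m + (a / 2) *: e_ j - x0| <= r ->
  0 <= h -> `|a| <= h -> `|b| = `|a| -> `|u| <= K * h ->
  bilin (G (m + (a / 2) *: e_ j)) (u + b *: e_ j) (u + b *: e_ j) <=
  bilin (G m) u u + 2 * b * bilin (G m) u (e_ j) +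
  K * a ^+ 2 + 2 * K ^+ 3 * `|a| * h ^+ 2.
Proof.
move=> mr m'r h0 ah ba uh; set u' := u + b *: e_ j.
have e1 := norm_delta_le1 j : `|e_ j| <= 1.
have u'h : `|u'| <= 2 * K * h.
  apply: le_trans (ler_normD _ _) _; rewrite normrZ ba.
  have : `|a| * `|e_ j| <= h * 1 by apply: ler_pM.
  have : h <= K * h by apply: ler_peMl.
  lra.
have E : bilin (G m) u' u' = bilin (G m) u u + 2 * b * bilin (G m) u (e_ j)
    + b ^+ 2 * bilin (G m) (e_ j) (e_ j).
  rewrite /u' !(bilinDl, bilinDr, bilinZl, bilinZr).
  by rewrite (bilin_sym (e_ j) u (rm_sym GP mr)); ring.
have b2 : b ^+ 2 = a ^+ 2 by rewrite -real_normK ?num_real// ba real_normK ?num_real.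
have eK : bilin (G m) (e_ j) (e_ j) <= K.
  apply: le_trans (ler_norm _) _; apply: le_trans (rm_bound GP _ _ mr) _.
  rewrite -mulrA -[leRHS]mulr1; apply: ler_wpM2l => //; rewrite -[leRHS]mulr1.
  exact: ler_pM.
have := rm_lipschitz GP u' u' mr m'r; rewrite [m + _ - m]addrAC subrr add0r normrZ.
move=> /(le_trans (ler_norm _)) L.
have {}L : bilin (G (m + (a / 2) *: e_ j)) u' u' - bilin (G m) u' u' <=
    2 * K ^+ 3 * `|a| * h ^+ 2.
  apply: (le_trans L); rewrite normrM (ger0_norm (_ : 0 <= 2^-1))//.
  have -> : 2 * K ^+ 3 * `|a| * h ^+ 2 = K * (`|a| / 2 * 1) * (2 * K * h) * (2 * K * h).
    by field.
  apply: ler_pM => //; first by rewrite !mulr_ge0.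
  apply: ler_pM => //; first by rewrite !mulr_ge0.
  apply: ler_wpM2l => //; apply: ler_wpM2l e1.
  by rewrite mulr_ge0.
have : a ^+ 2 * bilin (G m) (e_ j) (e_ j) <= a ^+ 2 * K.
  by apply: ler_wpM2l => //; rewrite sqr_ge0.
rewrite E b2 in L; lra.
Qed.

(** The effect of the variation on the steps that it translates: only the point
    at which the metric is evaluated changes. *)
Lemma energy_shift m j u (a h : R) :
  `|m - x0| <= r -> `|m + a *: e_ j - x0| <= r -> 0 <= h -> `|u| <= K * h ->
  bilin (G (m + a *: e_ j)) u u <=
  bilin (G m) u u + a * bilin (DG j m) u u + K ^+ 3 * a ^+ 2 * h ^+ 2.
Proof.
move=> mr m'r h0 uh.
have := rm_taylor GP u u mr m'r; rewrite [m + _ - m]addrAC subrr add0r.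
have -> : \sum_k (a *: e_ j) 0 k * bilin (DG k m) u u = a * bilin (DG j m) u u.
  rewrite (bigD1 j) //= !mxE !eqxx mulr1 big1 ?addr0// => k kj.
  by rewrite !mxE (negPf kj) mulr0 mul0r.
move=> /(le_trans (ler_norm _)) T.
suff : K * `|a *: e_ j| ^+ 2 * `|u| * `|u| <= K ^+ 3 * a ^+ 2 * h ^+ 2 by lra.
have -> : K ^+ 3 * a ^+ 2 * h ^+ 2 = K * (`|a| * 1) ^+ 2 * (K * h) * (K * h).
  by rewrite -(real_normK (num_real a)); ring.
have ae : `|a *: e_ j| ^+ 2 <= (`|a| * 1) ^+ 2.
  rewrite lerXn2r// ?nnegrE ?mulr_ge0// normrZ ler_wpM2l//.
  exact: norm_delta_le1.
have ge0 p q : 0 <= p -> 0 <= q -> 0 <= p * q ^+ 2 :> R.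
  by move=> ? ?; rewrite mulr_ge0 ?exprn_ge0.
apply: ler_pM => //; first by rewrite mulr_ge0 ?ge0.
by apply: ler_pM => //; [exact: ge0|exact: ler_pM (sqr_ge0 _) _ _].
Qed.

(** Competitors are confined to the ball of radius [r] but the chain itself to
    the half ball, so that small variations of the chain are competitors. *)
Record minimizing_chain (c : nat -> 'rV[R]_n) (N : nat) (h : R) : Prop :=
  MinimizingChain {
  mc_ball : forall i, (i <= N)%N -> `|c i - x0| <= r / 2;
  mc_step : forall i, (i < N)%N -> D (c i) (c i.+1) = h;
  mc_minimal : forall c' : nat -> 'rV[R]_n,
    (forall i, (i <= N)%N -> `|c' i - x0| <= r) -> c' 0%N = c 0%N -> c' N = c N ->
    N%:R * h <= \sum_(0 <= i < N) D (c' i) (c' i.+1)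
}.

Section EulerLagrange.
Context (c : nat -> 'rV[R]_n) (N : nat) (h : R).
Hypothesis h_gt0 : 0 < h.
Hypothesis Nh1 : N%:R * h <= 1.
Hypothesis h_rho : h <= rho.
Hypothesis h_r : h <= r / 2.
Hypothesis cP : minimizing_chain c N h.

Let c_ball i : (i <= N)%N -> `|c i - x0| <= r / 2.
Proof. exact: (mc_ball cP). Qed.
Let c_step i : (i < N)%N -> D (c i) (c i.+1) = h.
Proof. exact: (mc_step cP). Qed.
Let c_minimal := mc_minimal cP.

Let step i := c i.+1 - c i.
Let mid i := midpoint (c i) (c i.+1).

Let h0 : 0 <= h. Proof. exact: ltW. Qed.

Let c_ball' i : (i <= N)%N -> `|c i - x0| <= r.
Proof. by move=> /c_ball; move: h_gt0 h_r => hp hr; lra. Qed.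

Let sum_const (a : R) : \sum_(0 <= i < N) a = N%:R * a.
Proof. by rewrite sumr_const_nat subn0 -[LHS]mulr_natl. Qed.

Lemma step_le i : (i < N)%N -> `|step i| <= K * h.
Proof.
move=> iN; rewrite -(c_step iN); apply: (md_lipschitz DP).
- exact: c_ball' (ltnW iN).
- exact: c_ball' iN.
- by rewrite c_step.
Qed.

Lemma mid_ball i : (i < N)%N -> `|mid i - x0| <= r / 2.
Proof. by move=> iN; apply: midpoint_ball; apply: c_ball => //; exact: ltnW. Qed.

(** The first variation of the energy, for a translation by [a] of the vertices
    [1], ..., [k].  Among chains with given ends, equal steps minimize the sum of
    the squared distances, and these squares are the energies of the steps up to
    an error which sums up to [17 K^5 h^3]. *)
Lemma energy_variation (k : nat) j (a : R) : (0 < k < N)%N -> `|a| <= h ->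
  0 <= a * (2 * (bilin (G (mid 0)) (step 0) (e_ j)
                 - bilin (G (mid k)) (step k) (e_ j))
            + \sum_(1 <= i < k) bilin (DG j (mid i)) (step i) (step i))
       + (3 * K ^+ 3 * a ^+ 2 + 4 * K ^+ 3 * `|a| * h ^+ 2 + 17 * K ^+ 5 * h ^+ 3).
Proof.
move=> /andP[k0 kN] ah; move: (h_gt0) (h_r) (K1) => hp hr K1'.
pose phi i : R := if (0 < i <= k)%N then a else 0.
pose c' i := c i + phi i *: e_ j.
pose step' i := c' i.+1 - c' i.
pose mid' i := midpoint (c' i) (c' i.+1).
have e1 := norm_delta_le1 j : `|e_ j| <= 1.
have phih i : `|phi i| <= h by rewrite /phi; case: ifP => // _; rewrite normr0.
have c'_ball i : (i <= N)%N -> `|c' i - x0| <= r.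
  move=> /c_ball ci; rewrite /c' addrAC; apply: le_trans (ler_normD _ _) _.
  rewrite normrZ; have : `|phi i| * `|e_ j| <= h * 1 by apply: ler_pM.
  lra.
have c'0 : c' 0%N = c 0%N by rewrite /c' /phi /= scale0r addr0.
have c'N : c' N = c N.
  by rewrite /c' /phi [(N <= k)%N]leqNgt kN andbF scale0r addr0.
have phiE i : (0 < i)%N -> (i <= k)%N -> phi i = a by rewrite /phi => -> ->.
have phi0 i : (k < i)%N -> phi i = 0 by rewrite /phi (leqNgt i) => ->; rewrite andbF.
have step'E i : step' i = step i + (phi i.+1 - phi i) *: e_ j.
  by rewrite /step' /c' /step scalerBl opprD addrACA.
have mid'E i : mid' i = mid i + ((phi i + phi i.+1) / 2) *: e_ j.
  rewrite /mid' /mid /midpoint /c' addrACA -scalerDl [LHS]scalerDr scalerA.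
  by rewrite [2^-1 * _]mulrC.
have step'_le i : (i < N)%N -> `|step' i| <= 2 * K * h.
  move=> iN; rewrite step'E; apply: le_trans (ler_normD _ _) _.
  have : `|phi i.+1 - phi i| <= h.
    rewrite /phi; case: ifP => _; case: ifP => _;
    by rewrite ?subrr ?normr0 ?subr0 ?sub0r ?normrN.
  rewrite normrZ => pp; have : `|phi i.+1 - phi i| * `|e_ j| <= h * 1 by apply: ler_pM.
  have : h <= K * h by apply: ler_peMl.
  have := step_le iN; lra.
pose E i := bilin (G (mid i)) (step i) (step i).
pose E' i := bilin (G (mid' i)) (step' i) (step' i).
have minE : 0 <= \sum_(0 <= i < N) (E' i - E i) + 17 * K ^+ 5 * h ^+ 3.
  have cN : N%:R * h ^+ 2 <= \sum_(0 <= i < N) D (c' i) (c' i.+1) ^+ 2.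
    (* the squares dominate their tangent at the mean step [h] *)
    have : \sum_(0 <= i < N) (2 * h * D (c' i) (c' i.+1) - h ^+ 2) <=
           \sum_(0 <= i < N) D (c' i) (c' i.+1) ^+ 2.
      apply: ler_sum => i _; have := sqr_ge0 (D (c' i) (c' i.+1) - h).
      by rewrite sqrrB; lra.
    apply: le_trans; rewrite sumrB -mulr_sumr sum_const.
    have M := c_minimal c'_ball c'0 c'N.
    have : 2 * h * (N%:R * h) <= 2 * h * \sum_(0 <= i < N) D (c' i) (c' i.+1).
      by apply: ler_wpM2l => //; rewrite mulr_ge0.
    by lra.
  have up : \sum_(0 <= i < N) D (c' i) (c' i.+1) ^+ 2 <=
            \sum_(0 <= i < N) (E' i + 16 * K ^+ 5 * h ^+ 4).
    rewrite !big_nat; apply: ler_sum => i /andP[_ iN].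
    have := md_upper DP (c'_ball _ (ltnW iN)) (c'_ball _ iN).
    move=> /le_trans; apply; rewrite lerD2l.
    have -> : 16 * K ^+ 5 * h ^+ 4 = K * (2 * K * h) ^+ 4 by ring.
    by apply: ler_wpM2l => //; rewrite lerXn2r ?nnegrE ?mulr_ge0// step'_le.
  have lo : \sum_(0 <= i < N) E i <= \sum_(0 <= i < N) (h ^+ 2 + K * h ^+ 4).
    rewrite !big_nat; apply: ler_sum => i /andP[_ iN].
    rewrite -(c_step iN); apply: (md_lower DP).
    - exact: c_ball' (ltnW iN).
    - exact: c_ball' iN.
    - by rewrite c_step.
  move: cN up lo; rewrite sumrB !big_split /= !sum_const.
  set S' := \sum_(0 <= i < N) E' i; set S := \sum_(0 <= i < N) E i.
  set S2 := \sum_(0 <= i < N) D _ _ ^+ 2 => cN up lo.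
  have K5 : K <= K ^+ 5 by rewrite -[leLHS]expr1 ler_weXn2l.
  have : N%:R * (16 * K ^+ 5 * h ^+ 4) + N%:R * (K * h ^+ 4) <= 17 * K ^+ 5 * h ^+ 3.
    have -> : N%:R * (16 * K ^+ 5 * h ^+ 4) + N%:R * (K * h ^+ 4) =
      (N%:R * h) * ((16 * K ^+ 5 + K) * h ^+ 3) by ring.
    have -> : 17 * K ^+ 5 * h ^+ 3 = 1 * (17 * K ^+ 5 * h ^+ 3) by rewrite mul1r.
    apply: ler_pM => //; rewrite ?mulr_ge0 ?addr_ge0 ?mulr_ge0 ?exprn_ge0//.
    by apply: ler_wpM2r; [exact: exprn_ge0|lra].
  by lra.
suff up : \sum_(0 <= i < N) (E' i - E i) <=
    a * (2 * (bilin (G (mid 0)) (step 0) (e_ j)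
                 - bilin (G (mid k)) (step k) (e_ j))
            + \sum_(1 <= i < k) bilin (DG j (mid i)) (step i) (step i))
       + (3 * K ^+ 3 * a ^+ 2 + 4 * K ^+ 3 * `|a| * h ^+ 2) by lra.
have mid_r i : (i < N)%N -> `|mid i - x0| <= r by move=> /mid_ball; lra.
have mid'_r i : (i < N)%N -> `|mid' i - x0| <= r.
  by move=> iN; apply: midpoint_ball; apply: c'_ball => //; exact: ltnW.
have N0 : (0 < N)%N by exact: leq_ltn_trans kN.
have h1 : h <= 1.
  by apply: le_trans Nh1; apply: ler_peMl => //; rewrite ler1n.
have -> : \sum_(0 <= i < N) (E' i - E i) = (E' 0%N - E 0%N) +
    (\sum_(1 <= i < k) (E' i - E i) +
     ((E' k - E k) + \sum_(k.+1 <= i < N) (E' i - E i))).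
  by rewrite -(big_ltn kN) -(big_cat_nat (n := k) k0 (ltnW kN)) -(big_ltn N0).
have F0 : E' 0%N - E 0%N <= 2 * a * bilin (G (mid 0)) (step 0) (e_ j) +
    K * a ^+ 2 + 2 * K ^+ 3 * `|a| * h ^+ 2.
  have m0 := mid_r _ N0; have := mid'_r _ N0.
  rewrite /E' step'E mid'E (phiE 1%N)// (_ : phi 0%N = 0)// add0r subr0 => m0'.
  by have := energy_ramp m0 m0' h0 ah erefl (step_le N0); rewrite /E; lra.
have Fk : E' k - E k <= - (2 * a) * bilin (G (mid k)) (step k) (e_ j) +
    K * a ^+ 2 + 2 * K ^+ 3 * `|a| * h ^+ 2.
  have mk := mid_r _ kN; have := mid'_r _ kN.
  rewrite /E' step'E mid'E (phiE k)// (phi0 k.+1)// addr0 sub0r => mk'.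
  by have := energy_ramp mk mk' h0 ah (normrN a) (step_le kN); rewrite /E; lra.
have Fmid : \sum_(1 <= i < k) (E' i - E i) <=
    a * \sum_(1 <= i < k) bilin (DG j (mid i)) (step i) (step i) + K ^+ 3 * a ^+ 2.
  have -> : a * \sum_(1 <= i < k) bilin (DG j (mid i)) (step i) (step i) =
    \sum_(1 <= i < k) a * bilin (DG j (mid i)) (step i) (step i).
    by rewrite mulr_sumr.
  have cst : \sum_(1 <= i < k) K ^+ 3 * a ^+ 2 * h ^+ 2 <= K ^+ 3 * a ^+ 2.
    rewrite sumr_const_nat -[leLHS]mulr_natl mulrCA -[leRHS]mulr1.
    apply: ler_wpM2l; first by rewrite mulr_ge0 ?sqr_ge0 ?exprn_ge0.
    rewrite -[leRHS]mulr1 expr2 mulrA; apply: ler_pM => //; first by rewrite mulr_ge0.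
    apply: le_trans Nh1; apply: ler_wpM2r => //; rewrite ler_nat.
    by rewrite (leq_trans (leq_subr _ _))// ltnW.
  suff : \sum_(1 <= i < k) (E' i - E i) <=
      \sum_(1 <= i < k) (a * bilin (DG j (mid i)) (step i) (step i)
                         + K ^+ 3 * a ^+ 2 * h ^+ 2).
    by move=> /le_trans; apply; rewrite big_split /= lerD2l.
  have aa : (a + a) / 2 = a by field.
  rewrite !big_nat; apply: ler_sum => i /andP[i1 ik].
  have iN : (i < N)%N by exact: ltn_trans kN.
  have mi := mid_r _ iN; have := mid'_r _ iN.
  rewrite /E' step'E mid'E (phiE i i1 (ltnW ik)) (phiE i.+1 isT ik) subrr scale0r addr0 aa.
  by move=> mi'; have := energy_shift mi mi' h0 (step_le iN); rewrite /E; lra.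
have Ftail : \sum_(k.+1 <= i < N) (E' i - E i) = 0.
  rewrite big_nat big1// => i /andP[ki iN].
  rewrite /E' step'E mid'E (phi0 i)// (phi0 i.+1) ?leqW//.
  by rewrite addr0 mul0r subrr scale0r !addr0 subrr.
have K13 : K <= K ^+ 3 by rewrite -[leLHS]expr1 ler_weXn2l.
have : K * a ^+ 2 <= K ^+ 3 * a ^+ 2 by rewrite ler_wpM2r ?sqr_ge0.
by rewrite Ftail; lra.
Qed.

(** Dividing [energy_variation] for [a = h * t] and [a = - (h * t)] by [h * t]
    leaves the error [34 K^5 h (t + h / t)], which is small compared with [h]
    once [t] is small and [h] is small compared with [t]. *)
Lemma discrete_euler_lagrange (k : nat) j (t : R) :
  (0 < k < N)%N -> 0 < t -> t <= 1 ->
  `|2 * (bilin (G (mid 0)) (step 0) (e_ j) - bilin (G (mid k)) (step k) (e_ j))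
    + \sum_(1 <= i < k) bilin (DG j (mid i)) (step i) (step i)|
  <= 34 * K ^+ 5 * h * (t + h / t).
Proof.
move=> kN t0 t1; set A := _ + _; move: (h_gt0) (K1) => hp K1'.
have ht : 0 < h * t by rewrite mulr_gt0.
have hth : `|h * t| <= h by rewrite gtr0_norm// ler_piMr.
have V1 := energy_variation j kN hth.
have := energy_variation j kN (_ : `|- (h * t)| <= h); rewrite normrN => /(_ hth) V2.
rewrite -/A (gtr0_norm ht) in V1; rewrite -/A (gtr0_norm ht) sqrrN in V2.
have K35 : K ^+ 3 <= K ^+ 5 by rewrite ler_weXn2l.
have B : 3 * K ^+ 3 * (h * t) ^+ 2 + 4 * K ^+ 3 * (h * t) * h ^+ 2 + 17 * K ^+ 5 * h ^+ 3
    <= (h * t) * (34 * K ^+ 5 * h * (t + h / t)).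
  have -> : (h * t) * (34 * K ^+ 5 * h * (t + h / t)) =
     K ^+ 5 * (34 * (h * t) ^+ 2) + K ^+ 5 * (34 * h ^+ 3) by field; lra.
  have : K ^+ 3 * (3 * (h * t) ^+ 2) <= K ^+ 5 * (3 * (h * t) ^+ 2).
    by rewrite ler_wpM2r// mulr_ge0 ?sqr_ge0.
  have : K ^+ 3 * (4 * (h * t) * h ^+ 2) <= K ^+ 5 * (4 * h ^+ 3).
    apply: ler_pM => //; [exact: exprn_ge0| |].
      by rewrite mulr_ge0 ?sqr_ge0// mulr_ge0// ltW.
    have : t * h ^+ 3 <= h ^+ 3 by rewrite ler_piMl ?exprn_ge0.
    by lra.
  have : 0 <= K ^+ 5 * (h * t) ^+ 2 by rewrite mulr_ge0 ?sqr_ge0 ?exprn_ge0.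
  have : 0 <= K ^+ 5 * h ^+ 3 by rewrite mulr_ge0 ?exprn_ge0.
  by lra.
rewrite ler_norml -(ler_pM2l ht) -(ler_pM2l ht A); apply/andP; split; lra.
Qed.

End EulerLagrange.

(** Subtracting the two discrete Euler-Lagrange equations bounds the
    difference of the [k]-th steps by the earlier differences; the discrete
    Gronwall inequality then makes the chains as close as the error term. *)
Lemma minimizing_chains_close (c d : nat -> 'rV[R]_n) (N : nat) (h t : R) :
  0 < h -> N%:R * h <= 1 -> h <= rho -> h <= r / 2 ->
  minimizing_chain c N h -> minimizing_chain d N h ->
  c 0%N = d 0%N -> c 1%N = d 1%N -> 0 < t -> t <= 1 ->
  `|c N - d N| <= expR (35 * n%:R * K ^+ 6) * (t + h / t).
Proof.
move=> hp Nh1 h_rho h_r cP dP cd0 cd1 t0 t1.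
have K1' := K1; have h0 := ltW hp.
set eta := t + h / t.
have h_eta : h <= eta.
  have : h <= h / t by rewrite ler_pdivlMr// ler_piMr.
  by rewrite /eta; lra.
have eta0 : 0 < eta by exact: lt_le_trans h_eta.
case: N => [|N] in Nh1 cP dP *.
  by rewrite cd0 subrr normr0 mulr_ge0 ?expR_ge0 ?ltW.
have h1 : h <= 1.
  by apply: le_trans Nh1; apply: ler_peMl => //; rewrite ler1n.
pose sc i := c i.+1 - c i; pose sd i := d i.+1 - d i.
pose mc i := midpoint (c i) (c i.+1); pose md i := midpoint (d i) (d i.+1).
pose W i := sc i - sd i; pose w i := c i - d i.
pose S k := \sum_(1 <= i < k) `|W i|.
have sch i : (i < N.+1)%N -> `|sc i| <= K * h by exact: step_le cP _.
have sdh i : (i < N.+1)%N -> `|sd i| <= K * h by exact: step_le dP _.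
have r0 : 0 <= r by lra.
have mcr i : (i < N.+1)%N -> `|mc i - x0| <= r.
  by move=> iN; apply: le_trans (mid_ball cP iN) _; lra.
have mdr i : (i < N.+1)%N -> `|md i - x0| <= r.
  by move=> iN; apply: le_trans (mid_ball dP iN) _; lra.
have wS k : (0 < k)%N -> `|w k| <= S k.
  move=> k0; have -> : w k = \sum_(1 <= i < k) W i.
    have WE i : W i = w i.+1 - w i.
      by apply/rowP => j; rewrite /W /sc /sd /w !mxE; ring.
    rewrite (eq_bigr _ (fun i _ => WE i)) telescope_sumr//.
    by rewrite /w cd1 subrr subr0.
  exact: ler_norm_sum.
have SS i k : (i <= k)%N -> S i <= S k.
  move=> ik; rewrite /S; have [i1|i1] := leqP 1 i.
    by rewrite (big_cat_nat i1 ik) /= lerDl sumr_ge0.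
  by rewrite [leLHS]big_geq ?sumr_ge0// ltnW.
have mw i : `|mc i - md i| <= `|w i| + `|W i| / 2.
  have -> : mc i - md i = w i + 2^-1 *: W i.
    by apply/rowP => j; rewrite /mc /md /w /W /sc /sd /midpoint !mxE; field.
  apply: le_trans (ler_normD _ _) _; rewrite normrZ (ger0_norm (_ : 0 <= 2^-1))//.
  by rewrite mulrC.
have qdiff i k j : (0 < i < k)%N -> (k <= N)%N ->
    `|bilin (DG j (mc i)) (sc i) (sc i) - bilin (DG j (md i)) (sd i) (sd i)| <=
    K ^+ 3 * h ^+ 2 * S k + 3 * K ^+ 3 * h * `|W i|.
  move=> /andP[i0 ik] kN.
  have iN : (i < N.+1)%N by rewrite ltnS (leq_trans (ltnW ik)).
  have -> : bilin (DG j (mc i)) (sc i) (sc i) - bilin (DG j (md i)) (sd i) (sd i) =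
    (bilin (DG j (mc i)) (sc i) (sc i) - bilin (DG j (md i)) (sc i) (sc i)) +
    (bilin (DG j (md i)) (W i) (sc i) + bilin (DG j (md i)) (sd i) (W i)).
    by rewrite /W bilinBl bilinBr; ring.
  have b1 := rm_dlipschitz GP j (sc i) (sc i) (mdr _ iN) (mcr _ iN).
  have b2 := rm_dbound GP j (W i) (sc i) (mdr _ iN).
  have b3 := rm_dbound GP j (sd i) (W i) (mdr _ iN).
  have c1 : K * `|mc i - md i| * `|sc i| * `|sc i| <=
            K * (S k + `|W i| / 2) * (K * h) * (K * h).
    have Sk : `|mc i - md i| <= S k + `|W i| / 2.
      by have := mw i; have := wS _ i0; have := SS _ _ (ltnW ik); lra.
    apply: ler_pM; rewrite ?mulr_ge0 ?sch//.
    by apply: ler_pM; rewrite ?mulr_ge0 ?sch// ler_wpM2l.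
  have c2 : K * `|W i| * `|sc i| <= K * `|W i| * (K * h).
    by rewrite ler_wpM2l ?mulr_ge0 ?sch.
  have c3 : K * `|sd i| * `|W i| <= K * (K * h) * `|W i|.
    by rewrite ler_wpM2r// ler_wpM2l ?sdh.
  have c4 : K ^+ 3 * h * (h * `|W i|) <= K ^+ 3 * h * (1 * `|W i|).
    by rewrite ler_wpM2l ?mulr_ge0 ?exprn_ge0// ler_wpM2r.
  have c5 : K ^+ 2 * (h * `|W i|) <= K ^+ 3 * (h * `|W i|).
    by rewrite ler_wpM2r ?mulr_ge0// ler_weXn2l.
  apply: le_trans (ler_normD _ _) _.
  have := ler_normD (bilin (DG j (md i)) (W i) (sc i)) (bilin (DG j (md i)) (sd i) (W i)).
  have : 0 <= K ^+ 3 * h * `|W i| by rewrite ?mulr_ge0 ?exprn_ge0.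
  by lra.
have key k : (0 < k <= N)%N -> `|W k| <= 35 * n%:R * K ^+ 6 * h * (S k + eta).
  move=> /andP[k0 kN]; have kN1 : (0 < k < N.+1)%N by rewrite k0.
  have S0 : 0 <= S k by rewrite sumr_ge0.
  have W2 : `|W k| <= 2 * K * h.
    apply: le_trans (ler_normB _ _) _.
    by have := sch k kN; have := sdh k kN; lra.
  (* the terms of the two equations at step [0] cancel *)
  have bW j : `|bilin (G (mc k)) (W k) (e_ j)| <= 35 * K ^+ 5 * h * (S k + eta).
    have e1 := norm_delta_le1 j : `|e_ j| <= 1.
    have ELc := discrete_euler_lagrange hp Nh1 h_rho h_r cP j kN1 t0 t1.
    have ELd := discrete_euler_lagrange hp Nh1 h_rho h_r dP j kN1 t0 t1.
    rewrite -cd0 -cd1 in ELd; rewrite -/(sc k) -/(mc k) in ELc.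
    rewrite -/(sd k) -/(md k) in ELd; rewrite -/eta in ELc ELd.
    have Q : \sum_(1 <= i < k) `|bilin (DG j (mc i)) (sc i) (sc i)
                 - bilin (DG j (md i)) (sd i) (sd i)| <= 4 * K ^+ 3 * h * S k.
      have : \sum_(1 <= i < k) `|bilin (DG j (mc i)) (sc i) (sc i)
                 - bilin (DG j (md i)) (sd i) (sd i)| <=
          \sum_(1 <= i < k) (K ^+ 3 * h ^+ 2 * S k + 3 * K ^+ 3 * h * `|W i|).
        by rewrite !big_nat; apply: ler_sum => i ik; exact: qdiff.
      move=> /le_trans; apply; rewrite big_split /= -!mulr_sumr sumr_const_nat.
      rewrite -[X in _ * X + _]mulr_natl -/(S k).
      have : (k - 1)%:R * h * (K ^+ 3 * h * S k) <= 1 * (K ^+ 3 * h * S k).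
        rewrite ler_wpM2r ?mulr_ge0 ?exprn_ge0//.
        apply: le_trans Nh1; rewrite ler_wpM2r// ler_nat.
        by rewrite (leq_trans (leq_subr _ _))// (leq_trans kN).
      by lra.
    have QQ : `|\sum_(1 <= i < k) bilin (DG j (mc i)) (sc i) (sc i)
                 - \sum_(1 <= i < k) bilin (DG j (md i)) (sd i) (sd i)|
              <= 4 * K ^+ 3 * h * S k.
      by rewrite -sumrB; apply: le_trans (ler_norm_sum _ _ _) Q.
    have L : `|bilin (G (md k)) (sd k) (e_ j) - bilin (G (mc k)) (sd k) (e_ j)| <=
             K ^+ 2 * h * S k + K ^+ 3 * h ^+ 2.
      have := rm_lipschitz GP (sd k) (e_ j) (mcr k kN) (mdr k kN).
      move=> /le_trans; apply; rewrite distrC.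
      have mk : `|mc k - md k| <= S k + K * h.
        by have := mw k; have := wS _ k0; lra.
      have -> : K ^+ 2 * h * S k + K ^+ 3 * h ^+ 2 = K * (S k + K * h) * (K * h) * 1.
        by ring.
      apply: ler_pM; rewrite ?mulr_ge0//.
      apply: ler_pM; rewrite ?mulr_ge0 ?sdh//.
      by rewrite ler_wpM2l.
    have -> : bilin (G (mc k)) (W k) (e_ j) =
       (bilin (G (mc k)) (sc k) (e_ j) - bilin (G (md k)) (sd k) (e_ j)) +
       (bilin (G (md k)) (sd k) (e_ j) - bilin (G (mc k)) (sd k) (e_ j)).
      by rewrite /W bilinBl; ring.
    apply: le_trans (ler_normD _ _) _.
    have K35 : K ^+ 3 * (h * S k) <= K ^+ 5 * (h * S k).
      by rewrite ler_wpM2r ?mulr_ge0// ler_weXn2l.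
    have K25 : K ^+ 2 * (h * S k) <= K ^+ 5 * (h * S k).
      by rewrite ler_wpM2r ?mulr_ge0// ler_weXn2l.
    have K35' : K ^+ 3 * (h * h) <= K ^+ 5 * (h * eta).
      apply: ler_pM; rewrite ?exprn_ge0 ?mulr_ge0 ?ler_weXn2l//.
      by rewrite ler_wpM2l.
    have K5S : 0 <= K ^+ 5 * (h * S k) by rewrite !mulr_ge0 ?exprn_ge0.
    have : `|bilin (G (mc k)) (sc k) (e_ j) - bilin (G (md k)) (sd k) (e_ j)| <=
           34 * K ^+ 5 * h * eta + 2 * K ^+ 3 * h * S k.
      move: ELc ELd QQ; rewrite !ler_norml.
      move=> /andP[x1 x2] /andP[y1 y2] /andP[z1 z2].
      apply/andP; split; lra.
    by lra.
  have ell : `|W k| ^+ 2 <= `|W k| * (35 * n%:R * K ^+ 6 * h * (S k + eta)).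
    apply: le_trans (rm_elliptic GP (W k) (mcr k kN)) _.
    have -> : `|W k| * (35 * n%:R * K ^+ 6 * h * (S k + eta)) =
      K * (\sum_(j < n) `|W k| * (35 * K ^+ 5 * h * (S k + eta))).
      by rewrite sumr_const card_ord -[X in _ = _ * X]mulr_natl; ring.
    rewrite ler_wpM2l// bilin_row; apply: ler_sum => j _.
    apply: le_trans (ler_norm _) _; rewrite normrM; apply: ler_pM => //.
    exact: le_coord_norm.
  have [W0|W0] := eqVneq `|W k| 0.
    rewrite W0 !mulr_ge0 ?exprn_ge0// addr_ge0// ltW//.
  by rewrite expr2 ler_pM2l// lt_neqAle eq_sym W0 normr_ge0 in ell.
set Q := 35 * n%:R * K ^+ 6 in key *.
have Q0 : 0 <= Q by rewrite !mulr_ge0 ?exprn_ge0.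
clearbody Q.
have gronwall k : (k <= N)%N -> S k.+1 + eta <= (1 + Q * h) ^+ k * eta.
  elim: k => [|k IH] kN; first by rewrite /S big_geq// add0r expr0 mul1r.
  have W1 := key k.+1 kN; rewrite {1}/S big_nat_recr//= -/(S k.+1) exprS.
  apply: (@le_trans _ _ ((1 + Q * h) * (S k.+1 + eta))).
    by rewrite mulrDl mul1r addrAC lerD2l.
  rewrite -mulrA; apply: ler_wpM2l; last exact: IH (ltnW kN).
  by rewrite addr_ge0// mulr_ge0.
apply: le_trans (wS N.+1 isT) _.
have : S N.+1 <= S N.+1 + eta by rewrite lerDl ltW.
move=> /le_trans; apply; apply: le_trans (gronwall N (leqnn _)) _.
apply: ler_wpM2r; first exact: ltW.
have E : (1 + Q * h) ^+ N <= expR (Q * h) ^+ N.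
  by rewrite lerXn2r ?nnegrE ?expR_ge0 ?addr_ge0 ?mulr_ge0// expR_ge1Dx.
apply: le_trans E _; rewrite -expRM_natl ler_expR mulrCA -[leRHS]mulr1 ler_wpM2l//.
by apply: le_trans Nh1; rewrite ler_wpM2r// ler_nat.
Qed.

End DiscreteGeodesics.

(** * Chain rule for maps with continuous partial derivatives *)

Section ChainRule.
Context {R : realType} {n : nat}.
Implicit Types (v x y z : 'rV[R]_n).

Lemma near_forall_ord (T : topologicalType) (x : T) m (P : 'I_m -> T -> Prop) :
  (forall j, \forall z \near x, P j z) -> \forall z \near x, forall j, P j z.
Proof. exact: filter_forall. Qed.

Lemma is_derive_near (f : R -> R) (t d : R) :
  (forall e, 0 < e -> \forall s \near t, `|f s - f t - d * (s - t)| <= e * `|s - t|) ->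
  is_derive t 1 f d.
Proof.
move=> H.
have C : (fun h : R => h^-1 *: ((f \o shift t) (h *: 1) - f t)) h @[h --> 0^'] --> d.
  apply/cvgrPdist_le => e e0; have /nbhs_ballP[r /= r0 Hr] := H e e0.
  near=> h.
  have h0 : h != 0 by near: h; exact: nbhs_dnbhs_neq.
  have hr : `|h| < r by near: h; exact: dnbhs0_lt.
  have /= := Hr (h + t); rewrite /ball /= opprD addrCA subrr addr0 normrN => /(_ hr).
  rewrite addrK => B.
  have hE : h *: (1 : R) = h by rewrite /GRing.scale /= mulr1.
  rewrite /= hE -(ler_pM2l (_ : 0 < `|h|)) ?normr_gt0// -normrM [`|h| * e]mulrC.
  apply: le_trans _ B; rewrite -normrN le_eqVlt; apply/orP; left; apply/eqP.
  by congr `|_|; rewrite /GRing.scale /=; field.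
by split; [apply/cvg_ex; exists d|exact/cvg_lim].
Unshelve. all: by end_near. Qed.

Lemma is_derive_approx (f : R -> R) (t d e : R) : is_derive t 1 f d -> 0 < e ->
  \forall s \near t, `|f s - f t - d * (s - t)| <= e * `|s - t|.
Proof.
move=> [df <-] e0.
have /cvgrPdist_le/(_ e e0) : (fun h : R => h^-1 *: ((f \o shift t) (h *: 1) - f t))
  h @[h --> 0^'] --> 'D_1 f t by exact: df.
move=> /nbhs_ballP[r /= r0 Hr]; apply/nbhs_ballP; exists r => //= s sr.
have [->|st] := eqVneq s t; first by rewrite !subrr mulr0 subrr normr0 mulr0.
have st0 : s - t != 0 by rewrite subr_eq0.
have sr' : `|s - t| < r by rewrite distrC.
have /= := Hr (s - t); rewrite /ball /= sub0r normrN => /(_ sr' st0).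
have -> : (s - t) *: (1 : R) = s - t by rewrite /GRing.scale /= mulr1.
rewrite subrK => B.
have B2 := ler_wpM2r (normr_ge0 (s - t)) B.
apply: le_trans _ B2.
rewrite -normrN le_eqVlt; apply/orP; left; apply/eqP.
by rewrite -normrM; congr `|_|; rewrite /GRing.scale /=; field.
Qed.

Lemma is_derive_coord (c : R -> 'rV[R]_n) (t : R) v j :
  is_derive t 1 c v -> is_derive t 1 (fun s => c s 0 j) (v 0 j).
Proof.
move=> [dc <-]; have D := (derivable_mxP _ _ _).1 dc 0 j.
by split => //; rewrite derive_mx// mxE.
Qed.

(** By the mean value inequality, [F (c s) - F (c t)] agrees up to
    [o(|c s - c t|)] with a linear function of [c s - c t]. *)
Lemma is_derive_comp_partial (F : 'rV[R]_n -> R) (DF : 'I_n -> 'rV[R]_n -> R)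
    (c : R -> 'rV[R]_n) (t : R) v :
  is_derive t 1 c v ->
  (\forall z \near c t, forall j, is_derive z (delta_mx 0 j) F (DF j z)) ->
  (forall j, {for c t, continuous (DF j)}) ->
  is_derive t 1 (F \o c) (\sum_j v 0 j * DF j (c t)).
Proof.
move=> dc dF cF; apply: is_derive_near => e e0.
pose C := `|v| + 1.
have C0 : 0 < C by rewrite ltr_wpDl.
pose e1 := e / (2 * (n%:R + 1) * C).
have n0 : 0 < n%:R + 1 :> R by rewrite ltr_wpDl.
have e10 : 0 < e1 by rewrite divr_gt0 ?mulr_gt0.
have : \forall z \near c t, (forall j, is_derive z (delta_mx 0 j) F (DF j z)) /\
    (forall j, `|DF j z - DF j (c t)| <= e1).
  have cF' : \forall z \near c t, forall j, `|DF j z - DF j (c t)| <= e1.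
    apply: (@near_forall_ord _ (c t) n (fun j z => `|DF j z - DF j (c t)| <= e1)) => j.
    by move: (cF j) => /cvgrPdist_le/(_ e1 e10); apply: filterS => z; rewrite distrC.
  by near=> z; split; near: z.
move=> /nbhs_ballP[r /= r0 Hr].
have cc : {for t, continuous c}.
  by apply/differentiable_continuous/derivable1_diffP; case: dc.
pose S := \sum_j (`|DF j (c t)| + 1).
have S0 : 0 <= S by apply: sumr_ge0 => j _; rewrite addr_ge0.
pose e2 := Num.min 1 (e / (2 * S + 1)).
have e20 : 0 < e2 by rewrite lt_min ltr01 divr_gt0// ltr_wpDl// mulr_ge0.
have A : \forall s \near t, forall j,
    `|c s 0 j - c t 0 j - v 0 j * (s - t)| <= e2 * `|s - t|.
  apply: (@near_forall_ord _ t n (fun j s =>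
    `|c s 0 j - c t 0 j - v 0 j * (s - t)| <= e2 * `|s - t|)) => j.
  exact: (is_derive_approx (is_derive_coord j dc)).
have /cvgrPdist_lt/(_ _ r0) B := cc.
near=> s.
have As : forall j, `|c s 0 j - c t 0 j - v 0 j * (s - t)| <=
   e2 * `|s - t| by near: s.
have Bs : `|c t - c s| < r by near: s.
have cs : `|c s - c t| <= C * `|s - t|.
  apply: row_norm_le => [|j]; first by rewrite mulr_ge0// ltW.
  rewrite !mxE; have := As j; set a := c s 0 j - c t 0 j => a1.
  have -> : a = (a - v 0 j * (s - t)) + v 0 j * (s - t) by rewrite subrK.
  apply: le_trans (ler_normD _ _) _; rewrite normrM /C mulrDl addrC lerD//.
    by rewrite ler_wpM2r// le_coord_norm.
  by apply: le_trans a1 _; rewrite ler_wpM2r// ge_min lexx.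
have MV : `|F (c s) - F (c t) - \sum_j (c s - c t) 0 j * DF j (c t)| <=
    n%:R * e1 * `|c s - c t|.
  apply: (@mean_value_coord _ _ F DF) => z zr j.
  have [D1 D2] : (forall j, is_derive z (delta_mx 0 j) F (DF j z)) /\
    (forall j, `|DF j z - DF j (c t)| <= e1).
    apply: Hr; rewrite -ball_normE /=; apply: le_lt_trans Bs.
    by rewrite distrC (le_trans zr)// distrC.
  by split.
have MV' : `|F (c s) - F (c t) - \sum_j (c s - c t) 0 j * DF j (c t)| <= e / 2 * `|s - t|.
  apply: (le_trans MV); apply: le_trans (ler_wpM2l _ cs) _.
    by rewrite mulr_ge0// ltW.
  rewrite mulrA ler_wpM2r//.
  have -> : e / 2 = (n%:R + 1) * e1 * C by rewrite /e1; field; rewrite !gt_eqF.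
  apply: ler_wpM2r; first exact: ltW.
  by apply: ler_wpM2r; [exact: ltW|rewrite lerDl].
have LIN : `|\sum_j (c s - c t) 0 j * DF j (c t) - (\sum_j v 0 j * DF j (c t)) * (s - t)|
    <= e / 2 * `|s - t|.
  rewrite mulr_suml -sumrB; apply: le_trans (ler_norm_sum _ _ _) _.
  apply: (@le_trans _ _ (\sum_(j < n) (`|DF j (c t)| + 1) * (e / (2 * S + 1) * `|s - t|))).
    apply: ler_sum => j _.
    have -> : (c s - c t) 0 j * DF j (c t) - v 0 j * DF j (c t) * (s - t) =
      DF j (c t) * (c s 0 j - c t 0 j - v 0 j * (s - t)) by rewrite !mxE; ring.
    rewrite normrM; apply: ler_pM => //; first by rewrite lerDl.
    by apply: le_trans (As j) _; rewrite ler_wpM2r// ge_min lexx orbT.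
  rewrite -mulr_suml -/S mulrA; apply: ler_wpM2r => //.
  rewrite mulrCA; apply: ler_wpM2l; first exact: ltW.
  by rewrite ler_pdivrMr ?ltr_wpDl ?mulr_ge0//; lra.
have -> : (F \o c) s - (F \o c) t - (\sum_j v 0 j * DF j (c t)) * (s - t) =
  (F (c s) - F (c t) - \sum_j (c s - c t) 0 j * DF j (c t)) +
  (\sum_j (c s - c t) 0 j * DF j (c t) - (\sum_j v 0 j * DF j (c t)) * (s - t)).
  by rewrite /=; ring.
apply: le_trans (ler_normD _ _) _; lra.
Unshelve. all: by end_near. Qed.

Lemma is_derive_affine z v (t : R) : is_derive t 1 (fun s : R => z + s *: v) v.
Proof. by apply: (@is_derive_line _ _ _ id); exact: is_derive_id. Qed.

(** The existence of directional derivatives does not give the chain rule; their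
    continuity does, one coordinate at a time. *)
Lemma C1_chain (U : set 'rV[R]_n) (f : 'rV[R]_n -> 'rV[R]_n) (c : R -> 'rV[R]_n)
    (t : R) : open U -> Ck_on 1 U f -> U (c t) -> derivable c t 1 ->
  is_derive t 1 (f \o c) ('D_('D_1 c t) f (c t)).
Proof.
move=> oU [_ f1] Uc dc.
pose DF k (j : 'I_n) z := ('D_(delta_mx 0 j) f z) 0 k.
have Udf z j : U z -> derivable f z (delta_mx 0 j) by move=> Uz; exact: (f1 _).1.
have chain (g : R -> 'rV[R]_n) (s : R) w k : U (g s) -> is_derive s 1 g w ->
    is_derive s 1 ((fun z => f z 0 k) \o g) (\sum_j w 0 j * DF k j (g s)).
  move=> Ug dg; apply: is_derive_comp_partial => //.
    have : nbhs (g s) U by exact: open_nbhs_nbhs.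
    apply: filterS => z Uz j; have D := Udf z j Uz.
    split; first exact: (derivable_mxP _ _ _).1 D 0 k.
    by rewrite /DF derive_mx// mxE.
  move=> j; apply: (@continuous_comp _ _ _ (fun z => 'D_(delta_mx 0 j) f z)
    (fun w : 'rV[R]_n => w 0 k)); last exact: coord_continuous.
  by have [_ [cD _]] := f1 (delta_mx 0 j); exact: cD.
have Dv v k : ('D_v f (c t)) 0 k = \sum_j v 0 j * DF k j (c t).
  have dfv := (f1 v).1 _ Uc; rewrite derive_mx// mxE.
  have L : U (c t + (0 : R) *: v) by rewrite scale0r addr0.
  have [_] := chain _ 0 _ k L (is_derive_affine (c t) v 0).
  rewrite scale0r addr0 => <-; pose fk z := f z 0 k.
  have E : (fun h : R => h^-1 *: ((fk \o shift (c t)) (h *: v) - fk (c t))) =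
    (fun h : R => h^-1 *: (((fk \o (fun s : R => c t + s *: v)) \o shift 0) (h *: 1)
                           - (fk \o (fun s : R => c t + s *: v)) 0)).
    apply/funext => h /=; congr (_ *: (fk _ - fk _)); last by rewrite scale0r addr0.
    by rewrite addr0 [h *: 1]mulr1 addrC.
  by rewrite -/fk /derive -/(fk (c t)) E.
have Dc := derivableP dc.
have DM k := chain c t _ k Uc Dc.
have dfc : derivable (f \o c) t 1.
  by apply/derivable_mxP => i k; rewrite (ord1 i); case: (DM k).
split => //; apply/rowP => k; rewrite derive_mx// mxE Dv.
by case: (DM k).
Qed.

End ChainRule.

(** * Speed and length of piecewise smooth curves *)

Section Curves.
Context {R : realType} {n : nat} {M : riemannian_manifold R n}.
Implicit Types (c : R -> M) (p q : M) (i j : atlas_index M).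

Lemma nbhs_chart i p : cdom (atlas i) p -> nbhs p (cdom (atlas i)).
Proof. by move=> ip; apply: open_nbhs_nbhs; split => //; exact: cdom_open. Qed.

Lemma overlap_open i j :
  open (cmap (atlas i) @` (cdom (atlas i) `&` cdom (atlas j))).
Proof.
rewrite openE => x [p [ip jp] <-]; rewrite /interior.
have U1 : nbhs (cmap (atlas i) p) (cmap (atlas i) @` cdom (atlas i)).
  by apply: open_nbhs_nbhs; split; [exact: cimg_open|exists p].
have U2 : nbhs (cmap (atlas i) p) (cinv (atlas i) @^-1` cdom (atlas j)).
  have /= := @cinv_continuous _ _ _ (atlas i) (cmap (atlas i) p).
  by apply; [exists p|rewrite (cmapK ip); exact: nbhs_chart].
near=> z.
have [q iq qz] : (cmap (atlas i) @` cdom (atlas i)) z by near: z.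
exists q => //; split=> //; rewrite -(cmapK iq) qz.
by near: z.
Unshelve. all: by end_near. Qed.

Lemma near_chart c t i : {for t, continuous c} -> cdom (atlas i) (c t) ->
  \forall s \near t, cdom (atlas i) (c s).
Proof. by move=> cc /nbhs_chart; exact: cc. Qed.

Lemma transition_derive i j c t : {for t, continuous c} ->
  cdom (atlas i) (c t) -> cdom (atlas j) (c t) ->
  derivable (cmap (atlas i) \o c) t 1 ->
  is_derive t 1 (cmap (atlas j) \o c)
    ('D_('D_1 (cmap (atlas i) \o c) t) (cmap (atlas j) \o cinv (atlas i))
       (cmap (atlas i) (c t))).
Proof.
move=> cc ic jc dc.
have := C1_chain (@overlap_open i j) (@atlas_smooth _ _ M i j 1%N) _ dc.
move=> /(_ (ex_intro2 _ _ _ (conj ic jc) erefl)).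
apply: near_eq_is_derive; near=> s => /=; rewrite cmapK//.
by near: s; exact: near_chart.
Unshelve. all: by end_near. Qed.

Definition chart_speed i c (t : R) : R :=
  Num.sqrt (bilin (metric i (cmap (atlas i) (c t)))
    (derive1 (cmap (atlas i) \o c) t) (derive1 (cmap (atlas i) \o c) t)).

Definition C1_at c (t : R) : Prop := {for t, continuous c} /\
  forall i, cdom (atlas i) (c t) ->
    derivable (cmap (atlas i) \o c) t 1 /\
    {for t, continuous (derive1 (cmap (atlas i) \o c))}.

(** By the compatibility of the metrics with the transition maps and the chain
    rule, the speed does not depend on the chart in which it is computed. *)
Lemma speed_chart c t i : C1_at c t -> cdom (atlas i) (c t) ->
  speed c t = chart_speed i c t.
Proof.
move=> [cc Dc] ic; rewrite /speed /chart_speed.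
have jc : cdom (atlas (chart_at (c t))) (c t) by rewrite /chart_at; case: cid.
have := transition_derive cc ic jc (Dc _ ic).1.
by rewrite !derive1E => -[_ ->]; rewrite [in RHS](metric_compat ic jc).
Qed.

Lemma near_eq_speed c c' t : (\forall s \near t, c s = c' s) ->
  speed c t = speed c' t.
Proof.
move=> cc'; have ct := nbhs_singleton cc'; rewrite /speed ct !derive1E.
suff -> : 'D_1 (cmap (atlas (chart_at (c' t))) \o c) t =
          'D_1 (cmap (atlas (chart_at (c' t))) \o c') t by [].
by apply: near_eq_derive; apply: filterS cc' => s /= ->.
Qed.

Lemma metric_continuous i x : (cmap (atlas i) @` cdom (atlas i)) x ->
  {for x, continuous (metric i)}.
Proof. by have [H _] := @metric_smooth R n M i 0%N; exact: H. Qed.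

Lemma cvg_bilin (T : Type) (F : set_system T) (FF : Filter F)
    (A : T -> 'M[R]_n) (v w : T -> 'rV[R]_n)
    (A0 : 'M[R]_n) (v0 w0 : 'rV[R]_n) :
  A x @[x --> F] --> A0 -> v x @[x --> F] --> v0 -> w x @[x --> F] --> w0 ->
  bilin (A x) (v x) (w x) @[x --> F] --> bilin A0 v0 w0.
Proof.
move=> cA cv cw; rewrite bilinE.
rewrite (_ : (fun x => _) = (fun x => \sum_i \sum_j A x i j * (v x 0 i * w x 0 j))); last first.
  by apply/funext => x; rewrite bilinE.
have C m k (B : T -> 'M[R]_(m, k)) (B0 : 'M[R]_(m, k)) (a : 'I_m) (b : 'I_k) :
    B x @[x --> F] --> B0 -> B x a b @[x --> F] --> B0 a b.
  by move=> cB; exact: (cvg_comp _ _ cB (@coord_continuous _ _ _ a b B0)).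
apply: cvg_big => // [|i _]; first exact: add_continuous.
apply: cvg_big => // [|j _]; first exact: add_continuous.
by apply: cvgM; [exact: C|apply: cvgM; exact: C].
Qed.

Lemma chart_speed_continuous c t i : C1_at c t -> cdom (atlas i) (c t) ->
  {for t, continuous (chart_speed i c)}.
Proof.
move=> [cc Dc] ic; have [d1 d2] := Dc _ ic.
apply: (continuous_comp _ (@sqrt_continuous R _)) => /=.
apply: cvg_bilin => //.
apply: (continuous_comp (f := cmap (atlas i) \o c)); last first.
  by apply: metric_continuous; exists (c t).
by apply: continuous_comp => //; exact: cmap_continuous.
Qed.

Lemma speed_continuous c t : (\forall s \near t, C1_at c s) ->
  {for t, continuous (speed c)}.
Proof.
move=> cC1; have C1t := nbhs_singleton cC1.
have [i ic] := atlas_cover (c t).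
have E : \forall s \near t, chart_speed i c s = speed c s.
  near=> s; rewrite (@speed_chart _ _ i)//; first by near: s.
  by near: s; apply: near_chart => //; case: C1t.
have /= C := chart_speed_continuous C1t ic.
rewrite /prop_for /continuous_at (speed_chart C1t ic).
exact: cvg_trans (near_eq_cvg E) C.
Unshelve. all: by end_near. Qed.

End Curves.

Section PiecewiseCurves.
Context {R : realType} {n : nat} {M : riemannian_manifold R n}.
Implicit Types (c : R -> M) (p q : M) (i j : atlas_index M).
Local Notation mu := (@lebesgue_measure R).

(** The length is computed on an extension of the curve beyond its end points:
    the speed of the extension is continuous on the closed interval, whereas the
    speed of the curve itself is arbitrary at the end points. *)
Definition C1_arc c (a b l : R) : Prop := exists c' : R -> M, exists e : R,
  [/\ 0 < e, C1_curve_on `]a - e, b + e[ c', {in `[a, b], c =1 c'} &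
   l = \int[mu]_(t in `[a, b]) speed c' t].

(** An inductive form of [piecewise_C1] which carries the length, so that
    statements about lengths are proved arc by arc. *)
Inductive piecewise_C1_arc c : R -> R -> R -> Prop :=
| pw_nil a : piecewise_C1_arc c a a 0
| pw_cons a m b l1 l2 : a < m -> C1_arc c a m l1 -> piecewise_C1_arc c m b l2 ->
    piecewise_C1_arc c a b (l1 + l2).

Lemma C1_curve_on_near a b (e : R) c t : C1_curve_on `]a - e, b + e[ c ->
  0 < e -> t \in `[a, b] -> \forall s \near t, C1_at c s.
Proof.
move=> H e0; rewrite in_itv /= => /andP[at_ tb].
have : \forall s \near t, s \in `]a - e, b + e[.
  by apply: near_in_itvoo; rewrite in_itv /=; apply/andP; split; lra.
by apply: filterS => s st; exact: H.
Qed.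

Lemma speed_ge0 c t : 0 <= speed c t.
Proof. exact: sqrtr_ge0. Qed.

Lemma C1_curve_speed_integrable a b (e : R) c : C1_curve_on `]a - e, b + e[ c ->
  0 < e -> {within `[a, b], continuous (speed c)} /\
  mu.-integrable `[a, b] (EFin \o speed c).
Proof.
move=> H e0; have C : {within `[a, b], continuous (speed c)}.
  apply: continuous_in_subspaceT => t; rewrite inE /= => tab.
  by apply: speed_continuous; exact: (C1_curve_on_near H).
by split => //; apply: continuous_compact_integrable => //; exact: segment_compact.
Qed.

(** The speeds of the curve and of its extension differ at most at the two end
    points. *)
Lemma C1_arc_integral c a b l : a < b -> C1_arc c a b l ->
  measurable_fun `[a, b] (speed c) /\
  (\int[mu]_(t in `[a, b]) (speed c t)%:E = l%:E)%E.
Proof.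
move=> ab [c' [e [e0 H cc' ->]]].
have [_ I] := C1_curve_speed_integrable H e0.
have mc' : measurable_fun `[a, b] (speed c').
  by apply/measurable_EFinP; exact: measurable_int I.
have mc'o : measurable_fun `]a, b[ (speed c').
  by apply: measurable_funS mc' => //; exact: subset_itv_oo_cc.
have E : {in `]a, b[, speed c =1 speed c'}.
  move=> t tab; apply: near_eq_speed.
  have : \forall s \near t, s \in `]a, b[ by exact: near_in_itvoo.
  by apply: filterS => s /subset_itv_oo_cc; exact: cc'.
have mco : measurable_fun `]a, b[ (speed c).
  by apply: eq_measurable_fun mc'o => t; rewrite inE /= => tab; rewrite E.
split; first exact: measurable_fun_itv_cc mco.
have -> := eq_integral_itv_bounded true false mco mc'o E.
by rewrite /Rintegral fineK//; exact: integrable_fin_num.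
Qed.

Lemma piecewise_C1_arc_le c a b l : piecewise_C1_arc c a b l -> a <= b.
Proof. by elim=> // {}a m {}b l1 l2 am _ _ mb; rewrite (le_trans (ltW am)). Qed.

Lemma C1_arc_ge0 c a b l : C1_arc c a b l -> 0 <= l.
Proof.
by move=> [c' [e [_ _ _ ->]]]; apply: Rintegral_ge0 => t _; exact: speed_ge0.
Qed.

Lemma piecewise_C1_arc_ge0 c a b l : piecewise_C1_arc c a b l -> 0 <= l.
Proof. by elim=> // ? ? ? l1 l2 _ /C1_arc_ge0 l10 _ l20; rewrite addr_ge0. Qed.

Lemma piecewise_C1_arc_integral c a b l : piecewise_C1_arc c a b l ->
  measurable_fun `[a, b] (speed c) /\
  (\int[mu]_(t in `[a, b]) (speed c t)%:E = l%:E)%E.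
Proof.
elim=> [{}a|{}a m {}b l1 l2 am /(C1_arc_integral am)[m1 I1] pw [m2 I2]].
  by rewrite set_itv1 integral_set1; split => //; exact: measurable_fun_set1.
have mb := piecewise_C1_arc_le pw.
have U : `[a, b]%classic = `[a, m] `|` `]m, b].
  by rewrite -itv_bndbnd_setU // bnd_simp // ltW.
have m2' : measurable_fun `]m, b] (speed c).
  by apply: measurable_funS m2 => //; exact: subset_itv_oc_cc.
have mU : measurable_fun (`[a, m] `|` `]m, b]) (speed c).
  by apply/measurable_funU.
rewrite U; split => //; rewrite ge0_integral_setU//=.
- rewrite I1 integral_itv_obnd_cbnd ?I2//.
  by apply/measurable_EFinP.
- by apply/measurable_EFinP.
- by move=> t _; rewrite lee_fin speed_ge0.
- apply/disj_setPS => y [/=]; rewrite 2!in_itv/= => /andP[_ yx] /andP[].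
  by rewrite ltNge yx.
Qed.

Lemma piecewise_C1_arcP c a b l : piecewise_C1_arc c a b l <->
  piecewise_C1 a b c /\ l = \int[mu]_(t in `[a, b]) speed c t.
Proof.
split=> [pw|[[s sp H] ->]].
  have [_ I] := piecewise_C1_arc_integral pw; split; last by rewrite /Rintegral I.
  elim: pw {I} => [{}a|{}a m {}b l1 l2 am [c' [e [e0 H cc' _]]] _ [s [s1 s2] sH]].
    by exists [::] => //; split.
  exists (m :: s); first by split => //=; rewrite am.
  case=> [_|k /=]; last by rewrite ltnS; exact: sH.
  by exists c' => //; exists e.
suff [l' pw] : exists l', piecewise_C1_arc c a b l'.
  by have [_ I] := piecewise_C1_arc_integral pw; rewrite /Rintegral I.
elim: s a sp H => [a /itv_partition_nil ->|m s IH a sp H].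
  by exists 0; exact: pw_nil.
have [|l2 pw] := IH m (itv_partition_cons sp).
  by move=> k ks; exact: (H k.+1).
have [c' [e e0 H'] cc'] := H 0%N isT.
exists (\int[mu]_(t in `[a, m]) speed c' t + l2).
apply: (pw_cons (m := m)) pw; last by exists c', e.
by move: sp => [/= /andP[]].
Qed.

Lemma eq_C1_arc c d a b l : {in `[a, b], c =1 d} -> C1_arc c a b l -> C1_arc d a b l.
Proof.
move=> cd [c' [e [e0 H cc' ->]]]; exists c', e; split => // t tab.
by rewrite -cd// cc'.
Qed.

Lemma eq_piecewise_C1_arc c d a b l : {in `[a, b], c =1 d} ->
  piecewise_C1_arc c a b l -> piecewise_C1_arc d a b l.
Proof.
move=> + pw; elim: pw => [{}a _|{}a m {}b l1 l2 am arc pw IH cd].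
  exact: pw_nil.
have mb := piecewise_C1_arc_le pw.
apply: (pw_cons am).
  apply: eq_C1_arc arc => t tam; apply: cd; move: tam; rewrite !in_itv /=.
  by move=> /andP[-> tm]; rewrite (le_trans tm).
apply: IH => t tmb; apply: cd; move: tmb; rewrite !in_itv /=.
by move=> /andP[mt ->]; rewrite (le_trans (ltW am)).
Qed.

Lemma piecewise_C1_arc_cat c a m b l1 l2 : piecewise_C1_arc c a m l1 ->
  piecewise_C1_arc c m b l2 -> piecewise_C1_arc c a b (l1 + l2).
Proof.
move=> pw; elim: pw l2 => [{}a l2|{}a m' {}m l l' am arc pw IH l2 pw2].
  by rewrite add0r.
by rewrite -addrA; apply: (pw_cons am arc); exact: IH.
Qed.

Lemma is_derive_affine_real (u v s : R) : is_derive s 1 (fun t : R => u + v * t) v.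
Proof.
apply: is_derive_near => e e0; apply: (@filterE _ (nbhs s)) => t.
have -> : u + v * t - (u + v * s) - v * (t - s) = 0 by ring.
by rewrite normr0 mulr_ge0// ltW.
Qed.

Lemma derive1_affine (W : normedModType R) (f : R -> W) (u v s : R) :
  derivable f (u + v * s) 1 ->
  derivable (fun t => f (u + v * t)) s 1 /\
  derive1 (fun t => f (u + v * t)) s = v *: derive1 f (u + v * s).
Proof.
move=> /derivable1_diffP df; pose phi t := u + v * t.
have dphi := is_derive_affine_real u v s.
have Dphi : differentiable phi s by apply/derivable1_diffP; case: dphi.
have Dc : differentiable (f \o phi) s by exact: differentiable_comp.
split; first exact/derivable1_diffP.
have dphi1 : 'd phi s 1 = v by rewrite -deriveE//; case: dphi.
rewrite !derive1E -[LHS]/('D_1 (f \o phi) s) deriveE// diff_comp//= dphi1.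
by rewrite -[X in 'd f _ X]mulr1 linearZ -deriveE.
Qed.

Lemma C1_at_affine (u v : R) c (t : R) : 0 < v ->
  (\forall s \near u + v * t, C1_at c s) ->
  C1_at (fun s => c (u + v * s)) t /\
  speed (fun s => c (u + v * s)) t = v * speed c (u + v * t).
Proof.
move=> v0 cC1; pose phi (s : R) := u + v * s.
have cphi : {for t, continuous phi}.
  apply/differentiable_continuous/derivable1_diffP.
  by case: (is_derive_affine_real u v t).
have [cc Dc] := nbhs_singleton cC1.
have C1' : C1_at (c \o phi) t.
  split; first by apply: continuous_comp.
  move=> i ic; have [d1 d2] := Dc i ic; split.
    exact: (derive1_affine (f := cmap (atlas i) \o c) _).1.
  have E : \forall s \near t, v *: derive1 (cmap (atlas i) \o c) (phi s) =
      derive1 (cmap (atlas i) \o (c \o phi)) s.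
    have A : \forall s \near t, C1_at c (phi s) by exact: cphi.
    have B : \forall s \near t, cdom (atlas i) (c (phi s)).
      by move: (near_chart cc ic); exact: cphi.
    near=> s; apply/esym.
    have [_ /(_ i)[|ds _]] : C1_at c (phi s) by near: s.
      by near: s.
    exact: (derive1_affine (f := cmap (atlas i) \o c) ds).2.
  have := nbhs_singleton E; rewrite /prop_for /continuous_at => <-.
  have C : v *: derive1 (cmap (atlas i) \o c) (phi s) @[s --> t] -->
      v *: derive1 (cmap (atlas i) \o c) (phi t).
    have D2 : {for t, continuous (derive1 (cmap (atlas i) \o c) \o phi)}.
      by apply: continuous_comp; [exact: cphi|exact: d2].
    by apply: (cvgZ (F := nbhs t) (s := cst v)); [exact: cvg_cst|exact: D2].
  exact: cvg_trans (near_eq_cvg E) C.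
split; first exact: C1'.
have [i ic] := atlas_cover (c (u + v * t)).
rewrite [LHS](speed_chart C1' ic) (speed_chart (nbhs_singleton cC1) ic).
have D := (derive1_affine (f := cmap (atlas i) \o c) (Dc i ic).1).2.
rewrite /chart_speed [derive1 (cmap _ \o (c \o phi)) t]D bilinZl bilinZr mulrA.
by rewrite -expr2 sqrtrM ?sqr_ge0// sqrtr_sqr gtr0_norm.
Unshelve. all: by end_near. Qed.

Lemma C1_arc_affine (u v : R) c (a b l : R) : 0 < v -> a < b ->
  C1_arc c (u + v * a) (u + v * b) l -> C1_arc (fun s => c (u + v * s)) a b l.
Proof.
move=> v0 ab [c' [e [e0 H cc' ->]]].
have ev : 0 < e / v by rewrite divr_gt0.
pose phi (s : R) := u + v * s.
have near_phi t : t \in `]a - e / v, b + e / v[ -> \forall s \near phi t, C1_at c' s.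
  rewrite in_itv /= => /andP[t1 t2].
  have : \forall s \near phi t, s \in `]u + v * a - e, u + v * b + e[.
    apply: near_in_itvoo; rewrite in_itv /= /phi.
    have : v * (a - e / v) < v * t by rewrite ltr_pM2l.
    have : v * t < v * (b + e / v) by rewrite ltr_pM2l.
    rewrite mulrBr mulrDr [v * (e / v)]mulrC divfK ?gt_eqF// => h1 h2.
    by apply/andP; split; lra.
  by apply: filterS => s st; exact: H.
have sub t : t \in `[a, b] -> t \in `]a - e / v, b + e / v[.
  by rewrite !in_itv /= => /andP[t1 t2]; apply/andP; split; lra.
exists (c' \o phi), (e / v); split; first exact: ev.
- by move=> t /near_phi/(C1_at_affine v0)[].
- move=> t; rewrite in_itv /= => /andP[t1 t2]; rewrite /= cc'// in_itv /=.
  by rewrite !lerD2l !ler_pM2l// t1.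
have Dphi s := is_derive_affine_real u v s.
have cphi : continuous phi.
  by move=> s; apply/differentiable_continuous/derivable1_diffP; case: (Dphi s).
have phi' : derive1 phi = cst v.
  by apply/funext => s; rewrite derive1E; case: (Dphi s).
have [C I] := C1_curve_speed_integrable H e0.
have S : (\int[mu]_(x in `[phi a, phi b]) (speed c' x)%:E =
    \int[mu]_(x in `[a, b]) (((speed c' \o phi) * derive1 phi) x)%:E)%E.
  apply: integration_by_substitution_increasing.
  - exact: ltW.
  - by move=> x y _ _ xy; rewrite /phi ltrD2l ltr_pM2l.
  - by rewrite phi' => x _; exact: cst_continuous.
  - by rewrite phi'; exact: is_cvg_cst.
  - by rewrite phi'; exact: is_cvg_cst.
  - split.
    + by move=> x _; case: (Dphi x).
    + exact: cvg_at_right_filter (cphi a).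
    + exact: cvg_at_left_filter (cphi b).
  - exact: C.
rewrite /Rintegral.
apply: (etrans (congr1 fine S)).
apply: (congr1 fine).
apply: eq_integral => t.
rewrite inE /= => /sub/near_phi/(C1_at_affine v0)[_ E].
congr (_%:E); rewrite phi'; transitivity (speed c' (phi t) * v) => //.
by rewrite mulrC -E.
Qed.

Lemma piecewise_C1_arc_affine (u v : R) c (a b l : R) : 0 < v ->
  piecewise_C1_arc c a b l ->
  piecewise_C1_arc (fun s => c (u + v * s)) ((a - u) / v) ((b - u) / v) l.
Proof.
move=> v0; elim=> [{}a|{}a m {}b l1 l2 am arc pw IH]; first exact: pw_nil.
apply: pw_cons IH; first by rewrite ltr_pM2r ?invr_gt0// ltrD2r.
apply: C1_arc_affine => //; first by rewrite ltr_pM2r ?invr_gt0// ltrD2r.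
have K x : u + v * ((x - u) / v) = x by field; rewrite gt_eqF.
by rewrite !K.
Qed.

(** * The Riemannian distance *)

Lemma dist_has_lbound p q :
  has_lbound [set l | exists c, [/\ piecewise_C1 0 1 c, c 0 = p, c 1 = q &
                 l = \int[mu]_(t in `[0, 1]) speed c t]].
Proof.
exists 0 => l [c [_ _ _ ->]]; apply: Rintegral_ge0 => t _; exact: speed_ge0.
Qed.

Lemma dist_ge0 p q : 0 <= dist p q.
Proof.
rewrite /dist; set A := [set l | _]; have [->|/set0P A0] := eqVneq A set0.
  by rewrite inf0.
apply: lb_le_inf => // l [c [_ _ _ ->]].
by apply: Rintegral_ge0 => t _; exact: speed_ge0.
Qed.

Lemma dist_le_length c a b l : a < b -> piecewise_C1_arc c a b l ->
  dist (c a) (c b) <= l.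
Proof.
move=> ab pw; have ba0 : 0 < b - a by rewrite subr_gt0.
have := piecewise_C1_arc_affine a ba0 pw.
rewrite subrr mul0r divff ?gt_eqF// => /piecewise_C1_arcP[P L].
apply: ge_inf; first exact: dist_has_lbound.
exists (fun s => c (a + (b - a) * s)); split => //; first by rewrite mulr0 addr0.
by rewrite mulr1 addrC subrK.
Qed.

Definition joined p q := exists c l, [/\ piecewise_C1_arc c 0 1 l, c 0 = p & c 1 = q].

Lemma dist_approx p q e : joined p q -> 0 < e ->
  exists c l, [/\ piecewise_C1_arc c 0 1 l, c 0 = p, c 1 = q & l < dist p q + e].
Proof.
move=> [c [l [pw c0 c1]]] e0.
have [||_ [c' [P c0' c1' ->]] lt] := @inf_adherent R
  [set l | exists c, [/\ piecewise_C1 0 1 c, c 0 = p, c 1 = q &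
                 l = \int[mu]_(t in `[0, 1]) speed c t]] e.
- exact: e0.
- split; last exact: dist_has_lbound.
  by move: pw => /piecewise_C1_arcP[P L]; exists l, c.
exists c', (\int[mu]_(t in `[0, 1]) speed c' t); split => //.
exact/piecewise_C1_arcP.
Qed.

Lemma joined_glue p q r c d l1 l2 : piecewise_C1_arc c 0 1 l1 ->
  piecewise_C1_arc d 0 1 l2 -> c 0 = p -> c 1 = q -> d 0 = q -> d 1 = r ->
  exists f, [/\ piecewise_C1_arc f 0 2 (l1 + l2), f 0 = p & f 2 = r].
Proof.
move=> pc pd c0 c1 d0 d1; pose f t := if t <= 1 then c t else d (-1 + 1 * t).
exists f; split.
- apply: (piecewise_C1_arc_cat (m := 1)).
    apply: eq_piecewise_C1_arc pc => t; rewrite in_itv /= /f.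
    by move=> /andP[_ ->].
  have := piecewise_C1_arc_affine (-1) ltr01 pd.
  rewrite !divr1 !opprK add0r -[1 + 1]/2 => pd'.
  apply: eq_piecewise_C1_arc pd' => t; rewrite in_itv /= /f => /andP[t1 _].
  case: ifP => // t1'; have -> : t = 1 by apply/eqP; rewrite eq_le t1 t1'.
  by rewrite mulr1 addNr d0 c1.
- by rewrite /f ler01.
- by rewrite /f ifF ?leNgt ?ltr1n//= -[2]/(1 + 1) mul1r addKr.
Qed.

Lemma joined_trans p q r : joined p q -> joined q r -> joined p r.
Proof.
move=> [c [l1 [pc c0 c1]]] [d [l2 [pd d0 d1]]].
have [f [pf f0 f2]] := joined_glue pc pd c0 c1 d0 d1.
have := piecewise_C1_arc_affine 0 (ltr0Sn R 1) pf.
rewrite !subr0 mul0r divff// => pf'.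
by exists (fun s => f (0 + 2 * s)), (l1 + l2); rewrite mulr0 mulr1 !add0r; split.
Qed.

Lemma joined_dist_triangle p q r : joined p q -> joined q r ->
  dist p r <= dist p q + dist q r.
Proof.
move=> jpq jqr; apply/ler_addgt0Pl => e e0.
have e2 : 0 < e / 2 by rewrite divr_gt0.
have [c [l1 [pc c0 c1 L1]]] := dist_approx jpq e2.
have [d [l2 [pd d0 d1 L2]]] := dist_approx jqr e2.
have [f [pf f0 f2]] := joined_glue pc pd c0 c1 d0 d1.
have := dist_le_length (ltr0n _ 2) pf; rewrite f0 f2; lra.
Qed.

Lemma C1_arc_cst p a b : C1_arc (cst p) a b 0.
Proof.
have C t : C1_at (cst p) t.
  split => [|i ip]; first exact: cst_continuous.
  rewrite (_ : cmap (atlas i) \o cst p = cst (cmap (atlas i) p))//.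
  split; first exact: derivable_cst.
  have -> : derive1 (cst (cmap (atlas i) p) : R -> 'rV[R]_n) = cst 0.
    by apply/funext => s; rewrite derive1_cst.
  exact: cst_continuous.
exists (cst p), 1; split => //; first by move=> t _; exact: C.
rewrite /Rintegral integral0_eq// => t _; rewrite /speed.
rewrite (_ : cmap _ \o cst p = cst (cmap (atlas (chart_at p)) p))// derive1_cst.
by rewrite bilin0l sqrtr0.
Qed.

Lemma joined_refl p : joined p p.
Proof.
exists (cst p), (0 + 0); split => //; apply: pw_cons ltr01 _ (pw_nil _ 1).
exact: C1_arc_cst.
Qed.

End PiecewiseCurves.

(** * Uniform bounds for the metric near a point *)

Section LocalBounds.
Context {R : realType} {n : nat}.
Implicit Types (u v w x y z : 'rV[R]_n).

(** By compactness, the quadratic form attains a positive minimum on the unit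
    sphere. *)
Lemma posdef_coercive (A : 'M[R]_n) :
  (forall v, v != 0 -> 0 < bilin A v v) ->
  exists2 a : R, 0 < a & forall v, a * `|v| ^+ 2 <= bilin A v v.
Proof.
move=> Apos; pose S := [set v : 'rV[R]_n | `|v| = 1].
have [[v0 Sv0]|S0] := pselect (S !=set0); last first.
  exists 1 => // v; have [->|vn0] := eqVneq v 0.
    by rewrite normr0 expr0n mulr0 bilin0l.
  exfalso; apply: S0; exists (`|v|^-1 *: v).
  by rewrite /S /= normrZ normfV normr_id mulVf// normr_eq0.
have cS : compact S.
  apply: bounded_closed_compact.
    by exists 1; split => // e e1 v /= ->; exact: ltW.
  have -> : S = (fun v : 'rV[R]_n => `|v|) @^-1` [set 1] by [].
  apply: closed_comp; last exact: closed_eq.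
  by move=> v _; exact: norm_continuous.
have cb : {within S, continuous (fun v => bilin A v v)}.
  apply: continuous_subspaceT => v.
  by apply: (@cvg_bilin R n _ (nbhs v) _ (cst A) id id); [exact: cvg_cst|exact: cvg_id|exact: cvg_id].
have [c Sc cmin] := EVT_min_rV (ex_intro _ v0 Sv0) cS cb.
have c0 : c != 0.
  by apply/eqP => c0; move: Sc; rewrite inE /S /= c0 normr0 => /esym/eqP; rewrite oner_eq0.
exists (bilin A c c); first exact: Apos.
move=> v; have [->|vn0] := eqVneq v 0; first by rewrite normr0 expr0n mulr0 bilin0l.
have nv : 0 < `|v| by rewrite normr_gt0.
have := cmin (`|v|^-1 *: v); rewrite inE /S /= normrZ normfV normr_id mulVf ?gt_eqF//.
move=> /(_ erefl); rewrite bilinZl bilinZr mulrA -expr2 exprVn.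
by rewrite mulrC ler_pdivlMr ?exprn_gt0.
Qed.

Lemma le_entry_norm (A : 'M[R]_n) i j : `|A i j| <= `|A|.
Proof.
rewrite [leRHS]/Num.Def.normr/= mx_normrE.
exact: (le_bigmax _ (fun ij => `|A ij.1 ij.2|) (i, j)).
Qed.

Lemma is_derive_entry (f : 'rV[R]_n -> 'M[R]_n) z v i j :
  derivable f z v -> is_derive z v (fun y => f y i j) ('D_v f z i j).
Proof.
move=> df; split; first exact: (derivable_mxP _ _ _).1 df i j.
by rewrite derive_mx// mxE.
Qed.

Lemma near_bounded (f : 'rV[R]_n -> 'M[R]_n) x : {for x, continuous f} ->
  \forall z \near x, `|f z| <= `|f x| + 1.
Proof.
move=> /cvgrPdist_le/(_ 1 ltr01); apply: filterS => z h.
have -> : f z = f x - (f x - f z) by rewrite opprB addrCA subrr addr0.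
by apply: le_trans (ler_normB _ _) _; rewrite lerD2l.
Qed.

(** Bounds on the second partial derivatives near [x0] give, through the
    mean value inequality, all the estimates at once; the ball is small enough
    for the Lipschitz bound to preserve half of the coercivity at [x0]. *)
Lemma regular_metric_exists (U : set 'rV[R]_n) (g : 'rV[R]_n -> 'M[R]_n) x0 :
  open U -> U x0 -> Ck_on 2 U g ->
  (forall z, U z -> (g z)^T = g z) ->
  (forall v, v != 0 -> 0 < bilin (g x0) v v) ->
  exists r K : R, [/\ 0 < r, forall z, `|z - x0| <= r -> U z &
    regular_metric x0 r K g (fun j z => 'D_(delta_mx 0 j) g z)].
Proof.
move=> oU Ux0 [g0 g1] gsym gpos.
pose e_ (j : 'I_n) : 'rV[R]_n := delta_mx 0 j.
pose DG (j : 'I_n) (z : 'rV[R]_n) : 'M[R]_n := 'D_(e_ j) g z.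
pose DDG (j l : 'I_n) (z : 'rV[R]_n) : 'M[R]_n := 'D_(e_ l) (DG j) z.
have dg j z : U z -> derivable g z (e_ j) by exact: (g1 (e_ j)).1.
have cDG j : {for x0, continuous (DG j)}.
  by have [_ [C _]] := g1 (e_ j); exact: C.
have dDG j l z : U z -> derivable (DG j) z (e_ l).
  by have [_ [_ C]] := g1 (e_ j); exact: (C (e_ l)).1.
have cDDG j l : {for x0, continuous (DDG j l)}.
  by have [_ [_ C]] := g1 (e_ j); have [_ [C' _]] := C (e_ l); exact: C'.
pose B := (`|g x0| + 1) + \sum_j (`|DG j x0| + 1) + \sum_j \sum_l (`|DDG j l x0| + 1).
have s0 (I : finType) (f : I -> R) : (forall i, 0 <= f i) -> 0 <= \sum_i f i.
  by move=> f0; apply: sumr_ge0.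
have s1 (I : finType) (f : I -> R) i : (forall i, 0 <= f i) -> f i <= \sum_i f i.
  by move=> f0; rewrite (bigD1 i)//= lerDl sumr_ge0.
have p1 (A : 'M[R]_n) : 0 <= `|A| + 1 by rewrite addr_ge0.
have BG : `|g x0| + 1 <= B.
  by rewrite /B -addrA lerDl addr_ge0// s0// => j; rewrite s0.
have BD j : `|DG j x0| + 1 <= B.
  rewrite /B addrAC; apply: le_trans (s1 _ (fun j => `|DG j x0| + 1) j _) _ => //.
  by rewrite lerDr addr_ge0// s0// => k; rewrite s0.
have BDD j l : `|DDG j l x0| + 1 <= B.
  apply: le_trans (s1 _ (fun l => `|DDG j l x0| + 1) l _) _ => //.
  apply: le_trans (s1 _ (fun j => \sum_l (`|DDG j l x0| + 1)) j _) _.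
    by move=> k; rewrite s0.
  by rewrite /B lerDr addr_ge0// s0.
have B1 : 1 <= B by apply: le_trans BG; rewrite lerDr.
have B0 : 0 <= B by apply: le_trans B1.
have : \forall z \near x0, [/\ U z, `|g z| <= B, forall j, `|DG j z| <= B &
    forall j l, `|DDG j l z| <= B].
  have N1 : \forall z \near x0, U z by exact: open_nbhs_nbhs.
  have N2 := near_bounded (g0 _ Ux0).
  have N3 := @near_forall_ord _ x0 n (fun j z => `|DG j z| <= `|DG j x0| + 1)
    (fun j => near_bounded (cDG j)).
  have N4 := @near_forall_ord _ x0 n
    (fun j z => forall l, `|DDG j l z| <= `|DDG j l x0| + 1)
    (fun j => @near_forall_ord _ x0 n
       (fun l z => `|DDG j l z| <= `|DDG j l x0| + 1)
       (fun l => near_bounded (cDDG j l))).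
  near=> z; have H1 : U z by near: z.
  have H2 : `|g z| <= `|g x0| + 1 by near: z.
  have H3 : forall j, `|DG j z| <= `|DG j x0| + 1 by near: z.
  have H4 : forall j l, `|DDG j l z| <= `|DDG j l x0| + 1 by near: z.
  split => //.
  - exact: le_trans H2 BG.
  - by move=> j; exact: le_trans (H3 j) (BD j).
  - by move=> j l; exact: le_trans (H4 j l) (BDD j l).
move=> /nbhs_ballP[r1 /= r10 Hr1].
have [a a0 acoer] := posdef_coercive gpos.
pose K := n%:R ^+ 2 * B + n%:R ^+ 3 * B + n%:R ^+ 4 * B + 2 / a + 1.
have n0 : 0 <= n%:R :> R by [].
have k2 : 0 <= n%:R ^+ 2 * B by rewrite mulr_ge0 ?exprn_ge0.
have k3 : 0 <= n%:R ^+ 3 * B by rewrite mulr_ge0 ?exprn_ge0.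
have k4 : 0 <= n%:R ^+ 4 * B by rewrite mulr_ge0 ?exprn_ge0.
have ka : 0 < 2 / a by rewrite divr_gt0.
pose r := Num.min (r1 / 4) (a / (2 * (n%:R ^+ 3 * B + 1))).
have r0 : 0 < r by rewrite lt_min !divr_gt0// mulr_gt0// ltr_wpDl.
have rr1 : r <= r1 / 4 by rewrite ge_min lexx.
have bd z : `|z - x0| < r1 -> [/\ U z, `|g z| <= B, forall j, `|DG j z| <= B &
    forall j l, `|DDG j l z| <= B].
  by move=> zr; apply: Hr1; rewrite -ball_normE /= distrC.
have inr z : `|z - x0| <= r -> `|z - x0| < r1 by move=> h; lra.
have seg z y w : `|z - x0| <= r -> `|y - x0| <= r -> `|w - z| <= `|y - z| ->
    `|w - x0| < r1.
  move=> zr yr wz.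
  have := ler_normD (w - z) (z - x0); rewrite addrA subrK.
  have := ler_normB (y - x0) (z - x0); rewrite opprB addrA subrK.
  lra.
have Lip (f : 'rV[R]_n -> 'M[R]_n) (df : 'I_n -> 'rV[R]_n -> 'M[R]_n) z y i k :
    (forall j w, U w -> derivable f w (e_ j)) -> (forall j w, 'D_(e_ j) f w = df j w) ->
    (forall j w, `|w - x0| < r1 -> `|df j w| <= B) ->
    `|z - x0| <= r -> `|y - x0| <= r -> `|(f y - f z) i k| <= n%:R * B * `|y - z|.
  move=> d1 d2 d3 zr yr.
  have M := @mean_value_coord _ _ (fun w => f w i k) (fun j w => df j w i k) (fun=> 0) B z y.
  rewrite [\sum_(j < n) _]big1 ?subr0 in M; last by move=> j _; rewrite mulr0.
  rewrite !mxE; apply: M => w wz j; have wr := seg z y w zr yr wz; split.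
    by rewrite -d2; apply: is_derive_entry; apply: d1; case: (bd w wr).
  by rewrite subr0; apply: le_trans (le_entry_norm _ _ _) _; exact: d3.
have LipG z y i k : `|z - x0| <= r -> `|y - x0| <= r ->
    `|(g y - g z) i k| <= n%:R * B * `|y - z|.
  by apply: (Lip g DG z y i k dg) => // j w /bd[].
have LipDG j z y i k : `|z - x0| <= r -> `|y - x0| <= r ->
    `|(DG j y - DG j z) i k| <= n%:R * B * `|y - z|.
  by apply: (Lip (DG j) (DDG j) z y i k (dDG j)) => // l w /bd[].
have TayG z y i k : `|z - x0| <= r -> `|y - x0| <= r ->
    `|(g y - g z - \sum_j (y - z) 0 j *: DG j z) i k| <= n%:R ^+ 2 * B * `|y - z| ^+ 2.
  move=> zr yr.
  have -> : (g y - g z - \sum_j (y - z) 0 j *: DG j z) i k =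
      g y i k - g z i k - \sum_j (y - z) 0 j * DG j z i k.
    by rewrite !mxE summxE; congr (_ - _ - _); apply: eq_bigr => j _; rewrite !mxE.
  have -> : n%:R ^+ 2 * B * `|y - z| ^+ 2 = n%:R * (n%:R * B * `|y - z|) * `|y - z|.
    by ring.
  apply: (@mean_value_coord _ _ (fun w => g w i k) (fun j w => DG j w i k)).
  move=> w wz j; have wr := seg z y w zr yr wz; split.
    by apply: is_derive_entry; apply: dg; case: (bd w wr).
  have -> : DG j w i k - DG j z i k = (DG j w - DG j z) i k by rewrite !mxE.
  apply: (@le_trans _ _ (n%:R * B * `|w - z|)); last first.
    by rewrite ler_wpM2l// mulr_ge0.
  (* [w] may lie outside the ball of radius [r], so the mean value inequality
     is applied again on the smaller box spanned by [z] and [w]. *)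
  have M := @mean_value_coord _ _ (fun w => DG j w i k) (fun l w => DDG j l w i k)
    (fun=> 0) B z w.
  rewrite [\sum_(l < n) _]big1 ?subr0 in M; last by move=> l _; rewrite mulr0.
  rewrite !mxE; apply: M => w' wz' l; have wr' := seg z y w' zr yr (le_trans wz' wz).
  have [Uw' _ _ D3] := bd w' wr'; split; first by apply: is_derive_entry; exact: dDG.
  by rewrite subr0; apply: le_trans (le_entry_norm _ _ _) _.
have mono c c' d u w : c <= c' -> 0 <= d -> c * d * `|u| * `|w| <= c' * d * `|u| * `|w|.
  by move=> cc d0; rewrite !ler_wpM2r.
exists r, K; split => //; first by move=> z /inr/bd[].
split.
- by rewrite /K; lra.
- by move=> z /inr/bd[Uz _ _ _]; exact: gsym.
- move=> z u w /inr/bd[_ gB _ _].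
  apply: le_trans (bilin_norm_le u w (fun i j => le_trans (le_entry_norm _ i j) gB)) _.
  by rewrite !ler_wpM2r// /K; lra.
- move=> z u zr; have x0r : `|x0 - x0| <= r by rewrite subrr normr0 ltW.
  have H := bilin_norm_le u u (fun i k => LipG x0 z i k x0r zr).
  rewrite bilin_mxB in H.
  have H2 : n%:R ^+ 2 * (n%:R * B * `|z - x0|) * `|u| * `|u| <= a / 2 * `|u| ^+ 2.
    rewrite -mulrA -expr2 ler_wpM2r ?exprn_ge0//.
    have -> : n%:R ^+ 2 * (n%:R * B * `|z - x0|) = (n%:R ^+ 3 * B) * `|z - x0| by ring.
    have : r <= a / (2 * (n%:R ^+ 3 * B + 1)) by rewrite ge_min lexx orbT.
    rewrite ler_pdivlMr ?mulr_gt0 ?ltr_wpDl// => ra.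
    have : (n%:R ^+ 3 * B) * `|z - x0| <= (n%:R ^+ 3 * B) * r by rewrite ler_wpM2l.
    lra.
  have H3 := acoer u.
  have H4 : a / 2 * `|u| ^+ 2 <= bilin (g z) u u.
    move: H; rewrite ler_norml => /andP[H _]; lra.
  have : `|u| ^+ 2 <= 2 / a * bilin (g z) u u.
    have -> : `|u| ^+ 2 = 2 / a * (a / 2 * `|u| ^+ 2) by field; rewrite gt_eqF.
    by rewrite ler_wpM2l// ltW.
  move=> /le_trans; apply; apply: ler_wpM2r; last by rewrite /K; lra.
  by apply: le_trans H4; rewrite mulr_ge0 ?exprn_ge0// divr_ge0// ltW.
- move=> z y u w zr yr; rewrite -bilin_mxB.
  apply: le_trans (bilin_norm_le u w (fun i k => LipG z y i k zr yr)) _.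
  have -> : n%:R ^+ 2 * (n%:R * B * `|y - z|) = n%:R ^+ 3 * B * `|y - z| by ring.
  by apply: mono => //; rewrite /K; lra.
- move=> j z u w /inr/bd[_ _ gB _].
  apply: le_trans (bilin_norm_le u w (fun i k => le_trans (le_entry_norm _ i k) (gB j))) _.
  by rewrite !ler_wpM2r// /K; lra.
- move=> j z y u w zr yr; rewrite -bilin_mxB.
  apply: le_trans (bilin_norm_le u w (fun i k => LipDG j z y i k zr yr)) _.
  have -> : n%:R ^+ 2 * (n%:R * B * `|y - z|) = n%:R ^+ 3 * B * `|y - z| by ring.
  by apply: mono => //; rewrite /K; lra.
- move=> z y u w zr yr.
  have -> : bilin (g y) u w - bilin (g z) u w - \sum_j (y - z) 0 j * bilin (DG j z) u w =
      bilin (g y - g z - \sum_j (y - z) 0 j *: DG j z) u w.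
    rewrite !bilin_mxB bilin_mx_sum; congr (_ - _).
    by apply: eq_bigr => j _; rewrite bilin_mxZ.
  apply: le_trans (bilin_norm_le u w (fun i k => TayG z y i k zr yr)) _.
  have -> : n%:R ^+ 2 * (n%:R ^+ 2 * B * `|y - z| ^+ 2) = n%:R ^+ 4 * B * `|y - z| ^+ 2.
    by ring.
  by apply: mono; rewrite ?exprn_ge0// /K; lra.
Unshelve. all: by end_near. Qed.

End LocalBounds.

(** * Calibrations *)

Section LinearForms.
Context {R : realType} {n : nat}.
Implicit Types (v w z : 'rV[R]_n) (a : 'I_n -> R) (c : R -> 'rV[R]_n).

Definition linform a v : R := \sum_j v 0 j * a j.

Lemma linformD a v w : linform a (v + w) = linform a v + linform a w.
Proof. by rewrite /linform -big_split; apply: eq_bigr => j _; rewrite mxE mulrDl. Qed.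

Lemma linformZ a (x : R) v : linform a (x *: v) = x * linform a v.
Proof. by rewrite /linform mulr_sumr; apply: eq_bigr => j _; rewrite mxE mulrA. Qed.

Lemma bilin_linform (A : 'M[R]_n) v w :
  bilin A v w = linform (fun j => bilin A (delta_mx 0 j) w) v.
Proof.
rewrite /linform {1}(row_sum_delta v) /bilin !mulmx_suml summxE.
by apply: eq_bigr => j _; rewrite -!scalemxAl mxE.
Qed.

Lemma is_derive_linform a c (t : R) v z : is_derive t 1 c v ->
  is_derive t 1 (fun s => linform a (c s - z)) (linform a v).
Proof.
move=> dc.
have D j : is_derive t 1 (fun s => (c s - z) 0 j * a j) (v 0 j * a j).
  have := is_derive_coord j dc => dcj.
  apply: is_derive_near => e e0.
  have e1 : 0 < e / (`|a j| + 1) by rewrite divr_gt0// ltr_wpDl.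
  have := is_derive_approx dcj e1; apply: filterS => s.
  rewrite !mxE => H.
  have -> : (c s 0 j - z 0 j) * a j - (c t 0 j - z 0 j) * a j - v 0 j * a j * (s - t) =
    (c s 0 j - c t 0 j - v 0 j * (s - t)) * a j by ring.
  rewrite normrM; apply: le_trans (ler_wpM2r (normr_ge0 _) H) _.
  rewrite mulrAC ler_wpM2r// -mulrA ger_pMr// mulrC ler_pdivrMr ?ltr_wpDl//.
  by rewrite mul1r lerDl.
have := is_derive_sum D; rewrite /linform.
by rewrite (_ : \sum_i _ = fun s => \sum_j (c s - z) 0 j * a j)// fct_sumE.
Qed.

Lemma continuous_linform a c (t : R) : {for t, continuous c} ->
  {for t, continuous (fun s => linform a (c s))}.
Proof.
move=> cc; apply: cvg_big => // [|j _]; first exact: add_continuous.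
apply: cvgM; last exact: cvg_cst.
exact: (cvg_comp _ _ cc (@coord_continuous _ _ _ 0 j (c t))).
Qed.

End LinearForms.

Lemma ler_of_sqr {R : realType} (x y : R) : 0 <= y -> x ^+ 2 <= y ^+ 2 -> x <= y.
Proof. by move=> y0 xy; case: (leP x y) => // yx; nra. Qed.

Lemma sqr_le {R : realType} (x y : R) : 0 <= x -> x <= y -> x ^+ 2 <= y ^+ 2.
Proof. by move=> x0 xy; nra. Qed.

(** The real inequality behind [calibration_slope_le]: the term in
    [`|a| * nu * t] is absorbed by [nu ^+ 2 / L] at the price of an error of
    second order in [t]. *)
Lemma calibration_ineq {R : realType} (L a nu t mu rho B : R) :
  1 <= L -> 0 <= nu -> 0 <= t -> 16 * L ^+ 9 * t <= 1 ->
  `|mu| <= L ^+ 2 * t -> `|rho| <= L ^+ 4 * nu * t ->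
  a ^+ 2 * (1 + mu) + nu ^+ 2 / L - 2 * L ^+ 2 * `|a| * t * nu - L * t * nu ^+ 2
    - 2 * L ^+ 2 * t ^+ 2 * a ^+ 2 - 2 * L * t ^+ 2 * nu ^+ 2 <= B ->
  a ^+ 2 <= L ^+ 5 * B ->
  (a * (1 + mu / 2) + rho) ^+ 2 <= B * (1 + 16 * L ^+ 14 * t ^+ 2) ^+ 2.
Proof.
move=> L1 nu0 t0 tL mut rhot Ble aB.
have L0 : 0 < L by lra.
have L0' : 0 <= L by exact: ltW.
have Lk k : 0 <= L ^+ k by exact: exprn_ge0.
have B0 : 0 <= B.
  by move: (le_trans (sqr_ge0 a) aB); rewrite pmulr_rge0// exprn_gt0.
have L2t : L ^+ 2 * t <= 1 / 16.
  have : L ^+ 2 * t <= L ^+ 9 * t by rewrite ler_wpM2r// ler_weXn2l.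
  by lra.
have t1 : t <= 1 / 16.
  have : 1 * t <= L ^+ 9 * t by rewrite ler_wpM2r// exprn_ege1.
  by lra.
set X := `|a| * t; have X0 : 0 <= X by rewrite mulr_ge0.
have X2 : X ^+ 2 = a ^+ 2 * t ^+ 2 by rewrite /X exprMn real_normK ?num_real.
have mu2 : mu ^+ 2 * a ^+ 2 <= L ^+ 4 * X ^+ 2.
  have : mu ^+ 2 <= (L ^+ 2 * t) ^+ 2.
    by rewrite -(real_normK (num_real mu)) lerXn2r ?nnegrE ?mulr_ge0 ?Lk.
  move=> /(ler_wpM2r (sqr_ge0 a)); rewrite X2 => /le_trans; apply.
  by rewrite le_eqVlt; apply/orP; left; apply/eqP; ring.
have rho2 : rho ^+ 2 <= L ^+ 8 * t ^+ 2 * nu ^+ 2.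
  have : rho ^+ 2 <= (L ^+ 4 * nu * t) ^+ 2.
    by rewrite -(real_normK (num_real rho)) lerXn2r ?nnegrE ?mulr_ge0 ?Lk.
  by move=> /le_trans; apply; rewrite le_eqVlt; apply/orP; left; apply/eqP; ring.
have cross : 2 * (a * (1 + mu / 2)) * rho <= 3 * L ^+ 4 * X * nu.
  apply: le_trans (ler_norm _) _; rewrite !normrM (ger0_norm (_ : 0 <= 2))//.
  have -> : 3 * L ^+ 4 * X * nu = 2 * (`|a| * (3 / 2)) * (L ^+ 4 * nu * t).
    by rewrite /X; field.
  apply: ler_pM; [by rewrite !mulr_ge0|by []| |exact: rhot].
  rewrite ler_wpM2l// ler_wpM2l//.
  apply: le_trans (ler_normD _ _) _; rewrite normr1 normrM (ger0_norm (_ : 0 <= 2^-1))//.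
  by lra.
have L42 : L ^+ 2 * X ^+ 2 <= L ^+ 4 * X ^+ 2 by rewrite ler_wpM2r ?sqr_ge0// ler_weXn2l.
have L42' : L ^+ 2 * (X * nu) <= L ^+ 4 * (X * nu).
  by rewrite ler_wpM2r ?mulr_ge0// ler_weXn2l.
have L94 : L ^+ 4 * X ^+ 2 <= L ^+ 9 * X ^+ 2 by rewrite ler_wpM2r ?sqr_ge0// ler_weXn2l.
have amgm : 5 * L ^+ 4 * (X * nu) <= 25 / 2 * L ^+ 9 * X ^+ 2 + nu ^+ 2 / (2 * L).
  have := sqr_ge0 (5 * L ^+ 5 * X - nu).
  have : 0 <= 1 / (2 * L) by rewrite divr_ge0// mulr_ge0// ltW.
  move=> h1 h2; have := mulr_ge0 h1 h2.
  have -> : 1 / (2 * L) * (5 * L ^+ 5 * X - nu) ^+ 2 =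
    25 / 2 * L ^+ 9 * X ^+ 2 + nu ^+ 2 / (2 * L) - 5 * L ^+ 4 * (X * nu).
    by field; rewrite gt_eqF.
  by lra.
have small : (L ^+ 8 * t ^+ 2 + L * t + 2 * L * t ^+ 2) * nu ^+ 2 <= nu ^+ 2 / (2 * L).
  rewrite mulrC ler_wpM2l ?sqr_ge0// -[leRHS]div1r ler_pdivlMr ?mulr_gt0//.
  have : L ^+ 9 * t * t <= 1 / 16 * (1 / 16) by apply: ler_pM; rewrite ?mulr_ge0 ?Lk//; lra.
  have : L ^+ 2 * t * t <= 1 / 16 * (1 / 16) by apply: ler_pM; rewrite ?mulr_ge0 ?Lk//.
  by lra.
have half : nu ^+ 2 / (2 * L) = nu ^+ 2 / L / 2 by field; rewrite gt_eqF.
have main : (a * (1 + mu / 2) + rho) ^+ 2 <= B + 16 * L ^+ 9 * X ^+ 2.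
  have -> : (a * (1 + mu / 2) + rho) ^+ 2 =
    a ^+ 2 * (1 + mu) + (mu ^+ 2 * a ^+ 2) / 4 + 2 * (a * (1 + mu / 2)) * rho + rho ^+ 2.
    by field.
  have eX : 2 * L ^+ 2 * `|a| * t * nu = 2 * (L ^+ 2 * (X * nu)) by rewrite /X; ring.
  have eX2 : 2 * L ^+ 2 * t ^+ 2 * a ^+ 2 = 2 * (L ^+ 2 * X ^+ 2) by rewrite X2; ring.
  rewrite eX eX2 in Ble; rewrite half in amgm small.
  have := mulr_ge0 (Lk 4%N) (sqr_ge0 X).
  by lra.
apply: (le_trans main).
have : L ^+ 9 * X ^+ 2 <= L ^+ 14 * t ^+ 2 * B.
  rewrite X2; have -> : L ^+ 14 * t ^+ 2 * B = L ^+ 9 * (L ^+ 5 * B * t ^+ 2) by ring.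
  by rewrite ler_wpM2l// ler_wpM2r// sqr_ge0.
have : 0 <= B * (16 * L ^+ 14 * t ^+ 2) by rewrite !mulr_ge0 ?sqr_ge0.
have : 0 <= B * (16 * L ^+ 14 * t ^+ 2) ^+ 2 by rewrite mulr_ge0 ?sqr_ge0.
have -> : B * (1 + 16 * L ^+ 14 * t ^+ 2) ^+ 2 = B + 2 * (B * (16 * L ^+ 14 * t ^+ 2)) +
  B * (16 * L ^+ 14 * t ^+ 2) ^+ 2 by ring.
by lra.
Qed.

Section Calibration.
Context {R : realType} {n : nat}.
Implicit Types (u v w z m e : 'rV[R]_n).
Context (x0 : 'rV[R]_n) (r K : R).
Context (G : 'rV[R]_n -> 'M[R]_n) (DG : 'I_n -> 'rV[R]_n -> 'M[R]_n).
Hypothesis GP : regular_metric x0 r K G DG.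

Let K1 : 1 <= K := rm_K1 GP.
(** The factor [n + 1] allows for the sum over the partial derivatives of the
    metric, so that a single constant serves for the metric and for its
    differential. *)
Definition cal_const : R := (n%:R + 1) * K.
Local Notation L := cal_const.
Let L1 : 1 <= L.
Proof. by rewrite /L -[leLHS]mul1r; apply: ler_pM => //; rewrite lerDr. Qed.
Let KL : K <= L.
Proof. by move: K1 => k1; rewrite /L -[leLHS]mul1r ler_wpM2r ?lerDr//; lra. Qed.

Context (m e : 'rV[R]_n).
Hypothesis mr : `|m - x0| <= r.
Hypothesis e0 : e != 0.

Let beta := bilin (G m) e e.
Let kap := linform (fun j => bilin (G m) (delta_mx 0 j) e).
Let muf := linform (fun j => bilin (DG j m) e e).

(** The linear form [kap] is dual to [e] for the metric at [m].  The quadratic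
    terms compensate the first order variation of the metric around [m]: along
    the line through [m] in the direction [e] the slope of [calibration] in the
    direction [e] is [beta + s * muf e / 2] at [m + s *: e], which is
    [sqrt beta] times the length of [e] at this point up to second order in
    [s]. *)
Definition calibration z : R := kap (z - m) + muf (z - m) * kap (z - m) / (2 * beta)
  - muf e * kap (z - m) ^+ 2 / (4 * beta ^+ 2).

Definition calibration_slope z v : R := kap v
  + (muf v * kap (z - m) + muf (z - m) * kap v) / (2 * beta)
  - muf e * kap (z - m) * kap v / (2 * beta ^+ 2).

Let K0 : 0 <= K. Proof. exact: le_trans K1. Qed.

Let elliptic z v : `|z - x0| <= r -> `|v| ^+ 2 <= L * bilin (G z) v v.
Proof.
move=> zr; apply: le_trans (rm_elliptic GP v zr) _; apply: ler_wpM2r KL.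
have := le_trans (sqr_ge0 `|v|) (rm_elliptic GP v zr).
by rewrite pmulr_rge0// (lt_le_trans ltr01).
Qed.

Let beta_ge : `|e| ^+ 2 <= L * beta.
Proof. exact: elliptic. Qed.

Lemma beta_gt0 : 0 < beta.
Proof.
have : 0 < L * beta by apply: lt_le_trans beta_ge; rewrite exprn_gt0// normr_gt0.
by rewrite pmulr_rgt0//; move: L1 => l1; lra.
Qed.

Let kapE v : kap v = bilin (G m) v e.
Proof. by rewrite bilin_linform. Qed.

Let Q w := \sum_j w 0 j *: DG j m.

Let QE w u v : bilin (Q w) u v = \sum_j w 0 j * bilin (DG j m) u v.
Proof. by rewrite bilin_mx_sum; apply: eq_bigr => j _; rewrite bilin_mxZ. Qed.

Let mufE w : muf w = bilin (Q w) e e.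
Proof. by rewrite QE. Qed.

Let Q_le w u v : `|bilin (Q w) u v| <= L * `|w| * `|u| * `|v|.
Proof.
rewrite QE; apply: le_trans (ler_norm_sum _ _ _) _.
apply: (@le_trans _ _ (\sum_(j < n) `|w| * (K * `|u| * `|v|))).
  apply: ler_sum => j _; rewrite normrM; apply: ler_pM => //.
    exact: le_coord_norm.
  exact: (rm_dbound GP).
rewrite sumr_const card_ord -[leLHS]mulr_natl.
have -> : n%:R * (`|w| * (K * `|u| * `|v|)) = n%:R * K * `|w| * `|u| * `|v| by ring.
have nK : n%:R * K <= L by rewrite /L mulrDl mul1r lerDl.
by do 3 (apply: ler_wpM2r => //).
Qed.

#[local] Opaque cal_const.

(** The quadratic terms take the same value at the two ends of a segment
    centred at [m]. *)
Lemma calibration_increment :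
  calibration (m + 2^-1 *: e) - calibration (m - 2^-1 *: e) = beta.
Proof.
have b0 := beta_gt0; rewrite /calibration.
have -> : m + 2^-1 *: e - m = 2^-1 *: e by rewrite addrAC subrr add0r.
have -> : m - 2^-1 *: e - m = (- 2^-1) *: e by rewrite addrAC subrr add0r scaleNr.
rewrite /muf /kap !linformZ -/muf -/kap kapE -/beta.
by field; rewrite gt_eqF.
Qed.

(** Decompose [v = a *: e + u] with [u] orthogonal to [e] at [m].  For [u = 0]
    the quadratic terms of [calibration] match the metric to first order.  The
    contribution of [u] to the slope is of order [`|u| * `|z - m|], and it is
    absorbed by the positive term [`|u| ^+ 2] of the squared length of [v]. *)
Lemma calibration_slope_le z v : `|z - x0| <= r -> 16 * L ^+ 9 * `|z - m| <= 1 ->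
  calibration_slope z v ^+ 2 <=
  beta * (bilin (G z) v v * (1 + 16 * L ^+ 14 * `|z - m| ^+ 2) ^+ 2).
Proof.
move=> zr tL; set t := `|z - m|; set w := z - m.
have b0 := beta_gt0; have b0' : beta != 0 by rewrite gt_eqF.
pose s := Num.sqrt beta; have s0 : 0 < s by rewrite sqrtr_gt0.
have ss : s ^+ 2 = beta by rewrite sqr_sqrtr// ltW.
have k0 := K0; have l1 := L1; have s0' : 0 <= s by exact: ltW.
have L0 : 0 < L by lra.
have L0' : 0 <= L by exact: ltW.
have Lk k : 0 <= L ^+ k by exact: exprn_ge0.
have t0 : 0 <= t by exact: normr_ge0.
have es : `|e| <= L * s.
  have : `|e| ^+ 2 <= (L * s) ^+ 2.
    apply: le_trans beta_ge _; rewrite exprMn ss; apply: ler_wpM2r; first exact: ltW.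
    by rewrite expr2 ler_peMr// ltW.
  by apply: ler_of_sqr; exact: mulr_ge0.
pose a := kap v / beta; pose u := v - a *: e.
have vE : v = a *: e + u by rewrite /u addrCA subrr addr0.
have kape : kap e = beta by exact: kapE.
have kapu : kap u = 0.
  by rewrite /u /kap linformD -scaleNr linformZ -/kap kape /a mulNr divfK// subrr.
clearbody u.
have bue : bilin (G m) u e = 0 by move: kapu; rewrite kapE.
have beu : bilin (G m) e u = 0 by rewrite (bilin_sym _ _ (rm_sym GP mr)) bue.
pose nu := `|u|; have nu0 : 0 <= nu by exact: normr_ge0.
pose mu := muf w / beta; pose rho := muf u * kap w / (2 * beta * s).
have e2 : `|e| * `|e| <= L * beta by rewrite -expr2; exact: beta_ge.
have muf_le x : `|muf x| <= L ^+ 2 * `|x| * beta.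
  rewrite mufE; apply: le_trans (Q_le _ _ _) _.
  have -> : L ^+ 2 * `|x| * beta = L * `|x| * (L * beta) by ring.
  by rewrite -mulrA ler_wpM2l// mulr_ge0.
have kap_le x : `|kap x| <= L ^+ 2 * `|x| * s.
  rewrite kapE; apply: le_trans (rm_bound GP _ _ mr) _.
  have -> : L ^+ 2 * `|x| * s = L * `|x| * (L * s) by ring.
  have KL' := KL; apply: ler_pM => //; first by rewrite mulr_ge0.
  exact: ler_wpM2r.
have S : calibration_slope z v = s * (a * s * (1 + mu / 2) + rho).
  rewrite /calibration_slope -/w.
  have -> : muf v = a * muf e + muf u by rewrite vE /muf linformD linformZ.
  have -> : kap v = a * beta by rewrite /a divfK.
  rewrite /mu /rho mulrDr.
  have -> : s * (a * s * (1 + muf w / beta / 2)) = a * s ^+ 2 * (1 + muf w / beta / 2) by ring.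
  have -> : s * (muf u * kap w / (2 * beta * s)) = muf u * kap w / (2 * beta).
    by field; rewrite b0' gt_eqF.
  by rewrite ss; field; rewrite b0'.
have muL : `|mu| <= L ^+ 2 * t.
  by rewrite normrM normfV (gtr0_norm b0) ler_pdivrMr.
have rhoL : `|rho| <= L ^+ 4 * nu * t.
  have bs : 0 < 2 * beta * s by rewrite !mulr_gt0.
  rewrite normrM normfV normrM (gtr0_norm bs) ler_pdivrMr//.
  have -> : L ^+ 4 * nu * t * (2 * beta * s) = 2 * ((L ^+ 2 * nu * beta) * (L ^+ 2 * t * s)).
    by ring.
  apply: (@le_trans _ _ ((L ^+ 2 * nu * beta) * (L ^+ 2 * t * s))).
    by apply: ler_pM.
  have b00 : 0 <= beta by exact: ltW.
  by apply: ler_peMl; rewrite ?ler1n// !mulr_ge0.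
have an : `|a| * `|e| <= L * `|a * s|.
  by rewrite (normrM a s) (gtr0_norm s0) mulrCA ler_wpM2l.
have ae2 : (`|a| * `|e|) ^+ 2 <= L * (a * s) ^+ 2.
  rewrite exprMn real_normK ?num_real// (exprMn _ a s) ss.
  have -> : L * (a ^+ 2 * beta) = a ^+ 2 * (L * beta) by ring.
  by apply: ler_wpM2l; [exact: sqr_ge0|exact: beta_ge].
have v2 : `|v| ^+ 2 <= 2 * L * (a * s) ^+ 2 + 2 * nu ^+ 2.
  have : `|v| <= `|a| * `|e| + nu by rewrite {1}vE -normrZ ler_normD.
  move=> h; have : `|v| ^+ 2 <= (`|a| * `|e| + nu) ^+ 2.
    by apply: sqr_le.
  have := sqr_ge0 (`|a| * `|e| - nu).
  rewrite sqrrB sqrrD; lra.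
have T : `|bilin (G z) v v - bilin (G m) v v - bilin (Q w) v v| <= L * t ^+ 2 * `|v| ^+ 2.
  rewrite QE; apply: le_trans (rm_taylor GP v v mr zr) _.
  by rewrite -mulrA -expr2 -/w -/t -2!mulrA ler_wpM2r// mulr_ge0 ?sqr_ge0.
have bvv : bilin (G m) v v = (a * s) ^+ 2 + bilin (G m) u u.
  rewrite {1 2}vE !(bilinDl, bilinDr, bilinZl, bilinZr) bue beu -/beta.
  by rewrite exprMn ss; ring.
have buu : nu ^+ 2 / L <= bilin (G m) u u.
  by rewrite ler_pdivrMr// mulrC; exact: elliptic.
have qvv : bilin (Q w) v v = (a * s) ^+ 2 * mu + a * (bilin (Q w) e u + bilin (Q w) u e)
    + bilin (Q w) u u.
  rewrite {1 2}vE !(bilinDl, bilinDr, bilinZl, bilinZr) -mufE /mu exprMn ss.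
  by field.
have qeu : `|a * (bilin (Q w) e u + bilin (Q w) u e)| <= 2 * L ^+ 2 * `|a * s| * t * nu.
  rewrite (normrM a).
  have h1 := Q_le w e u; have h2 := Q_le w u e.
  apply: (@le_trans _ _ (`|a| * (2 * (L * t * `|e| * nu)))).
    rewrite ler_wpM2l//; apply: le_trans (ler_normD _ _) _.
    by move: h1 h2; rewrite -/t -/nu; lra.
  have -> : `|a| * (2 * (L * t * `|e| * nu)) = (`|a| * `|e|) * (2 * L * t * nu) by ring.
  have -> : 2 * L ^+ 2 * `|a * s| * t * nu = (L * `|a * s|) * (2 * L * t * nu) by ring.
  by rewrite ler_wpM2r// !mulr_ge0.
have quu : `|bilin (Q w) u u| <= L * t * nu ^+ 2.
  by apply: le_trans (Q_le w u u) _; rewrite -mulrA -expr2.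
have aB : (a * s) ^+ 2 <= L ^+ 5 * bilin (G z) v v.
  have h : a * s = kap v / s.
    have -> : kap v = a * s ^+ 2 by rewrite ss /a divfK.
    by field; rewrite gt_eqF.
  have h2 : `|a * s| <= L ^+ 2 * `|v|.
    by rewrite h normrM normfV (gtr0_norm s0) ler_pdivrMr.
  have h3 : (a * s) ^+ 2 <= (L ^+ 2 * `|v|) ^+ 2.
    by rewrite -(real_normK (num_real (a * s))); exact: sqr_le.
  apply: (le_trans h3).
  have -> : (L ^+ 2 * `|v|) ^+ 2 = L ^+ 4 * `|v| ^+ 2 by ring.
  have -> : L ^+ 5 * bilin (G z) v v = L ^+ 4 * (L * bilin (G z) v v) by ring.
  by apply: ler_wpM2l => //; exact: elliptic.
have Ble : (a * s) ^+ 2 * (1 + mu) + nu ^+ 2 / L - 2 * L ^+ 2 * `|a * s| * t * nu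
    - L * t * nu ^+ 2 - 2 * L ^+ 2 * t ^+ 2 * (a * s) ^+ 2 - 2 * L * t ^+ 2 * nu ^+ 2
    <= bilin (G z) v v.
  have h : L * t ^+ 2 * `|v| ^+ 2 <= L * t ^+ 2 * (2 * L * (a * s) ^+ 2 + 2 * nu ^+ 2).
    by rewrite ler_wpM2l// mulr_ge0 ?sqr_ge0.
  move: T qeu quu; rewrite !ler_norml => /andP[T1 T2] /andP[q1 q2] /andP[q3 q4].
  lra.
have := calibration_ineq l1 nu0 t0 tL muL rhoL Ble aB.
by rewrite S (exprMn _ s) ss => H; apply: ler_wpM2l => //; exact: ltW.
Qed.

(** This and the continuity of the slope along curves are what the fundamental
    theorem of calculus requires in order to bound the variation of
    [calibration] along a curve. *)
Lemma is_derive_calibration (c : R -> 'rV[R]_n) (t : R) v : is_derive t 1 c v ->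
  is_derive t 1 (calibration \o c) (calibration_slope (c t) v).
Proof.
move=> dc; have b0' : beta != 0 by rewrite gt_eqF// beta_gt0.
have dk : is_derive t 1 (fun s => kap (c s - m)) (kap v) := is_derive_linform _ m dc.
have dm : is_derive t 1 (fun s => muf (c s - m)) (muf v) := is_derive_linform _ m dc.
have -> : calibration \o c = (fun s => kap (c s - m))
    + (2 * beta)^-1 *: ((fun s => muf (c s - m)) * (fun s => kap (c s - m)))
    - (muf e / (4 * beta ^+ 2)) *: ((fun s => kap (c s - m)) * (fun s => kap (c s - m))).
  apply/funext => s; rewrite /calibration /=.
  rewrite -[RHS]/(kap (c s - m) + (2 * beta)^-1 * (muf (c s - m) * kap (c s - m))
    - (muf e / (4 * beta ^+ 2)) * (kap (c s - m) * kap (c s - m))).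
  by field.
have D1 := is_deriveM dm dk; have D2 := is_deriveM dk dk.
have D := is_deriveB (is_deriveD dk (is_deriveZ (2 * beta)^-1 D1))
  (is_deriveZ (muf e / (4 * beta ^+ 2)) D2).
apply: (is_derive_eq D); rewrite /calibration_slope /GRing.scale /=.
by field.
Qed.

Lemma continuous_calibration_slope (c w : R -> 'rV[R]_n) (t : R) :
  {for t, continuous c} -> {for t, continuous w} ->
  {for t, continuous (fun s => calibration_slope (c s) (w s))}.
Proof.
move=> cc cw.
have cm : {for t, continuous (fun s => c s - m)} by apply: cvgB => //; exact: cvg_cst.
have k1 := @continuous_linform R n (fun j => bilin (G m) (delta_mx 0 j) e) _ t cw.
have k2 := @continuous_linform R n (fun j => bilin (G m) (delta_mx 0 j) e) _ t cm.
have m1 := @continuous_linform R n (fun j => bilin (DG j m) e e) _ t cw.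
have m2 := @continuous_linform R n (fun j => bilin (DG j m) e e) _ t cm.
apply: cvgB; last first.
  by apply: cvgM; [apply: cvgM; [apply: cvgM => //; [exact: cvg_cst]|]|exact: cvg_cst].
apply: cvgD => //; apply: cvgM; last exact: cvg_cst.
by apply: cvgD; apply: cvgM.
Qed.

End Calibration.

(** * Third order comparison of the distance with the metric *)

Section FundamentalTheorem.
Context {R : realType}.
Local Notation mu := (@lebesgue_measure R).

Lemma Rintegral_derive (F f : R -> R) (a b : R) : a < b ->
  (forall t : R, t \in `[a, b] -> is_derive t 1 F (f t)) ->
  (forall t : R, t \in `[a, b] -> {for t, continuous f}) ->
  mu.-integrable `[a, b] (EFin \o f) /\
  \int[mu]_(t in `[a, b]) f t = F b - F a.
Proof.
move=> ab dF cf; have cF t : t \in `[a, b] -> {for t, continuous F}.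
  by move=> /dF[d _]; exact/differentiable_continuous/derivable1_diffP.
have C : {within `[a, b], continuous f}.
  by apply: continuous_in_subspaceT => t; rewrite inE /=; exact: cf.
split; first by apply: continuous_compact_integrable => //; exact: segment_compact.
rewrite /Rintegral.
have -> : (\int[mu]_(x in `[a, b]) (f x)%:E = (F b)%:E - (F a)%:E)%E.
  apply: continuous_FTC2 => //.
    split.
    - by move=> t /subset_itv_oo_cc/dF[].
    - by apply: cvg_at_right_filter; apply: cF; rewrite in_itv /= lexx ltW.
    - by apply: cvg_at_left_filter; apply: cF; rewrite in_itv /= lexx ltW.
  by move=> t /subset_itv_oo_cc/dF[_ <-]; rewrite derive1E.
by [].
Qed.

End FundamentalTheorem.

(** Differentials are tested on curves, which covers the linear forms and the
    calibration by the same argument. *)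
Definition differential_of {R : realType} {n : nat} (Phi : 'rV[R]_n -> R)
    (dPhi : 'rV[R]_n -> 'rV[R]_n -> R) : Prop :=
  (forall (c : R -> 'rV[R]_n) (t : R) v, is_derive t 1 c v ->
     is_derive t 1 (Phi \o c) (dPhi (c t) v)) /\
  (forall (c w : R -> 'rV[R]_n) (t : R),
     {for t, continuous c} -> {for t, continuous w} ->
     {for t, continuous (fun s => dPhi (c s) (w s))}).

Lemma differential_of_linform {R : realType} {n : nat} (a : 'I_n -> R) :
  differential_of (linform a) (fun _ => linform a).
Proof.
split=> [c t v dc|c w t _ cw]; last exact: continuous_linform.
have := is_derive_linform a 0 dc.
by rewrite (_ : (fun s => linform a (c s - 0)) = linform a \o c)//;
  apply/funext => s /=; rewrite subr0.
Qed.

Lemma regular_metric_weaken {R : realType} {n : nat} (x0 : 'rV[R]_n) (r r' K K' : R) G DG :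
  r' <= r -> K <= K' -> regular_metric x0 r K G DG -> regular_metric x0 r' K' G DG.
Proof.
move=> rr KK H; have k1 := rm_K1 H.
have ball z : `|z - x0| <= r' -> `|z - x0| <= r by move=> /le_trans; apply.
have mono (a b : R) (u w : 'rV[R]_n) : 0 <= a -> b <= K * a * `|u| * `|w| ->
    b <= K' * a * `|u| * `|w|.
  by move=> a0 /le_trans; apply; do 3 (apply: ler_wpM2r => //).
split.
- exact: le_trans KK.
- by move=> z /ball; exact: (rm_sym H).
- move=> z u w /ball zr; apply: le_trans (rm_bound H u w zr) _.
  by do 2 (apply: ler_wpM2r => //).
- move=> z u /ball zr; apply: le_trans (rm_elliptic H u zr) _.
  apply: ler_wpM2r => //; have := le_trans (sqr_ge0 `|u|) (rm_elliptic H u zr).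
  by rewrite pmulr_rge0// (lt_le_trans ltr01).
- by move=> z y u w /ball zr /ball yr; apply: mono => //; exact: (rm_lipschitz H).
- move=> j z u w /ball zr; apply: le_trans (rm_dbound H j u w zr) _.
  by do 2 (apply: ler_wpM2r => //).
- by move=> j z y u w /ball zr /ball yr; apply: mono => //; exact: (rm_dlipschitz H).
- move=> z y u w /ball zr /ball yr; apply: mono; first exact: exprn_ge0.
  exact: (rm_taylor H).
Qed.

Section ChartDistance.
Context {R : realType} {n : nat} {M : riemannian_manifold R n}.
Implicit Types (c : R -> M) (p q : M) (u v w x y z m e : 'rV[R]_n).
Local Notation mu := (@lebesgue_measure R).
Context (i : atlas_index M) (x0 : 'rV[R]_n) (r K : R).
Local Notation X := (cmap (atlas i)).
Local Notation Y := (cinv (atlas i)).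
Local Notation g := (metric i).
Local Notation U := (cmap (atlas i) @` cdom (atlas i)).
Local Notation DG := (fun j z => 'D_(delta_mx 0 j) (metric i) z).
Hypothesis r0 : 0 < r.
Hypothesis r1 : r <= 1.
Hypothesis UB : forall z, `|z - x0| <= 2 * r -> U z.
Hypothesis GP : regular_metric x0 (2 * r) K g DG.

Let K1 : 1 <= K := rm_K1 GP.
Let K0 : 0 <= K. Proof. exact: le_trans K1. Qed.

Let domY z : U z -> cdom (atlas i) (Y z).
Proof. by move=> [p ip <-]; rewrite cmapK. Qed.

Let XY z : U z -> X (Y z) = z.
Proof. by move=> [p ip <-]; rewrite cmapK. Qed.

(** The ball of twice the radius leaves room for the extension of the segment
    that [C1_curve_on_segment] asks for. *)
Lemma segment_ball x y (t : R) : `|x - x0| <= r -> `|y - x0| <= r ->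
  t \in `]0 - 2^-1, 1 + 2^-1[ -> `|x + t *: (y - x) - x0| <= 2 * r.
Proof.
move=> xr yr; rewrite in_itv /= => /andP[t1 t2].
have -> : x + t *: (y - x) - x0 = (1 - t) *: (x - x0) + t *: (y - x0).
  by apply/rowP => j; rewrite !mxE; ring.
apply: le_trans (ler_normD _ _) _; rewrite !normrZ.
have h1 : `|1 - t| * `|x - x0| <= `|1 - t| * r by rewrite ler_wpM2l.
have h2 : `|t| * `|y - x0| <= `|t| * r by rewrite ler_wpM2l.
have : (`|1 - t| + `|t|) * r <= 2 * r.
  apply: ler_wpM2r; first exact: ltW.
  case: (ler0P t) => ht; case: (ler0P (1 - t)) => h; lra.
by rewrite mulrDl; lra.
Qed.

Lemma segment_C1 x y : `|x - x0| <= r -> `|y - x0| <= r ->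
  C1_curve_on `]0 - 2^-1, 1 + 2^-1[ (fun t => Y (x + t *: (y - x))) /\
  forall t : R, t \in `]0 - 2^-1, 1 + 2^-1[ ->
    speed (fun t => Y (x + t *: (y - x))) t =
    Num.sqrt (bilin (g (x + t *: (y - x))) (y - x) (y - x)).
Proof.
move=> xr yr; set e := y - x; pose line (t : R) : 'rV[R]_n := x + t *: e.
pose I (t : R) : Prop := t \in `]0 - 2^-1, 1 + 2^-1[.
have lineU t : I t -> U (line t) by move=> It; apply: UB; exact: segment_ball.
have nI t : I t -> \forall s \near t, I s.
  by move=> It; exact: near_in_itvoo.
have dline (t : R) : is_derive t 1 line e by exact: is_derive_affine.
have cline : continuous line.
  by move=> t; apply/differentiable_continuous/derivable1_diffP; case: (dline t).
have C1 t : I t -> C1_at (Y \o line) t.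
  move=> It; split.
    by apply: continuous_comp; [exact: cline|exact: (cinv_continuous (lineU t It))].
  move=> j jt; pose tau := X \o Y.
  pose V := cmap (atlas i) @` (cdom (atlas i) `&` cdom (atlas j)).
  have Vt s : I s -> cdom (atlas j) (Y (line s)) -> V (line s).
    by move=> Is js; exists (Y (line s)); [split => //; exact: domY (lineU s Is)|exact: XY (lineU s Is)].
  have oV : open V by exact: overlap_open.
  have [S0 S1] := @atlas_smooth _ _ M i j 1%N.
  have D s : V (line s) -> is_derive s 1 (cmap (atlas j) \o (Y \o line))
      ('D_e (cmap (atlas j) \o Y) (line s)).
    move=> Vs; have [d E] := dline s.
    by have := C1_chain oV (@atlas_smooth _ _ M i j 1%N) Vs d; rewrite E.
  have VV := Vt t It jt.
  split; first by case: (D t VV).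
  have N : \forall s \near t, 'D_e (cmap (atlas j) \o Y) (line s) =
      derive1 (cmap (atlas j) \o (Y \o line)) s.
    have : \forall s \near t, V (line s).
      by apply: cline; exact: open_nbhs_nbhs.
    by apply: filterS => s /D[_ <-]; rewrite derive1E.
  rewrite /prop_for /continuous_at -(nbhs_singleton N).
  have C : {for t, continuous ('D_e (cmap (atlas j) \o Y) \o line)}.
    apply: continuous_comp; first exact: cline.
    by have [_ [cD _]] := S1 e; exact: cD.
  exact: cvg_trans (near_eq_cvg N) C.
split; first exact: C1.
move=> t It; have it : cdom (atlas i) (Y (line t)) by exact: domY (lineU t It).
rewrite (speed_chart (C1 t It) it) /chart_speed XY; last exact: lineU.
suff -> : derive1 (X \o (Y \o line)) t = e by [].
have [_ <-] := dline t; rewrite derive1E; apply: near_eq_derive.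
by apply: filterS (nI t It) => s /lineU/XY.
Qed.

Lemma joined_chart x y : `|x - x0| <= r -> `|y - x0| <= r -> joined (Y x) (Y y).
Proof.
move=> xr yr; have [C _] := segment_C1 xr yr.
exists (fun t => Y (x + t *: (y - x))), (\int[mu]_(t in `[0, 1]) speed (fun t => Y (x + t *: (y - x))) t + 0).
split; last 2 first.
- by rewrite scale0r addr0.
- by rewrite scale1r addrC subrK.
apply: (pw_cons ltr01) (pw_nil _ _).
by exists (fun t => Y (x + t *: (y - x))), 2^-1; split.
Qed.

Lemma elliptic_ge0 z v : `|z - x0| <= 2 * r -> 0 <= bilin (g z) v v.
Proof.
move=> zr; have := le_trans (sqr_ge0 `|v|) (rm_elliptic GP v zr).
by rewrite pmulr_rge0// (lt_le_trans ltr01).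
Qed.

Let r2 : r <= 2 * r. Proof. by move: r0 => h; lra. Qed.

(** The distance is at most the length of the coordinate segment.  Let [A] be
    the length of [e] at the midpoint.  The square root lies below its tangent
    at [A ^+ 2], and the squared length of [e] at the point of parameter [t] is
    [A ^+ 2 + (t - 1 / 2) * q] up to [O(|e| ^ 4)]; the linear term has mean
    value zero. *)
Lemma dist_chart_upper x y : `|x - x0| <= r -> `|y - x0| <= r ->
  dist (Y x) (Y y) ^+ 2 <=
  bilin (g (midpoint x y)) (y - x) (y - x) + 2 * K ^+ 3 * `|y - x| ^+ 4.
Proof.
move=> xr yr; have [C S] := segment_C1 xr yr.
set m := midpoint x y; set e := y - x.
have mr : `|m - x0| <= 2 * r by apply: le_trans r2; exact: midpoint_ball.
have d0 := dist_ge0 (Y x) (Y y).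
have L : dist (Y x) (Y y) <= \int[mu]_(t in `[0, 1]) speed (fun t => Y (x + t *: e)) t.
  have := @dist_le_length _ _ _ (fun t => Y (x + t *: e)) 0 1
     (\int[mu]_(t in `[0, 1]) speed (fun t => Y (x + t *: e)) t + 0) ltr01.
  rewrite scale0r addr0 scale1r /e addrCA subrr !addr0; apply.
  rewrite -[X in piecewise_C1_arc _ _ _ X]addr0.
  apply: (pw_cons ltr01) (pw_nil _ _).
  by exists (fun t => Y (x + t *: e)), 2^-1; split.
have [e0|en0] := eqVneq e 0.
  suff d00 : dist (Y x) (Y y) <= 0.
    have -> : dist (Y x) (Y y) = 0 by apply/eqP; rewrite eq_le d00.
    by rewrite e0 bilin0l normr0 !expr0n mulr0 addr0.
  apply: (le_trans L); rewrite -[leRHS](@Rintegral_set0 _ _ R mu (fun=> 0)).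
  rewrite (@eq_Rintegral _ _ _ mu `[0, 1] (fun=> 0)); last first.
    move=> t; rewrite inE /= in_itv /= => /andP[t0 t1].
    have tI : t \in `]0 - 2^-1, 1 + 2^-1[ by rewrite in_itv /=; apply/andP; split; lra.
    by rewrite (S t tI) -/e e0 bilin0l sqrtr0.
  by rewrite Rintegral_set0 Rintegral_cst// mul0r.
have b_gt : `|e| ^+ 2 <= K * bilin (g m) e e by exact: (rm_elliptic GP e mr).
have e_gt0 : 0 < `|e| by rewrite normr_gt0.
have b0 : 0 < bilin (g m) e e.
  have : 0 < K * bilin (g m) e e by apply: lt_le_trans b_gt; rewrite exprn_gt0.
  by rewrite pmulr_rgt0// (lt_le_trans ltr01).
pose A := Num.sqrt (bilin (g m) e e).
have A0 : 0 < A by rewrite sqrtr_gt0.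
have A2 : A ^+ 2 = bilin (g m) e e by rewrite sqr_sqrtr// ltW.
pose q := \sum_j e 0 j * bilin (DG j m) e e.
pose kappa := K * `|e| ^+ 4.
have kappa0 : 0 <= kappa by rewrite mulr_ge0 ?exprn_ge0.
(* [h] bounds the speed; its primitive [H] is written so that the part coming
   from the linear term visibly vanishes at [0] and [1] *)
pose h t := A + kappa / (2 * A) + (t - 2^-1) * (q / (2 * A)).
pose H t := (A + kappa / (2 * A)) * t + (t * t - t) * (q / (4 * A)).
have speed_h t : t \in `[0, 1] -> speed (fun t => Y (x + t *: e)) t <= h t.
  rewrite in_itv /= => /andP[t0 t1].
  have tI : t \in `]0 - 2^-1, 1 + 2^-1[ by rewrite in_itv /=; apply/andP; split; lra.
  rewrite S//; set z := x + t *: e; set B := bilin (g z) e e.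
  have zr : `|z - x0| <= 2 * r by exact: segment_ball.
  have B0 : 0 <= B by exact: elliptic_ge0.
  have zm : z - m = (t - 2^-1) *: e.
    by apply/rowP => j; rewrite /z /m /e /midpoint !mxE; field.
  have BT : B <= A ^+ 2 + (t - 2^-1) * q + kappa.
    have := rm_taylor GP e e mr zr; rewrite zm -/B -A2.
    have -> : \sum_j ((t - 2^-1) *: e) 0 j * bilin (DG j m) e e = (t - 2^-1) * q.
      by rewrite /q mulr_sumr; apply: eq_bigr => j _; rewrite mxE mulrA.
    move=> /(le_trans (ler_norm _)) T.
    suff : K * `|(t - 2^-1) *: e| ^+ 2 * `|e| * `|e| <= kappa by lra.
    have -> : kappa = K * (1 * `|e|) ^+ 2 * `|e| * `|e| by rewrite /kappa; ring.
    do 2 (apply: ler_wpM2r => //); apply: ler_wpM2l => //; apply: sqr_le => //.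
    by rewrite normrZ ler_wpM2r// ler_norml; apply/andP; split; lra.
  have : Num.sqrt B <= (B / A + A) / 2.
    have sB := sqr_sqrtr B0; have := sqr_ge0 (Num.sqrt B - A).
    have -> : (B / A + A) / 2 = (B + A ^+ 2) / (2 * A) by field; rewrite gt_eqF.
    rewrite ler_pdivlMr ?mulr_gt0// sqrrB sB; lra.
  move=> /le_trans; apply; rewrite /h.
  have -> : (B / A + A) / 2 = B / (2 * A) + A / 2 by field; rewrite gt_eqF.
  have -> : A + kappa / (2 * A) + (t - 2^-1) * (q / (2 * A)) =
    (A ^+ 2 + (t - 2^-1) * q + kappa) / (2 * A) + A / 2 by field; rewrite gt_eqF.
  by rewrite lerD2r ler_wpM2r// invr_ge0 mulr_ge0// ltW.
have dH (t : R) : is_derive t 1 H (h t).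
  have -> : H = (fun s => 0 + (A + kappa / (2 * A)) * s) +
      ((fun s => 0 + 1 * s) * (fun s => 0 + 1 * s) + (fun s => 0 + (-1) * s)) * cst (q / (4 * A)).
    apply/funext => s; rewrite /H.
    rewrite -[RHS]/((0 + (A + kappa / (2 * A)) * s) +
      ((0 + 1 * s) * (0 + 1 * s) + (0 + (-1) * s)) * (q / (4 * A))).
    by ring.
  have D1 := is_derive_affine_real 0 1 t; have Dm := is_derive_affine_real 0 (-1) t.
  have D := is_deriveD (is_derive_affine_real 0 (A + kappa / (2 * A)) t)
    (is_deriveM (is_deriveD (is_deriveM D1 D1) Dm) (is_derive_cst (q / (4 * A)) t 1)).
  apply: (is_derive_eq D); rewrite /h /GRing.scale /=.
  by field; rewrite gt_eqF.
have ch (t : R) : {for t, continuous h}.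
  apply: cvgD; first exact: cvg_cst.
  by apply: cvgM; [apply: cvgB; [exact: cvg_id|exact: cvg_cst]|exact: cvg_cst].
have [Ih Eh] := Rintegral_derive ltr01 (fun t _ => dH t) (fun t _ => ch t).
have h20 : 0 < 2^-1 :> R by [].
have [_ Is] := C1_curve_speed_integrable C h20.
have L2 : dist (Y x) (Y y) <= A + kappa / (2 * A).
  apply: (le_trans L).
  have -> : A + kappa / (2 * A) = \int[mu]_(t in `[0, 1]) h t.
    by rewrite Eh /H; ring.
  by apply: le_Rintegral => //; exact: Is.
apply: le_trans (sqr_le d0 L2) _; rewrite -A2.
have -> : (A + kappa / (2 * A)) ^+ 2 = A ^+ 2 + kappa + kappa ^+ 2 / (4 * A ^+ 2).
  by field; rewrite gt_eqF.
rewrite -addrA lerD2l.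
have K13 : K <= K ^+ 3 by rewrite -[leLHS]expr1 ler_weXn2l.
have k1 : kappa <= K ^+ 3 * `|e| ^+ 4 by rewrite ler_wpM2r ?exprn_ge0.
have e2 : `|e| <= 2.
  have -> : e = (y - x0) - (x - x0) by rewrite /e opprB addrA subrK.
  by apply: le_trans (ler_normB _ _) _; move: r1 => h1; lra.
have : kappa ^+ 2 / (4 * A ^+ 2) <= K ^+ 3 * `|e| ^+ 4.
  rewrite ler_pdivrMr ?mulr_gt0 ?exprn_gt0// A2.
  have -> : K ^+ 3 * `|e| ^+ 4 * (4 * bilin (g m) e e) =
    K ^+ 2 * `|e| ^+ 4 * (4 * (K * bilin (g m) e e)) by ring.
  have -> : kappa ^+ 2 = K ^+ 2 * `|e| ^+ 4 * (`|e| ^+ 2 * `|e| ^+ 2).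
    by rewrite /kappa; ring.
  apply: ler_wpM2l; first by rewrite mulr_ge0 ?exprn_ge0.
  apply: ler_pM => //; rewrite ?exprn_ge0//.
  have -> : 4 = 2 ^+ 2 :> R by ring.
  exact: sqr_le.
by lra.
Qed.

Lemma C1_arc_sub c a b t l : a < t -> t <= b -> C1_arc c a b l ->
  exists2 l', C1_arc c a t l' & l' <= l.
Proof.
move=> at_ tb [c' [e [e0 H cc' ->]]].
have [_ I] := C1_curve_speed_integrable H e0.
exists (\int[mu]_(s in `[a, t]) speed c' s).
  exists c', e; split => //.
    move=> s; rewrite /= in_itv /= => /andP[s1 s2]; apply: H; rewrite /= in_itv /=.
    by apply/andP; split; lra.
  move=> s; rewrite in_itv /= => /andP[s1 s2]; apply: cc'; rewrite in_itv /= s1.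
  exact: le_trans tb.
rewrite -subr_ge0 (@Rintegral_itvB _ (speed c') (BLeft a) (BRight b) t)//.
- by apply: Rintegral_ge0 => s _; exact: speed_ge0.
- by rewrite bnd_simp ltW.
Qed.

(** A function whose differential has norm at most [A] increases by at most [A]
    times the length.  It is applied to coordinates in order to confine a curve
    to a ball, and to the calibration in order to bound its length. *)
Lemma C1_arc_variation c a b l Phi dPhi A : a < b -> C1_arc c a b l ->
  differential_of Phi dPhi ->
  (forall t, t \in `[a, b] -> cdom (atlas i) (c t) /\
     forall v, dPhi (X (c t)) v <= A * Num.sqrt (bilin (g (X (c t))) v v)) ->
  Phi (X (c b)) - Phi (X (c a)) <= A * l.
Proof.
move=> ab [c' [e [e0 H cc' ->]]] [d1 d2] Q.
have [_ I] := C1_curve_speed_integrable H e0.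
have C t : t \in `[a, b] -> C1_at c' t.
  by move=> tab; exact: nbhs_singleton (C1_curve_on_near H e0 tab).
pose gam := X \o c'; pose f t := dPhi (gam t) (derive1 gam t).
have aab : a \in `[a, b] by rewrite in_itv /= lexx ltW.
have bab : b \in `[a, b] by rewrite in_itv /= lexx ltW.
have Dg t : t \in `[a, b] -> derivable gam t 1 /\ {for t, continuous (derive1 gam)}.
  move=> tab; have [_ D] := C t tab; apply: D; rewrite -cc'//; exact: (Q t tab).1.
have df t : t \in `[a, b] -> is_derive t 1 (Phi \o gam) (f t).
  by move=> /Dg[D _]; apply: d1; rewrite derive1E; exact: derivableP.
have cf t : t \in `[a, b] -> {for t, continuous f}.
  move=> /Dg[D1 D2]; apply: d2; last exact: D2.
  exact: (differentiable_continuous ((derivable1_diffP gam t).1 D1)).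
have [If Ef] := Rintegral_derive ab df cf.
have -> : Phi (X (c b)) - Phi (X (c a)) = \int[mu]_(t in `[a, b]) f t.
  by rewrite Ef /gam /= !cc'.
rewrite -RintegralZl//; apply: le_Rintegral => //.
  have := @integrableZl _ _ _ mu `[a, b] _ A (EFin \o speed c') I.
  by apply.
move=> t; rewrite /= => tab; have [it Qt] := Q t tab; rewrite cc'// in it Qt.
by rewrite (speed_chart (C t tab) it); exact: Qt.
Qed.

Lemma coord_le_norm z v j : `|z - x0| <= 2 * r ->
  `|v 0 j| <= K * Num.sqrt (bilin (g z) v v).
Proof.
move=> zr; have E := rm_elliptic GP v zr.
apply: le_trans (le_coord_norm v j) _.
have b0 : 0 <= bilin (g z) v v by exact: elliptic_ge0.
apply: ler_of_sqr; first by rewrite mulr_ge0.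
rewrite exprMn sqr_sqrtr//; apply: (le_trans E); apply: ler_wpM2r => //.
by rewrite expr2 ler_peMr.
Qed.

(** A curve issued from the chart cannot leave a coordinate ball before its
    length exceeds a multiple of the radius: the Hausdorff property forbids
    it to jump out of the compact image of a closed ball. *)
Lemma C1_arc_stays c a b l x1 (d e : R) : a < b -> C1_arc c a b l ->
  cdom (atlas i) (c a) -> `|X (c a) - x1| <= d -> d + K * l < e ->
  `|x1 - x0| + e <= 2 * r ->
  forall t, t \in `[a, b] -> cdom (atlas i) (c t) /\ `|X (c t) - x1| <= d + K * l.
Proof.
move=> ab arc ia da de er.
have l0 := C1_arc_ge0 arc.
have d0 : 0 <= d by exact: le_trans da.
pose inside (k : R) s := cdom (atlas i) (c s) /\ `|X (c s) - x1| <= k.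
have ballr z : `|z - x1| <= e -> `|z - x0| <= 2 * r.
  move=> h; have := ler_normD (z - x1) (x1 - x0); rewrite addrA subrK; lra.
(* while it stays in the large ball, the curve is in fact in the small one *)
have key t : a <= t -> t <= b -> (forall s, a <= s -> s <= t -> inside e s) ->
    inside (d + K * l) t.
  rewrite le_eqVlt => /orP[/eqP <- _ H|at_ tb H].
    split => //; apply: (le_trans da); rewrite lerDl mulr_ge0//.
  have [l' arc' ll'] := C1_arc_sub at_ tb arc.
  split; first exact: (H t (ltW at_) (lexx _)).1.
  have V (s : bool) j : (-1) ^+ s * (X (c t) 0 j - X (c a) 0 j) <= K * l'.
    pose al k : R := if k == j then (-1) ^+ s else 0.
    have alE v : linform al v = (-1) ^+ s * v 0 j.
      rewrite /linform (bigD1 j)//= big1; last first.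
        by move=> k kj; rewrite /al (negPf kj) mulr0.
      by rewrite addr0 /al eqxx mulrC.
    have := @C1_arc_variation c a t l' _ _ K at_ arc' (differential_of_linform al).
    rewrite !alE -mulrBr; apply => u; rewrite in_itv /= => /andP[au ut].
    have [iu hu] := H u au ut; split => // v; rewrite alE.
    apply: le_trans (coord_le_norm v j (ballr _ hu)); apply: le_trans (ler_norm _) _.
    by rewrite normrM normrX normrN1 expr1n mul1r.
  have tri : `|X (c t) - X (c a)| <= K * l'.
    apply: row_norm_le => [|j]; first by rewrite mulr_ge0// (C1_arc_ge0 arc').
    have := V false j; have := V true j; rewrite expr0 expr1 mul1r mulN1r !mxE ler_norml.
    by move=> h1 h2; apply/andP; split; lra.
  have := ler_normD (X (c t) - X (c a)) (X (c a) - x1); rewrite addrA subrK.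
  have : K * l' <= K * l by rewrite ler_wpM2l.
  lra.
case: (arc) => c' [e' [e'0 H cc' _]].
have cont t : t \in `[a, b] -> {for t, continuous c'}.
  by move=> tab; have [] := nbhs_singleton (C1_curve_on_near H e'0 tab).
have Kl0 : 0 <= K * l by rewrite mulr_ge0.
pose k1 := (d + K * l + e) / 2; have k10 : 0 < k1 by rewrite /k1; lra.
have k1e : k1 < e by rewrite /k1; lra.
have ball_k1 z : closed_ball x1 k1 z <-> `|z - x1| <= k1.
  by rewrite closed_ballE// /closed_ball_ /= distrC.
pose B := Y @` closed_ball x1 k1.
have Bin q : B q -> cdom (atlas i) q /\ `|X q - x1| <= e.
  move=> [z /ball_k1 zl <-]; have ze : `|z - x1| <= e by lra.
  have Uz : U z by exact/UB/ballr.
  by rewrite XY//; split => //; exact: domY.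
have inB s : inside (d + K * l) s -> B (c s).
  move=> [is_ hs]; exists (X (c s)); last exact: cmapK.
  by apply/ball_k1; rewrite /k1; lra.
have cB : closed B.
  apply: compact_closed; first exact: manifold_hausdorff.
  apply: continuous_compact.
    apply: continuous_in_subspaceT => z; rewrite inE => /ball_k1 zl.
    by apply: cinv_continuous; apply: UB; apply: ballr; lra.
  apply: bounded_closed_compact; last exact: closed_ball_closed.
  exists (`|x1| + k1); split; first exact: num_real.
  move=> k hk z /ball_k1 hz; apply: ltW; apply: le_lt_trans hk.
  by rewrite -(subrK x1 z) addrC; apply: le_trans (ler_normD _ _) _; rewrite lerD2l.
pose E := [set t | [/\ a <= t, t <= b & forall s, a <= s -> s <= t -> inside (d + K * l) s]].
have Ea : E a.
  split => //; first exact: ltW.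
  move=> s as_ sa; have -> : s = a by apply/eqP; rewrite eq_le sa.
  by split => //; apply: (le_trans da); rewrite lerDl mulr_ge0.
have supE : has_sup E by split; [exists a|exists b => t []].
set tau := sup E.
have atau : a <= tau by apply: sup_upper_bound.
have taub : tau <= b by apply: sup_le_ub; [exists a|move=> t []].
have below s : a <= s -> s < tau -> inside (d + K * l) s.
  move=> as_ st; have e0 : 0 < tau - s by rewrite subr_gt0.
  have [t [_ _ Ht]] := sup_adherent e0 supE; rewrite opprB addrC subrK => /ltW st'.
  exact: Ht.
have tauab : tau \in `[a, b] by rewrite in_itv /= atau.
(* [B] is closed and contains the curve before [tau], hence also at [tau] *)
have intau : inside (d + K * l) tau.
  move: atau; rewrite le_eqVlt => /orP[/eqP <-|atau].
    by case: Ea => _ _; apply.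
  suff Bt : B (c tau).
    apply: key => // [|s as_]; first exact: ltW.
    rewrite le_eqVlt => /orP[/eqP ->|st]; first exact: Bin.
    by have [h1 h2] := below s as_ st; split => //; lra.
  rewrite cc'//; apply: contrapT => nB.
  have N : nbhs (c' tau) (~` B).
    by apply: open_nbhs_nbhs; split; [rewrite openC|exact: nB].
  have : \forall s \near tau, ~ B (c' s) by move: N; exact: (cont _ tauab).
  move=> /nbhs_ballP[k /= k0 Hk].
  pose s := Num.max a (tau - k / 2).
  have sa : a <= s by rewrite le_max lexx.
  have st : s < tau by rewrite gt_max atau; lra.
  have sk : tau - k / 2 <= s by rewrite le_max lexx orbT.
  apply: (Hk s); first by rewrite /ball /= ger0_norm; lra.
  rewrite -cc'; first exact: inB (below s sa st).
  by rewrite in_itv /= sa (le_trans (ltW st)).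
have taubE : tau = b.
  apply/eqP; rewrite eq_le taub leNgt; apply/negP => taub'.
  have N1 : \forall s \near tau, cdom (atlas i) (c' s).
    by apply: near_chart; [exact: cont|rewrite -cc'//; case: intau].
  have N2 : \forall s \near tau, `|X (c' s) - x1| < e.
    have C : {for tau, continuous (fun s => `|X (c' s) - x1|)}.
      apply: (@continuous_comp _ _ _ (fun s => X (c' s) - x1) (fun v => `|v|)).
        apply: cvgB; last exact: cvg_cst.
        apply: (@continuous_comp _ _ _ c' X); first exact: cont.
        by apply: cmap_continuous; rewrite -cc'//; case: intau.
      exact: norm_continuous.
    have h : `|X (c' tau) - x1| < e by rewrite -cc'//; apply: le_lt_trans de; case: intau.
    have := @open_lt R e; rewrite openE => /(_ _ h).
    exact: C.
  have [k /= k0 Hk] := (nbhs_ballP _ _).1 (filterI N1 N2).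
  pose t := Num.min b (tau + k / 2).
  have tt : tau < t by rewrite lt_min taub' /=; lra.
  have tb : t <= b by rewrite ge_min lexx.
  have tk : t <= tau + k / 2 by rewrite ge_min lexx orbT.
  have weak s : a <= s -> s <= t -> inside e s.
    move=> as_ st; have [stau|taus] := ltP s tau.
      by have [h1 h2] := below s as_ stau; split => //; lra.
    have [|h1 h2] := Hk s; first by rewrite /ball /= distrC ger0_norm; lra.
    have sab : s \in `[a, b] by rewrite in_itv /= as_ (le_trans st).
    by rewrite /inside cc'//; split => //; exact: ltW.
  have Et : E t.
    split => //; first by rewrite (le_trans atau)// ltW.
    move=> s as_ st; apply: key => //; first exact: le_trans tb.
    by move=> s' as' ss'; apply: weak => //; exact: le_trans st.
  by have := sup_upper_bound supE Et; rewrite -/tau leNgt tt.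
move=> t; rewrite in_itv /= => /andP[at_ tb].
move: tb; rewrite -taubE le_eqVlt => /orP[/eqP ->|]; [exact: intau|exact: below].
Qed.

Lemma piecewise_C1_arc_stays c a b l x1 (d e : R) : piecewise_C1_arc c a b l ->
  cdom (atlas i) (c a) -> `|X (c a) - x1| <= d -> d + K * l < e ->
  `|x1 - x0| + e <= 2 * r ->
  forall t, t \in `[a, b] -> cdom (atlas i) (c t) /\ `|X (c t) - x1| <= d + K * l.
Proof.
move=> pw; elim: pw d => [{}a d ia da _ _ t|{}a m {}b l1 l2 am arc pw IH d ia da de er t].
  rewrite in_itv /= -eq_le => /eqP <-.
  by rewrite mulr0 addr0.
have l10 := C1_arc_ge0 arc; have l20 := piecewise_C1_arc_ge0 pw.
have mb := piecewise_C1_arc_le pw.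
have Kl1 : 0 <= K * l1 by rewrite mulr_ge0.
have Kl2 : 0 <= K * l2 by rewrite mulr_ge0.
rewrite mulrDr in de *.
have S := C1_arc_stays am arc ia da _ er.
have de1 : d + K * l1 < e by lra.
have mm : m \in `[a, m] by rewrite in_itv /= lexx ltW.
have [im dm] := S de1 m mm.
rewrite in_itv /= => /andP[at_ tb]; have [tm|mt] := leP t m.
  have [|it dt] := S de1 t; first by rewrite in_itv /= at_.
  by split => //; lra.
have [||it dt] := IH (d + K * l1) im dm _ er t.
- by lra.
- by rewrite in_itv /= tb ltW.
- by split => //; lra.
Qed.

Lemma piecewise_C1_arc_variation c a b l Phi dPhi A : piecewise_C1_arc c a b l ->
  differential_of Phi dPhi ->
  (forall t, t \in `[a, b] -> cdom (atlas i) (c t) /\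
     forall v, dPhi (X (c t)) v <= A * Num.sqrt (bilin (g (X (c t))) v v)) ->
  Phi (X (c b)) - Phi (X (c a)) <= A * l.
Proof.
move=> pw dP; elim: pw => [{}a _|{}a m {}b l1 l2 am arc pw IH Q].
  by rewrite subrr mulr0.
have mb := piecewise_C1_arc_le pw.
have V1 : Phi (X (c m)) - Phi (X (c a)) <= A * l1.
  apply: (C1_arc_variation am arc dP) => t; rewrite in_itv /= => /andP[t1 t2].
  by apply: Q; rewrite in_itv /= t1 (le_trans t2).
have V2 : Phi (X (c b)) - Phi (X (c m)) <= A * l2.
  apply: IH => t; rewrite in_itv /= => /andP[t1 t2].
  by apply: Q; rewrite in_itv /= t2 (le_trans (ltW am)).
by rewrite mulrDr; lra.
Qed.

(** Curves that almost realize the distance are short enough to remain in the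
    chart. *)
Lemma dist_chart_near x q : `|x - x0| <= r -> joined (Y x) q ->
  K * dist (Y x) q < r ->
  cdom (atlas i) q /\ `|X q - x| <= K * dist (Y x) q.
Proof.
move=> xr J Dr; set D := dist (Y x) q in Dr *.
have k0 : 0 < K by apply: lt_le_trans K1.
have stay (e : R) : 0 < e -> K * e <= r - K * D ->
    cdom (atlas i) q /\ `|X q - x| <= K * D + K * e.
  move=> e0 er; have [c [l [pw c0 c1 lD]]] := dist_approx J e0.
  have Kl : K * l < K * (D + e) by rewrite ltr_pM2l.
  have Ux : U x by apply: UB; move: r0 => h; lra.
  have := @piecewise_C1_arc_stays c 0 1 l x 0 r pw.
  rewrite c0 XY// subrr normr0 add0r => S; rewrite mulrDr in Kl.
  have Klr : K * l < r by lra.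
  have xrr : `|x - x0| + r <= 2 * r by lra.
  have t1 : 1 \in `[0, 1 : R] by rewrite in_itv /= lexx ler01.
  have [it dt] := S (domY Ux) (lexx 0) Klr xrr 1 t1.
  by rewrite -c1; split => //; lra.
have e0 : 0 < (r - K * D) / K by rewrite divr_gt0// subr_gt0.
split.
  by have [] := stay _ e0; rewrite ?[K * _]mulrC ?divfK ?gt_eqF.
apply/ler_addgt0Pr => e e_gt0.
pose e' := Num.min ((r - K * D) / K) (e / K).
have e'0 : 0 < e' by rewrite lt_min e0 divr_gt0.
have [|_] := stay e' e'0.
  have : e' <= (r - K * D) / K by rewrite ge_min lexx.
  by rewrite ler_pdivlMr// mulrC.
have : e' <= e / K by rewrite ge_min lexx orbT.
by rewrite ler_pdivlMr// mulrC; lra.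
Qed.

Local Notation L := (@cal_const R n K).

Let L1 : 1 <= L.
Proof. by rewrite /cal_const -[leLHS]mul1r; apply: ler_pM => //; rewrite lerDr. Qed.
Let KL : K <= L.
Proof. by rewrite /cal_const -[leLHS]mul1r ler_wpM2r ?lerDr. Qed.

Let C : R := 64 * L ^+ 14 * K ^+ 2.

(** The calibration centred at the midpoint increases by [beta = s ^+ 2] from
    [x] to [y], and its slope along the curve is at most
    [s * (1 + C * l ^+ 2)] times the speed; hence [s] is at most
    [l * (1 + C * l ^+ 2)]. *)
Lemma dist_chart_lower_length x y c l : `|x - x0| <= r -> `|y - x0| <= r ->
  piecewise_C1_arc c 0 1 l -> c 0 = Y x -> c 1 = Y y -> 32 * L ^+ 10 * l < r ->
  bilin (g (midpoint x y)) (y - x) (y - x) <= (l * (1 + C * l ^+ 2)) ^+ 2.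
Proof.
move=> xr yr pw c0 c1 lr; set m := midpoint x y; set e := y - x.
have l0 := piecewise_C1_arc_ge0 pw.
have l1 := L1; have kl := KL; have k0 := K0; have L0 : 0 <= L by lra.
have rp := r0; have r1' := r1.
have C0 : 0 <= C by rewrite !mulr_ge0 ?exprn_ge0.
have mr : `|m - x0| <= 2 * r.
  by apply: (@le_trans _ _ r); [exact: midpoint_ball|lra].
have [->|en0] := eqVneq e 0; first by rewrite bilin0l sqr_ge0.
have Kl : 32 * L ^+ 9 * (K * l) < r.
  apply: le_lt_trans lr; have -> : 32 * L ^+ 10 * l = 32 * L ^+ 9 * (L * l) by ring.
  by apply: ler_wpM2l; [rewrite mulr_ge0 ?exprn_ge0|exact: ler_wpM2r].
have Klr : K * l < r.
  apply: le_lt_trans Kl; apply: ler_peMl; first exact: mulr_ge0.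
  have : 1 <= L ^+ 9 by exact: exprn_ege1.
  lra.
have Kl0 : 0 <= K * l by exact: mulr_ge0.
have Ux : U x by apply: UB; lra.
have Uy : U y by apply: UB; lra.
have S t : t \in `[0, 1] -> cdom (atlas i) (c t) /\ `|X (c t) - x| <= K * l.
  move=> t01.
  have := @piecewise_C1_arc_stays c 0 1 l x 0 r pw.
  rewrite c0 XY// subrr normr0 add0r; apply => //; first exact: domY.
  by lra.
have el : `|e| <= K * l.
  by have [] := S 1; rewrite ?in_itv /= ?ler01 ?lexx// c1 XY.
have yE : y = m + 2^-1 *: e.
  by apply/rowP => j; rewrite /m /e /midpoint !mxE; field.
have xE : x = m - 2^-1 *: e.
  by apply/rowP => j; rewrite /m /e /midpoint !mxE; field.
set beta := bilin (g m) e e.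
have b0 : 0 < beta by exact: (beta_gt0 GP mr en0).
pose s := Num.sqrt beta.
have s0 : 0 < s by rewrite sqrtr_gt0.
have ss : s ^+ 2 = beta by rewrite sqr_sqrtr// ltW.
pose A := s * (1 + C * l ^+ 2).
have A0 : 0 <= A.
  by apply: mulr_ge0; [exact: ltW|rewrite addr_ge0// mulr_ge0 ?sqr_ge0].
have V : calibration (metric i) DG m e (X (c 1)) - calibration (metric i) DG m e (X (c 0))
    <= A * l.
  apply: (piecewise_C1_arc_variation (dPhi := calibration_slope (metric i) DG m e) pw).
    split; first by move=> ? ? ?; exact: (is_derive_calibration GP mr en0).
    by move=> ? ? ?; exact: continuous_calibration_slope.
  move=> t t01; have [it ht] := S t t01; split => // v.
  set z := X (c t) in ht *.
  have zr : `|z - x0| <= 2 * r.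
    by have := ler_normD (z - x) (x - x0); rewrite addrA subrK; lra.
  have zm : `|z - m| <= 2 * (K * l).
    have -> : z - m = (z - x) - 2^-1 *: e by apply/rowP => j; rewrite /m /e /midpoint !mxE; field.
    apply: le_trans (ler_normB _ _) _; rewrite normrZ (ger0_norm (_ : 0 <= 2^-1))//.
    by lra.
  have small : 16 * L ^+ 9 * `|z - m| <= 1.
    have : 16 * L ^+ 9 * `|z - m| <= 16 * L ^+ 9 * (2 * (K * l)).
      by apply: ler_wpM2l => //; rewrite mulr_ge0 ?exprn_ge0.
    lra.
  have := calibration_slope_le GP mr en0 v zr small.
  set B := bilin (g z) v v; have B0 : 0 <= B by exact: elliptic_ge0.
  move=> H; apply: ler_of_sqr; first by rewrite mulr_ge0.
  apply: (le_trans H); rewrite (exprMn _ A) sqr_sqrtr// /A (exprMn _ s) ss -/beta -[leRHS]mulrA.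
  apply: ler_wpM2l; first exact: ltW.
  rewrite mulrC; apply: ler_wpM2r => //; apply: sqr_le.
    by rewrite addr_ge0// !mulr_ge0 ?exprn_ge0 ?sqr_ge0.
  rewrite lerD2l /C.
  have -> : 64 * L ^+ 14 * K ^+ 2 * l ^+ 2 = 16 * L ^+ 14 * (2 * (K * l)) ^+ 2 by ring.
  by apply: ler_wpM2l; [rewrite mulr_ge0 ?exprn_ge0|exact: sqr_le].
move: V; rewrite c1 c0 !XY// yE xE (calibration_increment GP mr en0) -/beta => V.
rewrite -ss; apply: sqr_le; first exact: ltW.
have : s * s <= s * (l * (1 + C * l ^+ 2)).
  by rewrite -expr2 ss; apply: (le_trans V); rewrite /A -mulrA [l * _]mulrC.
by rewrite ler_pM2l.
Qed.

(** The bound of [dist_chart_lower_length] along curves whose length tends to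
    the distance; [e] is the admissible excess of length. *)
Lemma dist_chart_lower x y : `|x - x0| <= r -> `|y - x0| <= r ->
  64 * L ^+ 10 * dist (Y x) (Y y) <= r / 2 ->
  bilin (g (midpoint x y)) (y - x) (y - x) <=
  dist (Y x) (Y y) ^+ 2 + (2 * C + C ^+ 2) * dist (Y x) (Y y) ^+ 4.
Proof.
move=> xr yr; have := joined_chart xr yr.
set D := dist _ _ => J Dr; set beta := bilin _ _ _.
have D0 : 0 <= D by exact: dist_ge0.
have l1 := L1; have k0 := K0; have rp := r0; have r1' := r1.
have L10 : 1 <= L ^+ 10 by exact: exprn_ege1.
pose C3 := 2 * C + C ^+ 2.
have C0 : 0 <= C.
  have L0 : 0 <= L by lra.
  by rewrite !mulr_ge0 ?exprn_ge0.
have C30 : 0 <= C3 by rewrite addr_ge0 ?mulr_ge0 ?sqr_ge0.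
have D1 : D <= 1 / 2.
  have : 64 * D <= 64 * L ^+ 10 * D by apply: ler_wpM2r => //; lra.
  by lra.
apply/ler_addgt0Pr => eta eta0.
pose e := Num.min (r / (128 * L ^+ 10)) (eta / (3 + 15 * C3)).
have d1 : 0 < 128 * L ^+ 10 by lra.
have d2 : 0 < 3 + 15 * C3 by lra.
have e0 : 0 < e by rewrite lt_min !divr_gt0.
have e1 : 128 * L ^+ 10 * e <= r.
  by rewrite mulrC -ler_pdivlMr// ge_min lexx.
have e2 : (3 + 15 * C3) * e <= eta.
  by rewrite mulrC -ler_pdivlMr// ge_min lexx orbT.
have e12 : e <= 1 / 2.
  have : 128 * e <= 128 * L ^+ 10 * e by apply: ler_wpM2r; lra.
  by lra.
have [c [l [pw c0 c1 lD]]] := dist_approx J e0.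
have l0 := piecewise_C1_arc_ge0 pw.
have lr : 32 * L ^+ 10 * l < r.
  have : 32 * L ^+ 10 * l < 32 * L ^+ 10 * (D + e) by rewrite ltr_pM2l//; lra.
  by rewrite mulrDr; lra.
have lD' : l <= D + e by exact: ltW.
have H := dist_chart_lower_length xr yr pw c0 c1 lr.
apply: (le_trans H).
have De1 : D + e <= 1 by lra.
have De0 : 0 <= D + e by rewrite addr_ge0// ltW.
have ll1 : l <= 1 by lra.
have s2 : l ^+ 2 <= D ^+ 2 + 3 * e.
  apply: le_trans (sqr_le l0 lD') _; have := sqr_ge0 e; nra.
have s4 : l ^+ 4 <= D ^+ 4 + 15 * e.
  have -> : l ^+ 4 = (l ^+ 2) ^+ 2 by ring.
  have q1 : l ^+ 2 <= (D + e) ^+ 2 by exact: sqr_le.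
  have q2 : (D + e) ^+ 2 <= D ^+ 2 + 3 * e by nra.
  apply: (@le_trans _ _ ((D ^+ 2 + 3 * e) ^+ 2)).
    by apply: sqr_le; [exact: sqr_ge0|exact: le_trans q2].
  have D21 : D ^+ 2 <= 1 by nra.
  have -> : (D ^+ 2 + 3 * e) ^+ 2 = D ^+ 4 + 6 * (D ^+ 2 * e) + 9 * (e * e) by ring.
  have : D ^+ 2 * e <= 1 * e by apply: ler_wpM2r => //; exact: ltW.
  have : e * e <= 1 * e by apply: ler_wpM2r; lra.
  by lra.
have l6 : l ^+ 6 <= l ^+ 4 by apply: ler_wiXn2l.
have -> : (l * (1 + C * l ^+ 2)) ^+ 2 = l ^+ 2 + 2 * C * l ^+ 4 + C ^+ 2 * l ^+ 6 by ring.
have : C ^+ 2 * l ^+ 6 <= C ^+ 2 * l ^+ 4 by rewrite ler_wpM2l ?sqr_ge0.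
have : C3 * l ^+ 4 <= C3 * (D ^+ 4 + 15 * e) by rewrite ler_wpM2l.
by rewrite -/C3 {1}/C3; lra.
Qed.

End ChartDistance.

(** * Geodesics do not branch *)

Section NonBranching.
Context {R : realType} {n : nat} {M : riemannian_manifold R n}.
Implicit Types (c d : R -> M) (p q : M) (x y z : 'rV[R]_n).

(** In a small ball around the image of [p0], the distance read in a chart meets
    the hypotheses of [minimizing_chains_close]; the last clauses serve to show
    that short geodesics stay in the chart. *)
Lemma normal_chart p0 : exists (i : atlas_index M) (r K rho : R)
    (DG : 'I_n -> 'rV[R]_n -> 'M[R]_n),
  [/\ cdom (atlas i) p0, 0 < r, 0 < rho,
   regular_metric (cmap (atlas i) p0) r K (metric i) DG &
   midpoint_distance (cmap (atlas i) p0) r K rho (metric i)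
     (fun x y => dist (cinv (atlas i) x : M) (cinv (atlas i) y)) /\
   (forall x y, `|x - cmap (atlas i) p0| <= r -> `|y - cmap (atlas i) p0| <= r ->
      joined (cinv (atlas i) x : M) (cinv (atlas i) y)) /\
   (forall x q, `|x - cmap (atlas i) p0| <= r -> joined (cinv (atlas i) x) q ->
      dist (cinv (atlas i) x) q <= rho ->
      cdom (atlas i) q /\ `|cmap (atlas i) q - x| <= K * dist (cinv (atlas i) x) q)].
Proof.
have [i ip0] := atlas_cover p0.
pose x0 := cmap (atlas i) p0; pose U := cmap (atlas i) @` cdom (atlas i).
have Ux0 : U x0 by exists p0.
have [||r' [K0 [r'0 UB GP]]] := @regular_metric_exists _ _ U (metric i) x0
  (@cimg_open _ _ _ (atlas i)) Ux0 (@metric_smooth _ _ M i 2%N).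
- by move=> z [p ip <-]; exact: metric_symmetric.
- by move=> v v0; exact: metric_pos.
pose r := Num.min (r' / 2) 1.
have r0 : 0 < r by rewrite lt_min divr_gt0//=.
have r1 : r <= 1 by rewrite ge_min lexx orbT.
have r2 : 2 * r <= r'.
  have : r <= r' / 2 by rewrite ge_min lexx.
  lra.
have UB2 z : `|z - x0| <= 2 * r -> U z by move=> h; apply: UB; exact: le_trans r2.
have GP2 := regular_metric_weaken r2 (lexx K0) GP.
have K1 := rm_K1 GP2.
pose L := @cal_const R n K0; pose C := 64 * L ^+ 14 * K0 ^+ 2.
have KL : K0 <= L by rewrite /L /cal_const -[leLHS]mul1r ler_wpM2r ?lerDr//; lra.
have L1 : 1 <= L by exact: le_trans KL.
have C0 : 0 <= C by rewrite !mulr_ge0 ?exprn_ge0//; lra.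
have L10 : 1 <= L ^+ 10 by exact: exprn_ege1.
have LL : L <= L ^+ 10 by rewrite -[leLHS]expr1 ler_weXn2l.
pose rho := r / (128 * L ^+ 10).
have d1 : 0 < 128 * L ^+ 10 by lra.
have rho0 : 0 < rho by rewrite divr_gt0.
have rho_le D : D <= rho -> 64 * L ^+ 10 * D <= r / 2.
  by rewrite ler_pdivlMr// mulrC; lra.
have rho_lt D : 0 <= D -> D <= rho -> K0 * D < r.
  move=> D0 /rho_le h; have : K0 * D <= L ^+ 10 * D by apply: ler_wpM2r => //; lra.
  lra.
pose K := K0 + 2 * K0 ^+ 3 + (2 * C + C ^+ 2).
have K30 : 0 <= K0 ^+ 3 by rewrite exprn_ge0//; lra.
have C20 : 0 <= C ^+ 2 by exact: sqr_ge0.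
have near x q : `|x - x0| <= r -> joined (cinv (atlas i) x) q ->
      dist (cinv (atlas i) x) q <= rho ->
      cdom (atlas i) q /\ `|cmap (atlas i) q - x| <= K0 * dist (cinv (atlas i) x) q.
  by move=> xr J D; apply: (dist_chart_near r0 UB2 GP2) => //; exact: rho_lt (dist_ge0 _ _) D.
have KK0 : K0 <= K by rewrite /K; lra.
have KM D : 0 <= D -> K0 * D <= K * D by move=> D0; exact: ler_wpM2r.
exists i, r, K, rho, (fun j z => 'D_(delta_mx 0 j) (metric i) z); split => //.
  apply: (regular_metric_weaken _ KK0 GP2); lra.
split; last split.
- split.
  + by move=> x y; exact: dist_ge0.
  + move=> x y xr yr; apply: le_trans (dist_chart_upper r0 r1 UB2 GP2 xr yr) _.
    by rewrite lerD2l; apply: ler_wpM2r; [exact: exprn_ge0|rewrite /K; lra].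
  + move=> x y xr yr /rho_le D.
    apply: le_trans (dist_chart_lower r0 r1 UB2 GP2 xr yr D) _.
    by rewrite lerD2l; apply: ler_wpM2r; [exact: exprn_ge0 (dist_ge0 _ _)|rewrite /K -/L -/C; lra].
  + move=> x y xr yr D; have J := joined_chart r0 UB2 xr yr.
    have [_] := near x _ xr J D; rewrite (_ : cmap (atlas i) (cinv (atlas i) y) = y).
      by move=> /le_trans; apply; exact: KM (dist_ge0 _ _).
    by have [|p ip <-] := UB2 y; [lra|rewrite cmapK].
- by move=> x y xr yr; exact: (joined_chart r0 UB2).
- move=> x q xr J D; have [iq h] := near x q xr J D; split => //.
  by apply: (le_trans h); exact: KM (dist_ge0 _ _).
Qed.

Lemma near_coordinates i p (e : R) : cdom (atlas i) p -> 0 < e ->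
  \forall q \near p, cdom (atlas i) q /\
    `|cmap (atlas i) q - cmap (atlas i) p| <= e.
Proof.
move=> ip e0; have N1 := nbhs_chart ip.
have N2 : \forall q \near p, `|cmap (atlas i) p - cmap (atlas i) q| <= e.
  by have /cvgrPdist_le/(_ e e0) := @cmap_continuous _ _ _ (atlas i) p ip.
by near=> q; split; [near: q|rewrite distrC; near: q].
Unshelve. all: by end_near. Qed.

Lemma near_joined p : \forall q \near p, joined p q /\ joined q p.
Proof.
have [i [r [K [rho [DG [ip r0 rho0 _ [_ [J _]]]]]]]] := normal_chart p.
have := near_coordinates ip r0; apply: filterS => q [iq qr].
have pr : `|cmap (atlas i) p - cmap (atlas i) p| <= r by rewrite subrr normr0 ltW.
by have := J _ _ pr qr; have := J _ _ qr pr; rewrite !cmapK.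
Qed.

(** Being joined by a piecewise smooth curve is an equivalence relation with
    open classes, so a connected manifold is a single class. *)
Lemma all_joined p q : joined p q.
Proof.
suff E : [set q' | joined p q'] = [set: M].
  by have : [set: M] q by []; rewrite -E.
apply: (@manifold_connected _ _ M).
- by exists p; exact: joined_refl.
- exists [set q' | joined p q']; last by rewrite setTI.
  rewrite openE => q1 /= J; rewrite /interior.
  by have := near_joined q1; apply: filterS => q2 [J2 _]; exact: joined_trans J2.
- exists [set q' | joined p q']; last by rewrite setTI.
  rewrite -openC openE => q1 /= J; rewrite /interior.
  have := near_joined q1; apply: filterS => q2 [_ J2] J'.
  by apply: J; exact: joined_trans J' J2.
Qed.

Lemma dist_triangle p q r : dist p r <= dist p q + dist q r.
Proof. by apply: joined_dist_triangle; exact: all_joined. Qed.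

Lemma dist_refl p : dist p p = 0.
Proof.
apply/eqP; rewrite eq_le dist_ge0 andbT.
have := dist_le_length ltr01 (pw_cons ltr01 (C1_arc_cst p 0 1) (pw_nil _ 1)).
by rewrite addr0.
Qed.

Lemma dist_eq0 p q : dist p q = 0 -> p = q.
Proof.
have [i [r [K [rho [DG [ip r0 rho0 GP [_ [_ J]]]]]]]] := normal_chart p => d0.
have pr : `|cmap (atlas i) p - cmap (atlas i) p| <= r by rewrite subrr normr0 ltW.
have := J _ q pr; rewrite cmapK// d0 mulr0 => /(_ (all_joined _ _) (ltW rho0))[iq].
by rewrite normr_le0 subr_eq0 => /eqP E; rewrite -(cmapK ip) -E cmapK.
Qed.

Lemma dist_chain (f : nat -> M) N : dist (f 0%N) (f N) <= \sum_(0 <= k < N) dist (f k) (f k.+1).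
Proof.
elim: N => [|N IH]; first by rewrite dist_refl big_geq.
rewrite big_nat_recr//=; apply: le_trans (dist_triangle _ (f N) _) _.
by rewrite lerD2r.
Qed.

(** No regularity of the curve is required: geodesics enter only through the
    distances that they realize. *)
Definition minimizing (v : R) c (a b : R) : Prop :=
  forall s t, a <= s -> s <= t -> t <= b -> dist (c s) (c t) = v * (t - s).

Definition nonbranching (rho : R) p : Prop := forall c d (v a m b : R),
  0 < v -> minimizing v c a b -> minimizing v d a b -> c a = p ->
  a < m -> m <= b -> (forall t, a <= t -> t <= m -> c t = d t) ->
  v * (b - a) <= rho -> c b = d b.

(** Subdivide [[a, b]] into [N] equal intervals.  The vertices form minimizing
    chains, which share their first two vertices as soon as the first interval
    is contained in [[a, m]], so [minimizing_chains_close] applies.  Its bound is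
    made smaller than any [eta] by the choice of [t] and then of [N]. *)
Lemma local_nonbranching p0 :
  exists2 rho0 : R, 0 < rho0 & \forall p \near p0, forall rho, rho <= rho0 -> nonbranching rho p.
Proof.
have [i [r [K [rho [DG [ip r0 rho0 GP [DP [_ J]]]]]]]] := normal_chart p0.
set x0 := cmap (atlas i) p0 in GP DP J.
have K1 := rm_K1 GP; have K0 : 0 < K by lra.
pose rho1 := Num.min (Num.min rho 1) (Num.min (r / (4 * K)) (r / 2)).
have rho10 : 0 < rho1 by rewrite !lt_min rho0 !divr_gt0 ?mulr_gt0//= ltr01.
exists rho1 => //.
have r4 : 0 < r / 4 by rewrite divr_gt0.
have := near_coordinates ip r4; apply: filterS => p [dp pr] e e1.
move=> c d v a m b v0 cmin dmin cap am mb cd ve.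
have ab : a < b by exact: lt_le_trans mb.
have ba0 : 0 < b - a by rewrite subr_gt0.
set l := v * (b - a) in ve; have l0 : 0 < l by exact: mulr_gt0.
have : l <= rho1 by exact: le_trans e1.
rewrite !le_min => /andP[/andP[l_rho l_1] /andP[l_r lr2]].
have Kl : K * l <= r / 4.
  move: l_r; rewrite ler_pdivlMr ?mulr_gt0//; lra.
have pr' : `|cmap (atlas i) p - x0| <= r by lra.
(* both curves stay in the half ball, where coordinates may be used *)
have stay f : minimizing v f a b -> f a = p -> forall t, a <= t -> t <= b ->
    cdom (atlas i) (f t) /\ `|cmap (atlas i) (f t) - x0| <= r / 2.
  move=> fmin fa t at_ tb.
  have Dt : dist p (f t) <= l.
    by rewrite -fa fmin// /l; apply: ler_wpM2l; [exact: ltW|lra].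
  have := J (cmap (atlas i) p) (f t) pr'; rewrite cmapK//.
  move=> /(_ (all_joined _ _) (le_trans Dt l_rho))[it ht]; split => //.
  have := ler_normD (cmap (atlas i) (f t) - cmap (atlas i) p) (cmap (atlas i) p - x0).
  rewrite addrA subrK; have : K * dist p (f t) <= K * l by rewrite ler_pM2l.
  lra.
have da : d a = p by rewrite -cd// ltW.
have cstay := stay c cmin cap; have dstay := stay d dmin da.
pose T N (k : nat) : R := a + k%:R * ((b - a) / N%:R).
pose pts (f : R -> M) N k := cmap (atlas i) (f (T N k)).
have Tin N k : (0 < N)%N -> (k <= N)%N -> a <= T N k /\ T N k <= b.
  move=> N0 kN; have N0' : 0 < N%:R :> R by rewrite ltr0n.
  have q0 : 0 <= (b - a) / N%:R by rewrite divr_ge0 ?ltW.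
  split; first by rewrite /T lerDl mulr_ge0.
  have : k%:R * ((b - a) / N%:R) <= N%:R * ((b - a) / N%:R) by rewrite ler_wpM2r// ler_nat.
  by rewrite [N%:R * _]mulrC divfK ?gt_eqF// /T; lra.
have chain f N : (0 < N)%N -> minimizing v f a b -> f a = p ->
    minimizing_chain x0 r (fun x y => dist (cinv (atlas i) x : M) (cinv (atlas i) y))
      (pts f N) N (l / N%:R).
  move=> N0 fmin fa; have N0' : 0 < N%:R :> R by rewrite ltr0n.
  have st k : (k <= N)%N -> cdom (atlas i) (f (T N k)) /\
      `|cmap (atlas i) (f (T N k)) - x0| <= r / 2.
    by move=> kN; have [h1 h2] := Tin N k N0 kN; exact: stay.
  split.
  - by move=> k /st[].
  - move=> k kN; have [s1 _] := st k (ltnW kN); have [s2 _] := st k.+1 kN.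
    have [t1 t2] := Tin N k N0 (ltnW kN); have [t3 t4] := Tin N k.+1 N0 kN.
    rewrite /pts !cmapK// fmin//; last first.
      by rewrite /T lerD2l ler_wpM2r ?ler_nat// divr_ge0 ?ltW.
    by rewrite /T /l -natr1; field; rewrite gt_eqF.
  - move=> c' _ c'0 c'N; rewrite [N%:R * _]mulrC divfK ?gt_eqF//.
    have T0 : T N 0%N = a by rewrite /T mul0r addr0.
    have TN : T N N = b by rewrite /T [N%:R * _]mulrC divfK ?gt_eqF// addrC subrK.
    have := dist_chain (fun k => cinv (atlas i) (c' k) : M) N.
    rewrite c'0 c'N /pts T0 TN !cmapK; last 2 first.
    + by have [] := stay f fmin fa b (ltW ab) (lexx _).
    + by have [] := stay f fmin fa a (lexx _) (ltW ab).
    by rewrite (fmin a b (lexx _) (ltW ab) (lexx _)).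
have [ibc _] := cstay b (ltW ab) (lexx _); have [ibd _] := dstay b (ltW ab) (lexx _).
suff E : cmap (atlas i) (c b) = cmap (atlas i) (d b) by rewrite -(cmapK ibc) E cmapK.
apply/eqP; rewrite -subr_eq0 -normr_le0; apply/ler_addgt0Pr => eta eta0; rewrite add0r.
pose Q := expR (35 * n%:R * K ^+ 6); have Q0 : 0 < Q by exact: expR_gt0.
pose t := Num.min 1 (eta / (2 * Q)).
have t0 : 0 < t by rewrite lt_min ltr01 divr_gt0// mulr_gt0.
have t1 : t <= 1 by rewrite ge_min lexx.
pose N := (Num.truncn (Num.max ((b - a) / (m - a)) (l / (t * (eta / (2 * Q)))))).+1.
have N0 : 0 < N%:R :> R by rewrite ltr0n.
have tq : 0 < t * (eta / (2 * Q)) by rewrite mulr_gt0// divr_gt0// mulr_gt0.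
have : Num.max ((b - a) / (m - a)) (l / (t * (eta / (2 * Q)))) < N%:R.
  exact: truncnS_gt.
rewrite gt_max => /andP[Nm Nt].
have N1 : (b - a) / N%:R <= m - a.
  by rewrite ler_pdivrMr// mulrC -ler_pdivrMr ?subr_gt0// ltW.
have hN : l / N%:R / t <= eta / (2 * Q).
  rewrite ler_pdivrMr// ler_pdivrMr//.
  have -> : eta / (2 * Q) * t * N%:R = N%:R * (t * (eta / (2 * Q))) by ring.
  by rewrite -ler_pdivrMr// ltW.
have l_ge0 := ltW l0.
have lN : l / N%:R <= l.
  by rewrite ler_pdivrMr// ler_peMr// ler1n.
have H := @minimizing_chains_close R n x0 r K rho (metric i) DG _ GP DP (pts c N) (pts d N)
  N (l / N%:R) t.
have TN : T N N = b by rewrite /T [N%:R * _]mulrC divfK ?gt_eqF// addrC subrK.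
have ptsb f : pts f N N = cmap (atlas i) (f b) by rewrite /pts TN.
have {}H : `|cmap (atlas i) (c b) - cmap (atlas i) (d b)| <= Q * (t + l / N%:R / t).
  rewrite -!ptsb; apply: H => //.
  - by rewrite divr_gt0.
  - by rewrite [N%:R * _]mulrC divfK ?gt_eqF.
  - exact: le_trans l_rho.
  - exact: le_trans lr2.
  - exact: chain.
  - exact: chain.
  - by rewrite /pts /T mul0r addr0 cap da.
  - rewrite /pts /T mul1r cd//; first by rewrite lerDl divr_ge0// ltW.
    by lra.
apply: (le_trans H).
have tQ : t <= eta / (2 * Q) by rewrite ge_min lexx orbT.
have : Q * (t + l / N%:R / t) <= Q * (eta / (2 * Q) + eta / (2 * Q)).
  by rewrite ler_pM2l// lerD.
move=> /le_trans; apply.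
by rewrite le_eqVlt; apply/orP; left; apply/eqP; field; rewrite gt_eqF.
Qed.

(** The local statement holds for all points near [p0] and all smaller radii, so
    finitely many neighbourhoods provide a common radius. *)
Lemma uniform_nonbranching : compact [set: M] ->
  exists2 rho : R, 0 < rho & forall p, nonbranching rho p.
Proof.
move=> /compact_near_coveringP/(_ R (0 : R)^'+ nonbranching _) H.
have : \forall rho \near (0 : R)^'+, [set: M] `<=` nonbranching rho.
  apply: H => p _; have [rho0 rho00 N] := local_nonbranching p.
  exists ([set q | forall rho, rho <= rho0 -> nonbranching rho q], [set rho : R | rho <= rho0]).
    by split => //=; exact: nbhs_right_le.
  by move=> [q rho] /= [h1 h2]; exact: h1.
move=> H2; have : \forall rho \near (0 : R)^'+, 0 < rho /\ [set: M] `<=` nonbranching rho.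
  by apply: filterI => //; exact: nbhs_right_gt.
by move=> /filter_ex[rho [rho0 h]]; exists rho => // p; exact: h.
Qed.

End NonBranching.

(** * Rotations of the circle *)

Section Rotations.
Context {R : realType}.
Implicit Types (x y : circle R) (s t a b : R).

Local Open Scope quotient_scope.

Definition circle_repr (x : circle R) : R := repr (x : {eq_quot @circle_rel R}).

Lemma circle_ptP s t : circle_pt s = circle_pt t <-> exists m : int, s - t = 2 * pi * m%:~R.
Proof.
rewrite /circle_pt; split.
- by move/eqmodP => /asboolP.
- by move=> H; apply/eqmodP/asboolP.
Qed.

Lemma circle_ptK x : circle_pt (circle_repr x) = x.
Proof. exact: reprK. Qed.

Lemma circle_ptD s t a : circle_pt s = circle_pt t -> circle_pt (s + a) = circle_pt (t + a).
Proof.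
by move=> /circle_ptP[m E]; apply/circle_ptP; exists m; rewrite opprD addrACA subrr addr0.
Qed.

Lemma circle_shift_pt s a : circle_shift (circle_pt s) a = circle_pt (s + a).
Proof. by apply: circle_ptD; exact: circle_ptK. Qed.

Lemma circle_shiftD x a b : circle_shift (circle_shift x a) b = circle_shift x (a + b).
Proof. by rewrite -[x]circle_ptK !circle_shift_pt addrA. Qed.

Lemma circle_pt_period s (m : nat) : circle_pt (s + 2 * pi * m%:R) = circle_pt s.
Proof. by apply/circle_ptP; exists m; rewrite addrC addKr. Qed.

Lemma circle_shift_isometry a : circle_isometry (fun x => circle_shift x a).
Proof.
have K b x : circle_shift (circle_shift x b) (- b) = x.
  by rewrite -[x]circle_ptK !circle_shift_pt addrK.
have K' x : circle_shift (circle_shift x (- a)) a = x.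
  by have := K (- a) x; rewrite opprK.
split; first by exists (fun x => circle_shift x (- a)) => x; [exact: K|exact: K'].
have sub b x y : [set d | exists s t : R,
    [/\ circle_pt s = x, circle_pt t = y & d = `|s - t|]] `<=`
  [set d | exists s t : R, [/\ circle_pt s = circle_shift x b,
    circle_pt t = circle_shift y b & d = `|s - t|]].
  move=> d [s [t [sx ty ->]]]; exists (s + b), (t + b).
  by rewrite -sx -ty !circle_shift_pt opprD addrACA subrr addr0.
move=> x y; rewrite /circle_dist; congr inf; rewrite eqEsubset; split; last exact: sub.
by have := sub (- a) (circle_shift x a) (circle_shift y a); rewrite !K.
Qed.

End Rotations.

(** * Closed geodesics *)

Section ClosedGeodesic.
Context {R : realType} {n : nat} {M : riemannian_manifold R n}.
Implicit Types (c : R -> M) (gamma : circle R -> M) (a b s t v : R).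

Lemma minimizing_sub v c a b a' b' : a <= a' -> b' <= b ->
  minimizing v c a b -> minimizing v c a' b'.
Proof.
by move=> aa bb H s t as_ st tb; apply: H => //; [exact: le_trans as_|exact: le_trans bb].
Qed.

(** The length of a curve of constant metric speed is additive, so an arc that
    realizes the distance of its end points realizes it between any two of
    its points. *)
Lemma minimizing_of_ends v c a b :
  (forall s t, s <= t -> dist (c s) (c t) <= v * (t - s)) ->
  v * (b - a) <= dist (c a) (c b) -> minimizing v c a b.
Proof.
move=> up lo s t as_ st tb; apply/eqP; rewrite eq_le up//=.
have h1 := up _ _ as_; have h2 := up _ _ tb.
have h3 := dist_triangle (c a) (c s) (c b); have h4 := dist_triangle (c s) (c t) (c b).
lra.
Qed.

Lemma dist_le_curve_length c a b : a <= b ->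
  ((dist (c a) (c b))%:E <= curve_length c a b)%E.
Proof.
rewrite le_eqVlt => /orP[/eqP <-|ab]; apply: ereal_sup_ubound.
  by exists [::]; [by split => //=; exact: eqxx|rewrite big_geq// dist_refl].
by exists [:: b]; [exact: itv_partition1|rewrite /= big_nat1].
Qed.

(** Translating a partition of one interval gives a partition of the other. *)
Lemma curve_length_shift c (u : R) a b :
  (curve_length c (u + a)%R (u + b)%R <= curve_length (fun s => c (u + s)%R) a b)%E.
Proof.
apply: ge_ereal_sup => _ [s [sp sl] <-]; apply: ereal_sup_ubound.
pose f x := x - u.
have fK x : u + f x = x by rewrite /f addrC subrK.
have fb : f (u + b) = b by rewrite /f addrC addKr.
have fa : f (u + a) = a by rewrite /f addrC addKr.
exists [seq f x | x <- s].
  split.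
    rewrite -fa (homo_path (e := <%O)) // => x y; by rewrite ltrD2r.
  by rewrite -fa last_map (eqP sl) fb.
rewrite size_map; congr (_%:E); apply: eq_bigr => i _.
have E k : u + nth b (a :: [seq f x | x <- s]) k = nth (u + b) (u + a :: s) k.
  rewrite -{1}fa -map_cons; have [ks|ks] := ltnP k (size (u + a :: s)).
    by rewrite (nth_map (u + b))// fK.
  by rewrite !nth_default// size_map.
by rewrite !E.
Qed.

Let lift gamma t := gamma (circle_pt t).

Lemma closed_geodesic_dist_le gamma : closed_geodesic gamma -> forall s t, s <= t ->
  dist (lift gamma s) (lift gamma t) <= loop_length gamma / (2 * pi) * (t - s).
Proof.
move=> [_ len _] s t st; rewrite -lee_fin -len//.
exact: (@dist_le_curve_length (gamma \o @circle_pt R)).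
Qed.

(** A closed geodesic of length zero would be constant. *)
Lemma closed_geodesic_length_gt0 gamma : closed_geodesic gamma -> 0 < loop_length gamma.
Proof.
move=> geo; rewrite ltNge; apply/negP => L0.
have [[x [y xy]] _ _] := geo.
have same s t : s <= t -> lift gamma s = lift gamma t.
  move=> st; apply: dist_eq0; apply/eqP; rewrite eq_le dist_ge0 andbT.
  apply: le_trans (closed_geodesic_dist_le geo st) _.
  rewrite mulr_le0_ge0 ?subr_ge0// mulr_le0_ge0// invr_ge0 mulr_ge0// pi_ge0//.
apply: xy; rewrite -(circle_ptK x) -(circle_ptK y).
have [h|/ltW h] := leP (circle_repr x) (circle_repr y).
  exact: same.
by apply/esym; exact: same.
Qed.

Section OneOverK.
Context (k : nat) (gamma : circle R -> M) (t0 : circle R).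
Hypothesis k_gt0 : (0 < k)%N.
Let T : R := 2 * pi / k%:R.
Let v : R := loop_length gamma / (2 * pi).
Let c s := gamma (circle_shift t0 s).

Lemma shifted_dist_le : closed_geodesic gamma ->
  forall s t, s <= t -> dist (c s) (c t) <= v * (t - s).
Proof.
move=> geo s t st; have st' : circle_repr t0 + s <=
  circle_repr t0 + t by rewrite lerD2l.
by have := closed_geodesic_dist_le geo st'; rewrite opprD addrACA subrr add0r.
Qed.

Lemma one_over_geodesic_minimizing : one_over_geodesic k gamma ->
  forall a, minimizing v c a (a + T).
Proof.
move=> [geo H] a; apply: minimizing_of_ends; first exact: shifted_dist_le.
have := H (circle_shift t0 a); rewrite circle_shiftD.
rewrite -/T /c => ->; rewrite addrC addKr /v /T.
have pi0 : 2 * pi != 0 :> R by rewrite gt_eqF// mulr_gt0// pi_gt0.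
by rewrite mulrA divfK.
Qed.

(** As the injectivity radius is a supremum greater than [L / k], some minimizing
    arc issued from [t0] is longer than [L / k]; the constancy of the speed
    turns its length into a distance. *)
Lemma openly_one_over_geodesic_minimizing : openly_one_over_geodesic k gamma ->
  exists2 T' : R, T < T' & minimizing v c 0 T'.
Proof.
move=> [[geo _] inj]; have L0 := closed_geodesic_length_gt0 geo.
have p0 : 0 < 2 * pi :> R by rewrite mulr_gt0// pi_gt0.
have k0 : 0 < k%:R :> R by rewrite ltr0n.
have : ((loop_length gamma / k%:R)%:E < injrad_at gamma t0)%E.
  by apply: (lt_le_trans inj); apply: ereal_inf_lbound; exists t0.
move=> /ereal_sup_gt[_ [h [h0 arc] <-]]; rewrite lte_fin => kh.
exists (2 * pi * h / loop_length gamma).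
  rewrite /T ltr_pdivlMr// mulrAC -mulrA ltr_pM2l//.
pose u := circle_repr t0.
apply: minimizing_of_ends; first exact: shifted_dist_le.
rewrite -lee_fin; move: arc; rewrite /arc_minimizing /length_minimizing => <-.
have [_ len _] := geo.
set b := 2 * pi * h / loop_length gamma.
have b0 : 0 <= b.
  by apply: divr_ge0; [apply: mulr_ge0 => //; exact: ltW|exact: ltW].
have ub : u + 0 <= u + b by rewrite lerD2l.
have := len _ _ ub; rewrite -/v => E.
have := curve_length_shift (gamma \o @circle_pt R) u 0 b; rewrite E.
have -> : u + b - (u + 0) = b - 0 by ring.
by move=> le_len; exact: le_len.
Qed.

End OneOverK.

End ClosedGeodesic.

Unset Implicit Arguments.

Theorem lemma9p1 (R : realType) (n : nat) (M : riemannian_manifold R n)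
    (M_compact : compact [set: M]) (k : nat) (k_gt0 : (0 < k)%N)
    (gamma sigma : circle R -> M)
    (gamma_geod : openly_one_over_geodesic k gamma)
    (sigma_geod : openly_one_over_geodesic k sigma)
    (s0 t0 : circle R)
    (agree : forall j : nat, (j < k)%N ->
       sigma (circle_shift s0 (2 * pi * j%:R / k%:R)) =
       gamma (circle_shift t0 (2 * pi * j%:R / k%:R))) :
  exists2 phi : circle R -> circle R,
    circle_isometry phi & sigma = gamma \o phi.
Proof.
have p0 : 0 < 2 * pi :> R by rewrite mulr_gt0// pi_gt0.
have k0 : 0 < k%:R :> R by rewrite ltr0n.
pose T : R := 2 * pi / k%:R; have T0 : 0 < T by rewrite divr_gt0.
pose c s := gamma (circle_shift t0 s); pose d s := sigma (circle_shift s0 s).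
have geoc := gamma_geod.1; have geod := sigma_geod.1.
pose v := loop_length gamma / (2 * pi).
have v0 : 0 < v by rewrite divr_gt0// closed_geodesic_length_gt0//; case: geoc.
have per (f : circle R -> M) x s (m : nat) :
    f (circle_shift x (s + 2 * pi * m%:R)) = f (circle_shift x s).
  by rewrite -[x]circle_ptK !circle_shift_pt addrA circle_pt_period.
have cd0 : c 0 = d 0.
  by have := agree 0%N k_gt0; rewrite mulr0 mul0r.
have cdT : c T = d T.
  have [k1|k1] := ltnP 1 k; first by have := agree 1%N k1; rewrite mulr1.
  have kE : k = 1%N by apply/eqP; rewrite eqn_leq k1.
  have TE : T = 0 + 2 * pi * 1%:R by rewrite /T kE divr1 add0r mulr1.
  by rewrite /c /d TE !per.
have cmin := one_over_geodesic_minimizing t0 geoc.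
have dmin := one_over_geodesic_minimizing s0 geod.
rewrite -/T -/v -/c in cmin; rewrite -/T -/d in dmin.
(* both geodesics realize the distance of the first two common points *)
have vE : loop_length sigma / (2 * pi) = v.
  have h1 := cmin 0 0 T; have h2 := dmin 0 0 T.
  move: h1 h2; rewrite add0r !lexx ltW// cd0 cdT => /(_ isT isT isT) -> /(_ isT isT isT).
  have Tn0 : T != 0 by rewrite gt_eqF.
  by rewrite subr0 => /(mulIf Tn0).
rewrite vE in dmin.
have [Tc TTc cmin0] := openly_one_over_geodesic_minimizing t0 k_gt0 gamma_geod.
have [Td TTd dmin0] := openly_one_over_geodesic_minimizing s0 k_gt0 sigma_geod.
rewrite -/T -/v -/c in TTc cmin0; rewrite -/T -/d vE in TTd dmin0.
pose T' := Num.min Tc Td; have TT' : T < T' by rewrite lt_min TTc.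
have T'c : T' <= Tc by rewrite ge_min lexx.
have T'd : T' <= Td by rewrite ge_min lexx orbT.
(* [u] is minimizing because its length on [[0, t]] is that of [c], which
   realizes the distance of the common end points *)
pose u s := if s <= T then d s else c s.
have uc s : T <= s -> u s = c s.
  rewrite /u le_eqVlt => /orP[/eqP <-|sT]; first by rewrite lexx cdT.
  by rewrite leNgt sT.
have ud s : s <= T -> u s = d s by rewrite /u => ->.
have umin : minimizing v u 0 T'.
  move=> s t s0' st tT'.
  have [tT|Tt] := leP t T.
    rewrite !ud//; last exact: le_trans tT.
    by apply: dmin0 => //; exact: le_trans T'd.
  have [Ts|sT] := leP T s.
    rewrite !uc//; last exact: ltW.
    by apply: cmin0 => //; exact: le_trans T'c.
  rewrite (ud s) ?(ltW sT)// (uc t) ?(ltW Tt)//.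
  have h1 := dmin0 s T s0' (ltW sT) (ltW TTd).
  have h2 := cmin0 T t (ltW T0) (ltW Tt) (le_trans tT' T'c).
  have h3 := cmin0 0 t (lexx _) (ltW (lt_trans T0 Tt)) (le_trans tT' T'c).
  have h4 := dmin0 0 s (lexx _) s0' (le_trans (ltW sT) (ltW TTd)).
  have h5 := dist_triangle (c 0) (d s) (c t).
  have h6 := dist_triangle (d s) (d T) (c t).
  rewrite -cdT in h1 h6; rewrite -cd0 in h4.
  apply/eqP; rewrite eq_le; apply/andP; split; lra.
have [rho rho0 NB] := uniform_nonbranching M_compact.
(* [w] is the length of a step: minimizing arcs over intervals of length [2 * w]
   that agree on the first half agree on the second *)
pose w := Num.min (T / 2) (Num.min (T' - T) (rho / (2 * v))).
have TT0 : 0 < T' - T by rewrite subr_gt0.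
have w0 : 0 < w by rewrite !lt_min TT0 !divr_gt0// mulr_gt0.
have wT : w <= T / 2 by rewrite ge_min lexx.
have wT' : w <= T' - T by rewrite !ge_min lexx orbT.
have wv : v * (2 * w) <= rho.
  have : w <= rho / (2 * v) by rewrite !ge_min lexx !orbT.
  have v2 : 0 < 2 * v by rewrite mulr_gt0.
  rewrite ler_pdivlMr// => wrho.
  by have -> : v * (2 * w) = w * (2 * v) by ring.
have vw b : b <= 2 * w -> v * b <= rho.
  by move=> bw; apply: le_trans wv; rewrite ler_pM2l.
have first_step b : T <= b -> b <= T + w -> c b = d b.
  rewrite le_eqVlt => /orP[/eqP <-//|Tb bw].
  rewrite -(uc b (ltW Tb)).
  apply: (NB (u (T - w)) u d v (T - w) T b) => //.
  - by apply: minimizing_sub umin; lra.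
  - by apply: minimizing_sub dmin0; lra.
  - by lra.
  - exact: ltW.
  - by move=> t _ tT; exact: ud.
  - by apply: vw; lra.
have steps (N : nat) b : T <= b -> b <= T + w * N.+1%:R -> c b = d b.
  elim: N b => [b|N IH b Tb bN]; first by rewrite mulr1; exact: first_step.
  have NN : w * N.+1%:R = w * N%:R + w by rewrite -natr1 mulrDr mulr1.
  have wN : 0 <= w * N%:R by rewrite mulr_ge0// ltW.
  have [bN'|bN'] := leP b (T + w * N.+1%:R); first exact: IH.
  have bN2 : b <= T + w * N.+1%:R + w by move: bN; rewrite -natr1 mulrDr mulr1; lra.
  pose m := T + w * N.+1%:R.
  apply: (NB (c (m - w)) c d v (m - w) m b) => //.
  - by apply: minimizing_sub (cmin (m - w)); rewrite /m; lra.
  - by apply: minimizing_sub (dmin (m - w)); rewrite /m; lra.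
  - by lra.
  - exact: ltW.
  - by move=> t t1 t2; apply: IH => //; move: t1; rewrite /m NN; lra.
  - by apply: vw; rewrite /m; lra.
have cd s : c s = d s.
  (* by periodicity [s] may be assumed to lie beyond [T] *)
  pose m := (Num.truncn ((T - s) / (2 * pi))).+1.
  have ms : T <= s + 2 * pi * m%:R.
    have := @truncnS_gt R ((T - s) / (2 * pi)); rewrite -/m ltr_pdivrMr// => h.
    by lra.
  pose b := s + 2 * pi * m%:R.
  suff : c b = d b by rewrite /c /d /b !per.
  pose N := Num.truncn ((b - T) / w).
  apply: (steps N) => //.
  have := @truncnS_gt R ((b - T) / w); rewrite -/N ltr_pdivrMr// => h.
  by lra.
exists (fun x => circle_shift x (circle_repr t0 - circle_repr s0)).
  exact: circle_shift_isometry.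
apply/funext => x /=.
pose a := circle_repr x - circle_repr s0.
have H : gamma (circle_pt (circle_repr t0 + a)) = sigma (circle_pt (circle_repr s0 + a)).
  exact: cd a.
have -> : sigma x = sigma (circle_pt (circle_repr s0 + a)).
  by rewrite /a addrC subrK circle_ptK.
rewrite -H; congr gamma.
rewrite -[RHS]/(circle_pt (circle_repr x + (circle_repr t0 - circle_repr s0))).
by congr circle_pt; rewrite /a addrCA.
Qed.
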